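(* Let $\pi$ be a fixed meta-prior on $\mathcal{A}$, let $\mathfrak{P}(A)$, $A\in\mathcal{A}$, be a fixed (data-independent) family as below, and let $\delta>0$. Then with probability at least $1-\delta$ over the sampling of the training tasks and datasets, simultaneously for all meta-posteriors $\rho$ and all hyper-posteriors $\mathcal{Q}(A)$, $$\mathcal{R}^T_M(\rho)\;\le\;\mathrm{kl}^{-1}_n\!\left(\mathrm{kl}^{-1}_{m_1,\dots,m_n}\Big(\widehat{\mathcal{R}}_1(\rho),\dots,\widehat{\mathcal{R}}_n(\rho)\,\Big|\,C(\rho)+c_1\Big)\,\Big|\,\mathrm{KL}(\rho\|\pi)+\log\frac{4\sqrt n}{\delta}\right),$$ where $C(\rho)=\mathrm{KL}(\rho\|\pi)+\mathbb{E}_{A\sim\rho}\big[\mathrm{KL}(\mathfrak{Q}(A)\|\mathfrak{P}(A))\big]+\log\frac2\delta$ and $c_1=\sum_{i=1}^n\log(2\sqrt{m_i})$.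
   Context: Meta-learning setting: $\tau$ is an unknown environment distribution over triples $(D,m,S)$, where $D$ is a distribution on $\mathcal{Z}$, $m\in\{1,\dots,m_{\max}\}$ and, given $(D,m)$, $S$ consists of $m$ i.i.d. samples from $D$. Training tasks $(D_i,m_i,S_i)$, $i=1,\dots,n$, are i.i.d. from $\tau$. A loss $\ell:\mathcal{F}\times\mathcal{Z}\to[0,1]$ is fixed; for a distribution $Q$ on $\mathcal{F}$, $\ell(z,Q)=\mathbb{E}_{f\sim Q}\ell(f,z)$. $\mathcal{A}$ is a set of algorithms; each $A\in\mathcal{A}$ maps a dataset $S$ to a posterior $A(S)\in\mathcal{M}(\mathcal{F})$ (distributions on $\mathcal{F}$). A meta-prior $\pi$ (data-independent) and meta-posterior $\rho$ are distributions on $\mathcal{A}$. For each $A$: $\mathcal{P}(A)$ is a data-independent hyper-prior (distribution on $\mathcal{M}(\mathcal{F})$) and $\mathcal{Q}(A)$ a data-dependent hyper-posterior; $\mathfrak{Q}(A)=\mathcal{Q}(A)\times A(S_1)\times\cdots\times A(S_n)$ on $\mathcal{M}(\mathcal{F})\times\mathcal{F}^n$, and $\mathfrak{P}(A)$ is generated by $P\sim\mathcal{P}(A)$, then $f_1,\dots,f_n$ i.i.d. $\sim P$. Empirical risks: $\widehat{\mathcal{R}}_i(\rho)=\mathbb{E}_{A\sim\rho}\frac1{m_i}\sum_{z\in S_i}\ell(z,A(S_i))$. Task-centric meta-risk: $\mathcal{R}^T_M(\rho)=\mathbb{E}_{A\sim\rho}\mathbb{E}_{(D,m,S)\sim\tau}\mathbb{E}_{z\sim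 D}\ell(z,A(S))$. $\mathrm{kl}(q|p)=q\log\frac qp+(1-q)\log\frac{1-q}{1-p}$. Inverses: $\mathrm{kl}^{-1}_{m_1,\dots,m_n}(q_1,\dots,q_n|b)=\sup\{\frac1n\sum_i p_i:\sum_i m_i\mathrm{kl}(q_i|p_i)\le b,\ p_i\in[0,1]\}$, and for a single integer $N$, $\mathrm{kl}^{-1}_N(q|b)=\sup\{p\in[0,1]:N\,\mathrm{kl}(q|p)\le b\}$. $\mathrm{KL}$ is the Kullback–Leibler divergence. *)

(* Defs.v *)
From HB Require Import structures.
From mathcomp Require Import all_boot all_order all_algebra.
From mathcomp Require Import all_classical all_reals all_analysis measurable_realfun giry.
Import Order.TTheory GRing.Theory Num.Theory.
Set Implicit Arguments.
Unset Strict Implicit.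
Unset Printing Implicit Defensive.
Local Open Scope classical_set_scope.
Local Open Scope ring_scope.

(* M(X) is represented inside the measurable type [giry X R] (subprobability
   measures with the sigma-algebra generated by the evaluation maps); a
   distribution on M(X) is a probability on [giry X R] giving mass 1 to the
   (measurable) set of probability measures. *)
Definition on_prob_measures {R : realType} {d} {X : measurableType d}
  (H : probability (giry X R) R) : Prop :=
  H [set P : giry X R | P setT = 1%E] = 1%E.

Definition xlog_ratio {R : realType} (a b : R) : \bar R :=
  if a == 0 then 0%E else if b == 0 then +oo%E else (a * ln (a / b))%:E.

Definition kl {R : realType} (q p : R) : \bar R :=
  (xlog_ratio q p + xlog_ratio (1 - q) (1 - p))%E.

Definition klinv {R : realType} (N : nat) (q : R) (b : \bar R) : R :=
  sup [set p : R | 0 <= p <= 1 /\ (N%:R%:E * kl q p <= b)%E].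

Definition klinv_multi {R : realType} (n : nat) (ms : 'I_n -> nat)
  (qs : 'I_n -> R) (b : \bar R) : R :=
  sup [set x : R | exists ps : 'I_n -> R,
         (forall i, 0 <= ps i <= 1) /\
         (\sum_(i < n) (ms i)%:R%:E * kl (qs i) (ps i) <= b)%E /\
         x = n%:R^-1 * \sum_(i < n) ps i].

Definition is_density {R : realType} {d} {T : measurableType d}
  (Q P : probability T R) (h : T -> R) : Prop :=
  [/\ measurable_fun setT h, (forall x, 0 <= h x) &
      forall B, measurable B -> Q B = (\int[P]_(x in B) (h x)%:E)%E].

(* KL(Q||P) = E_Q[log dQ/dP] if Q << P, and +oo otherwise (inf of the empty
   set).  The value does not depend on the version of the density. *)
Definition KL {R : realType} {d} {T : measurableType d}
  (Q P : probability T R) : \bar R :=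
  ereal_inf [set (\int[Q]_x (ln (h x))%:E)%E | h in is_density Q P].

(* A task is a triple (D, m, S); S is stored padded to length mmax: the
   dataset is the first m entries [take m S]. *)
Notation task Z R mmax := ((giry Z R * nat) * mmax.-tuple Z)%type.

Definition dataset {R : realType} {d} {Z : measurableType d} {mmax : nat}
  (t : task Z R mmax) : seq Z := take t.1.2 t.2.

(* tau is the law of (D, m, S) where (D, m) ~ mu and, given (D, m), the
   entries of S are i.i.d. ~ D *)
Definition env_law {R : realType} {d} {Z : measurableType d} (mmax : nat)
  (mu : probability (giry Z R * nat)%type R) (tau : probability (task Z R mmax) R)
  : Prop :=
  forall (B : set (giry Z R * nat)%type) (C : 'I_mmax -> set Z),
    measurable B -> (forall j, measurable (C j)) ->
    tau [set t | B t.1 /\ forall j, C j (tnth t.2 j)] =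
    (\int[mu]_(e in B) (\prod_(j < mmax) fine (e.1 (C j)))%:E)%E.

Definition iid_law {R : realType} {d} {T : measurableType d} (n : nat)
  (tau : probability T R) (Pr : probability (n.-tuple T) R) : Prop :=
  forall G : 'I_n -> set T, (forall i, measurable (G i)) ->
    Pr [set w | forall i, G i (tnth w i)] = (\prod_(i < n) fine (tau (G i)))%:E.

(* frakP = law of (P, f_1, ..., f_n) with P ~ calP and f_i i.i.d. ~ P *)
Definition hyperprior_law {R : realType} {d} {F : measurableType d} (n : nat)
  (calP : probability (giry F R) R)
  (frakP : probability (giry F R * n.-tuple F)%type R) : Prop :=
  forall (B0 : set (giry F R)) (Bs : 'I_n -> set F),
    measurable B0 -> (forall i, measurable (Bs i)) ->
    frakP [set x | B0 x.1 /\ forall i, Bs i (tnth x.2 i)] =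
    (\int[calP]_(P in B0) (\prod_(i < n) fine (P (Bs i)))%:E)%E.

Definition hyperpost_law {R : realType} {d} {F : measurableType d} (n : nat)
  (calQ : probability (giry F R) R) (post : 'I_n -> probability F R)
  (frakQ : probability (giry F R * n.-tuple F)%type R) : Prop :=
  forall (B0 : set (giry F R)) (Bs : 'I_n -> set F),
    measurable B0 -> (forall i, measurable (Bs i)) ->
    frakQ [set x | B0 x.1 /\ forall i, Bs i (tnth x.2 i)] =
    (calQ B0 * (\prod_(i < n) fine (post i (Bs i)))%:E)%E.

Definition loss_post {R : realType} {dF dZ} {F : measurableType dF}
  {Z : measurableType dZ} (ell : F -> Z -> R) (z : Z) (Q : probability F R) : R :=
  fine (\int[Q]_f (ell f z)%:E)%E.

Definition emp_risk {R : realType} {dA dF dZ} {Alg : measurableType dA}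
  {F : measurableType dF} {Z : measurableType dZ}
  (alg : Alg -> seq Z -> probability F R) (ell : F -> Z -> R)
  (rho : probability Alg R) (S : seq Z) : R :=
  fine (\int[rho]_a ((size S)%:R^-1 *
                      \sum_(z <- S) loss_post ell z (alg a S))%:E)%E.

Definition meta_risk {R : realType} {dA dF dZ} {Alg : measurableType dA}
  {F : measurableType dF} {Z : measurableType dZ} {mmax : nat}
  (alg : Alg -> seq Z -> probability F R) (ell : F -> Z -> R)
  (tau : probability (task Z R mmax) R) (rho : probability Alg R) : \bar R :=
  (\int[rho]_a \int[tau]_t \int[t.1.1]_z
     (loss_post ell z (alg a (dataset t)))%:E)%E.

(* Main.v *)
(** The unconditional ingredient is an e-value: for samples x_j in [0, 1] of
    mean p, the Krichevsky-Trofimov mixture of the likelihood ratios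
    prod_(j in J) (x_j / p) prod_(j notin J) ((1 - x_j) / (1 - p)) has
    expectation at most 1 and dominates exp(m kl(mean x | p)) / (2 sqrt m).
    Since kl(q | p) is the supremum over r, s > 0 of the forms
    q ln r + (1 - q) ln s + 1 - p r - (1 - p) s, which are affine in (q, p), it
    suffices to bound these forms: they are bounded, and they commute with
    averaging over the posteriors, so that Jensen's inequality is not needed.

    Tonelli and Markov give two events of probability at least 1 - delta / 2:
    one for the product over the tasks of the e-values of (f_1, ..., f_n),
    averaged over A ~ pi and f ~ frakP A, and one for the e-value of the n task
    risks averaged over A ~ pi.  On their intersection, the Donsker-Varadhan
    inequality applied to the forms yields the two kl bounds, which are chained
    by monotonicity of kl.

    As [frakP] is not assumed to be a measurable kernel, the joint prior
    pi (x) frakP does not make sense as a measure.  It is replaced by the measure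
    M whose outer measure comes from the content X |-> L (A |-> frakP A (X_A)),
    where L is a finitely additive extension of the expectation under pi to all
    bounded functions (Hahn-Banach).  The chain rule
    E_(rho, Q) phi <= KL(rho || pi) + E_rho KL(Q_A || P_A) + ln E_M (exp phi)
    survives. *)
Require Import Defs.
From HB Require Import structures.
From mathcomp Require Import all_boot all_order all_algebra.
From mathcomp Require Import all_classical all_reals all_analysis measurable_realfun giry.
From mathcomp Require Import ring lra.
Import Order.TTheory GRing.Theory Num.Theory.
Set Implicit Arguments.
Unset Strict Implicit.
Unset Printing Implicit Defensive.
Local Open Scope classical_set_scope.
Local Open Scope ring_scope.

(** * Krichevsky-Trofimov mixtures and binary relative entropy *)

(** The bounds hold for all posteriors at once because of the order of choices: each e-value has
    mean at most 1 for a fixed algorithm and fixed predictors, and it is mixed by a measure fixed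
    before the data. One event therefore serves every [rho] and [frakQ].

    Each e-value costs a factor 2 sqrt(sample size). The product of these factors over the tasks
    gives [c1]; at the level of tasks, with Markov's inequality at 2 / delta, the factor becomes 2
    sqrt n * 2 / delta = 4 sqrt n / delta.

    The main obstacle is that A |-> E_(frakP A) exp phi may have no integral under [pi]. Passing to
    the outer measure restores countable additivity, but [M] can be strictly smaller than the
    content, so a change of measure towards [M] is a stronger claim than one towards the content. It
    is recovered by covering the level sets of phi with countably many sets whose contents nearly
    add up to the [M]-mass, and by using finitely many of them at a time. *)

Section elementary.
Variable R : realType.
Implicit Types (x y u s : R) (a b k l : nat).

(** The difference of the two sides vanishes at 0 and has derivative 1 - (1 - x) exp x, which is
    nonnegative because exp (- x) >= 1 - x. The quotient (2 + y) / (2 - y) is the first diagonal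
    Padé approximant of exp. *)
Lemma expR_pade y : 0 <= y -> (2 - y) * expR y <= 2 + y.
Proof.
move=> y0; have [->|yn0] := eqVneq y 0; first by rewrite expR0; lra.
have {y0 yn0}y0 : 0 < y by rewrite lt_neqAle eq_sym yn0.
pose f x := 2 + x - (2 - x) * expR x.
pose f' x := 1 - (1 - x) * expR x.
have df x : is_derive x 1 f (f' x).
  rewrite /f /f'; apply: is_derive_eq.
  by rewrite /GRing.scale/=; ring.
have [|c] := @MVT _ f f' 0 y y0 (fun x _ => df x).
  by apply: derivable_within_continuous => x _; apply: ex_derive.
rewrite in_itv/= => /andP[c0 cy] E.
have : 0 <= f' c.
  have e := expRxMexpNx_1 c; have := expR_ge1Dx (- c).
  have := expR_gt0 c; rewrite /f'; move: (expR c) (expR (- c)) e => p q e p0 h.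
  nra.
move=> f'0.
have : 0 <= f y - f 0 by rewrite E; rewrite mulr_ge0// subr0 ltW.
by rewrite /f expR0; lra.
Qed.

(** The function 1 / x is convex, so its integral over [s, s + 1] is at least its value at the
    midpoint. With y the inverse of the midpoint, (s + 1) / s = (2 + y) / (2 - y). *)
Lemma ln_midpoint s : 0 < s -> 1 <= (s + 2^-1) * (ln (s + 1) - ln s).
Proof.
move=> s0; pose y := (s + 2^-1)^-1.
have y0 : 0 < y by rewrite invr_gt0; lra.
rewrite -ln_div ?posrE//; last lra.
rewrite -ler_pdivrMl ?mulr1; last lra.
rewrite -/y -ler_expR lnK ?posrE; last by rewrite divr_gt0//; lra.
have := expR_pade (ltW y0).
have -> : (s + 1) / s = (2 + y) / (2 - y).
  by rewrite /y; field; rewrite !gt_eqF//; lra.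
have y2 : y < 2.
  by rewrite /y -[2]invrK ltf_pV2 ?posrE; lra.
by rewrite ler_pdivlMr ?subr_gt0// mulrC.
Qed.

(** The difference of the two sides vanishes at 0 and has derivative - ln (1 - x^2) >= 0. *)
Lemma entropy_bound u : 0 < u -> u < 1 ->
  (1 + u) * ln (1 + u) - (1 - u) * ln (1 - u) <= 2 * u.
Proof.
move=> u0 u1.
pose f x := 2 * x - ((1 + x) * ln (1 + x) - (1 - x) * ln (1 - x)).
pose f' x := - (ln (1 + x) + ln (1 - x)).
have df x : 0 <= x < 1 -> is_derive x 1 f (f' x).
  move=> /andP[x0 x1].
  have p1 : 0 < 1 + x by lra.
  have p2 : 0 < 1 - x by lra.
  have := is_derive1_ln p1; have := is_derive1_ln p2.
  move=> d2 d1.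
  have g1 : is_derive x 1 (fun x : R => 1 + x) 1.
    have := is_deriveD (is_derive_cst (1:R) x (1:R)) (is_derive_id x (1:R)); rewrite add0r; exact.
  have g2 : is_derive x 1 (fun x : R => 1 - x) (-1).
    have := is_deriveB (is_derive_cst (1:R) x (1:R)) (is_derive_id x (1:R)); rewrite add0r; exact.
  have e1 : is_derive x 1 (fun x => ln (1 + x)) (1 + x)^-1.
    by have := @is_derive1_comp _ (@ln R) (fun x => 1 + x) x _ _ d1 g1; rewrite mulr1.
  have e2 : is_derive x 1 (fun x => ln (1 - x)) (- (1 - x)^-1).
    by have := @is_derive1_comp _ (@ln R) (fun x => 1 - x) x _ _ d2 g2; rewrite mulrN1.
  have h := is_deriveB (is_deriveM g1 e1) (is_deriveM g2 e2).
  have h2 : is_derive x 1 (fun x => 2 * x) 2.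
    have := is_deriveZ 2 (is_derive_id x (1:R)); rewrite /GRing.scale/= mulr1; exact.
  have E : 2 - ((1 + x) * (1 + x)^-1 + ln (1 + x) * 1 -
      ((1 - x) * - (1 - x)^-1 + ln (1 - x) * (-1))) = f' x; last by have D := is_deriveB h2 h; rewrite -E; exact: D.
  by rewrite /f' mulrN !divff ?gt_eqF//; lra.
have d01 x : x \in `]0, u[%R -> is_derive x 1 f (f' x).
  by rewrite in_itv/= => /andP[x0 xu]; apply: df; lra.
have [|c] := @MVT _ f f' 0 u u0 d01.
  apply: derivable_within_continuous => x; rewrite in_itv/= => /andP[x0 xu].
  have d : is_derive x 1 f (f' x) by apply: df; lra.
  exact: ex_derive.
rewrite in_itv/= => /andP[c0 cu] E.
have : 0 <= f' c.
  rewrite /f' oppr_ge0 -lnM ?posrE; [|lra|lra].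
  by apply: ln_le0; nra.
move=> f'0.
have : 0 <= f u - f 0 by rewrite E mulr_ge0// subr0 ltW.
by rewrite /f subr0 addr0 ln1; lra.
Qed.

(** Since x ln x has derivative 1 + ln x, this is the midpoint inequality for the concave function
    ln on [a, a + 1]. For [a = 0] the default [ln 0 = 0] is harmless, and the claim reduces to ln 2
    <= 1. *)
Lemma xlnx_step a :
  a.+1%:R * ln a.+1%:R - a%:R * ln a%:R - ln (a%:R + 2^-1) <= 1 :> R.
Proof.
case: a => [|a].
  rewrite mul0r subr0 add0r mul1r ln1 add0r lnV ?posrE// opprK.
  by have := @le_ln1Dx R 1; rewrite -natr1 ; apply; lra.
pose x : R := a.+1%:R; have x1 : 1 <= x by rewrite /x ler1n.
rewrite -[a.+2]addn1 natrD -/x.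
(* [c] is the midpoint and [u] the half-width relative to it, so that the endpoints are c (1 - u)
   and c (1 + u). *)
pose c := x + 2^-1; pose u := (2 * c)^-1.
have c0 : 0 < c by rewrite /c; lra.
have u0 : 0 < u by rewrite invr_gt0; lra.
have u1 : u < 1 by rewrite invf_lt1; rewrite /c; lra.
have E1 : x + 1 = c * (1 + u) by rewrite /u/c; field; rewrite gt_eqF//; lra.
have E2 : x = c * (1 - u) by rewrite /u/c; field; rewrite gt_eqF//; lra.
rewrite -/c E1 {1 2}E2 !lnM ?posrE//; [|lra|lra].
have := entropy_bound u0 u1.
have cu : 2 * c * u = 1 by rewrite /u mulfV// gt_eqF//; lra.
have -> : c * (1 + u) * (ln c + ln (1 + u)) - c * (1 - u) * (ln c + ln (1 - u)) - ln c
  = c * ((1 + u) * ln (1 + u) - (1 - u) * ln (1 - u)) + (2 * c * u - 1) * ln c by ring.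
rewrite cu subrr mul0r addr0 => h.
by rewrite -[leRHS]cu [2 * c]mulrC -mulrA ler_pM2l.
Qed.

(* Probability that the Krichevsky-Trofimov estimator gives to a given binary
   word with [a] ones and [b] zeros. *)
Definition kt a b : R :=
  (\prod_(i < a) (i%:R + 2^-1)) * (\prod_(i < b) (i%:R + 2^-1)) / (a + b)`!%:R.

Lemma ktC a b : kt a b = kt b a.
Proof. by rewrite /kt addnC [X in X / _]mulrC. Qed.

Lemma kt_gt0 a b : 0 < kt a b.
Proof.
rewrite /kt divr_gt0 ?ltr0n ?fact_gt0//.
by apply: mulr_gt0; apply: prodr_gt0 => i _; rewrite ltr_wpDl.
Qed.

Lemma ktS a b : kt a.+1 b = kt a b * ((a%:R + 2^-1) / (a + b).+1%:R).
Proof.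
rewrite /kt big_ord_recr/= addSn factS natrM; field.
by rewrite -natrD nat1r !pnatr_eq0/= -lt0n fact_gt0.
Qed.

(** The estimator gives the next letter the probabilities (a + 1/2) / (a + b + 1) and (b + 1/2) / (a
    + b + 1), which sum to 1. *)
Lemma kt_split a b : kt a.+1 b + kt a b.+1 = kt a b.
Proof.
rewrite ktS [kt a b.+1]ktC ktS [kt b a]ktC [(b + a)%N]addnC -mulrDr -mulrDl.
have -> : a%:R + 2^-1 + (b%:R + 2^-1) = (a + b).+1%:R :> R.
  by rewrite -[in RHS]addn1 !natrD; field.
by rewrite divff ?mulr1// pnatr_eq0.
Qed.

Let xlnx a : R := a%:R * ln a%:R.

(** Appending a one: [xlnx_step] bounds the change of [xlnx a], and with N = a + b what remains to
    show is 1 <= (N + 1/2) (ln (N + 1) - ln N), which is [ln_midpoint]. *)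
Let kt_lbS a b : (0 < a + b)%N ->
  xlnx a + xlnx b - xlnx (a + b) <= ln (2 * kt a b) + 2^-1 * ln (a + b)%:R ->
  xlnx a.+1 + xlnx b - xlnx (a.+1 + b) <=
    ln (2 * kt a.+1 b) + 2^-1 * ln (a.+1 + b)%:R.
Proof.
move=> ab0; have a0 : 0 < a%:R + 2^-1 :> R by rewrite ltr_wpDl.
have k0 : 0 < 2 * kt a b by rewrite mulr_gt0// kt_gt0.
have n0 : 0 < (a + b).+1%:R :> R by rewrite ltr0n.
move=> h; rewrite ktS mulrA lnM ?posrE ?divr_gt0// ln_div ?posrE//; move: h.
have s0 : 0 < (a + b)%:R :> R by rewrite ltr0n.
have := ln_midpoint s0; have := xlnx_step a.
rewrite /xlnx addSn -(natr1 (a + b)).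
move: (ln (2 * _)) (ln (_ + 2^-1)) (ln ((a + b)%:R + 1)) (ln (a + b)%:R) => K A B C.
move: (a.+1%:R * _) (a%:R * _) (b%:R * _) (a + b)%:R => p q r s; lra.
Qed.

(** The left side is the logarithm of the maximal likelihood (a/m)^a (b/m)^b with m = a + b, so this
    is the regret bound of the estimator. Equality holds for a word of one letter, which is where
    the factor 2 comes from. *)
Lemma kt_lb a b : (0 < a + b)%N ->
  xlnx a + xlnx b - xlnx (a + b) <= ln (2 * kt a b) + 2^-1 * ln (a + b)%:R.
Proof.
have kt01 : 2 * kt 0 1 = 1.
  by rewrite /kt big_ord0 big_ord1 mul1r add0r (_ : (0 + 1)`! = 1%N)// divr1 mulfV.

have b0 b' : xlnx 0 + xlnx b'.+1 - xlnx (0 + b'.+1) <=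
    ln (2 * kt 0 b'.+1) + 2^-1 * ln (0 + b'.+1)%:R.
  elim: b' => [|b' ih].
    by rewrite kt01 /xlnx !add0n ln1; lra.
  move: ih; rewrite !add0n [xlnx 0 + _]addrC [xlnx 0 + _]addrC.
  rewrite [kt 0 b'.+1]ktC [kt 0 b'.+2]ktC -[in X in X -> _](addn0 b'.+1) => ih.
  by have := @kt_lbS b'.+1 0 isT; rewrite -[b'.+2](addn0) !addn0; apply; move: ih; rewrite !addn0.
case: b => [|b]; last first.
  move=> _; elim: a => [|a ih]; first exact: b0.
  by apply: kt_lbS => //; rewrite addnS.
case: a => // a _; have := b0 a.
by rewrite [xlnx 0 + _]addrC ktC add0n addn0.
Qed.

Lemma kt_dominates a b x : (0 < a + b)%N -> 0 <= x <= 1 ->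
  x ^+ a * (1 - x) ^+ b <= 2 * Num.sqrt (a + b)%:R * kt a b.
Proof.
move=> ab0 /andP[x0 x1]; have := kt_lb ab0.
set m := (a + b)%N => h.
have m0 : 0 < m%:R :> R by rewrite ltr0n.
(* This is ln u <= u - 1 at u = p m / k. In the product over both letters the terms p m - k cancel,
   because x m + (1 - x) m = a + b, and only the maximal likelihood is left. *)
have key k (p : R) : 0 <= p -> p ^+ k <= expR (p * m%:R - k%:R + k%:R * (ln k%:R - ln m%:R)).
  move=> p0; case: k => [|k].
    by rewrite mul0r expr0 addr0 subr0 -expR0 ler_expR mulr_ge0// ltW.
  have [->|pn0] := eqVneq p 0; first by rewrite expr0n/= expR_ge0.
  have {p0 pn0}p0 : 0 < p by rewrite lt_neqAle eq_sym pn0.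
  rewrite -[leLHS](lnK) ?posrE ?exprn_gt0// ler_expR lnXn// -[ln p *+ _]mulr_natl.
  have k0 : 0 < k.+1%:R :> R by rewrite ltr0n.
  have : ln (p * m%:R / k.+1%:R) <= p * m%:R / k.+1%:R - 1.
    have q0 : 0 < p * m%:R / k.+1%:R by rewrite divr_gt0// mulr_gt0.
    move: (p * _ / _) q0 => q q0; have := @le_ln1Dx R (q - 1).
    by rewrite [1 + _]addrC subrK; apply; lra.
  rewrite ln_div ?posrE ?mulr_gt0// lnM ?posrE// => e.
  have : k.+1%:R * (ln p + ln m%:R - ln k.+1%:R) <= k.+1%:R * (p * m%:R / k.+1%:R - 1).
    by rewrite ler_pM2l.
  have -> : k.+1%:R * (p * m%:R / k.+1%:R - 1) = p * m%:R - k.+1%:R by field; rewrite nat1r pnatr_eq0.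
  rewrite !mulrBr !mulrDr; move: (_ * ln p) (_ * ln m%:R) (_ * ln k.+1%:R) (p * _) => *; lra.
have s0 : 0 < 2 * Num.sqrt m%:R * kt a b.
  by apply: mulr_gt0; [apply: mulr_gt0 => //; rewrite sqrtr_gt0 | exact: kt_gt0].
apply: (le_trans (ler_pM _ _ (key a x x0) (key b (1 - x) _))); rewrite ?exprn_ge0//; [lra|lra|].
rewrite -expRD -[leRHS]lnK ?posrE// ler_expR.
have k2 : 0 < 2 * kt a b by rewrite mulr_gt0// kt_gt0.
rewrite mulrAC lnM ?posrE ?sqrtr_gt0//.
have -> : ln (Num.sqrt m%:R) = 2^-1 * ln m%:R :> R.
  by rewrite -powR12_sqrt ?ltW// ln_powR.
apply: le_trans h; rewrite /xlnx -/m.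
have -> : m%:R = a%:R + b%:R :> R by rewrite natrD.
by move: (ln _) (ln _) (ln _) => A B C; lra.
Qed.

End elementary.

(** * Binary relative entropy as a supremum of affine forms *)

Section kl_forms.
Variable R : realType.
Implicit Types (a b p q r s x y : R).

(* [kl q p] is the supremum over [r, s > 0] of these affine functions of
   [(q, p)]. *)
Definition klform r s q p : R :=
  q * ln r + (1 - q) * ln s + 1 - p * r - (1 - p) * s.

(** As a function of r this is maximal at r = a / b, with value a ln (a / b) + b - a. The
    corrections b - a of the two halves of [kl] cancel, so the halves can be treated separately. *)
Let xform r a b : R := a * ln r + b * (1 - r).

Let klformE r s q p : klform r s q p = xform r q p + xform s (1 - q) (1 - p).
Proof. by rewrite /klform /xform; ring. Qed.

Let kl_xlog q p : kl q p = ((xlog_ratio q p + (p - q)%:E) +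
  (xlog_ratio (1 - q) (1 - p) + ((1 - p) - (1 - q))%:E))%E.
Proof.
rewrite addeACA -EFinD (_ : p - q + _ = 0); last by ring.
by rewrite adde0.
Qed.

Let xlogNy a b : xlog_ratio a b != -oo%E.
Proof. by rewrite /xlog_ratio; case: ifP => // _; case: ifP. Qed.

Let ln_le_sub1 x : 0 < x -> ln x <= x - 1.
Proof.
by move=> x0; have := @le_ln1Dx R (x - 1); rewrite [1 + _]addrC subrK; apply; lra.
Qed.

Let xform_le r a b : 0 < r -> 0 <= a -> 0 <= b ->
  ((xform r a b)%:E <= xlog_ratio a b + (b - a)%:E)%E.
Proof.
move=> r0 a0 b0; rewrite /xlog_ratio /xform.
case: eqVneq => [->|an0].
  by rewrite add0e lee_fin subr0 mul0r add0r; nra.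
case: eqVneq => [->|bn0]; first by rewrite addye// leey.
have {a0 an0}a0 : 0 < a by rewrite lt_neqAle eq_sym an0.
have {b0 bn0}b0 : 0 < b by rewrite lt_neqAle eq_sym bn0.
rewrite -EFinD lee_fin ln_div//.
have : ln (r * b / a) <= r * b / a - 1 by apply: ln_le_sub1; rewrite divr_gt0// mulr_gt0.
rewrite ln_div ?posrE ?mulr_gt0// lnM ?posrE// => h.
have : a * (ln r + ln b - ln a) <= a * (r * b / a - 1) by rewrite ler_pM2l.
have -> : a * (r * b / a - 1) = r * b - a by field; rewrite gt_eqF.
by rewrite !mulrBr !mulrDr; move: (a * ln r) (a * ln b) (a * ln a) => A B C; lra.
Qed.

(** The maximiser a / b serves when a and b are positive. For a = 0 < b the supremum b is only
    approached as r tends to 0, and r is chosen to reach (b + y) / 2. For b = 0 < a the form is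
    unbounded, and r is chosen to reach y + 1. *)
Let xform_sup y a b : 0 <= a -> 0 <= b ->
  (y%:E < xlog_ratio a b + (b - a)%:E)%E -> exists2 r, 0 < r & y < xform r a b.
Proof.
move=> a0 b0; rewrite /xlog_ratio /xform.
case: eqVneq => [->|an0].
  rewrite add0e lte_fin subr0 => yb.
  have [b00|bn0] := eqVneq b 0; first by exists 1 => //; rewrite b00 in yb *; lra.
  have {b0 bn0}b0 : 0 < b by rewrite lt_neqAle eq_sym bn0.
  exists ((b - y) / (2 * b)); first by rewrite divr_gt0// ?mulr_gt0//; lra.
  rewrite mul0r add0r (_ : b * _ = (b + y) / 2); first by lra.
  by field; rewrite gt_eqF.
have {a0 an0}a0 : 0 < a by rewrite lt_neqAle eq_sym an0.
case: eqVneq => [-> _|bn0].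
  exists (expR ((y + 1) / a)); first exact: expR_gt0.
  by rewrite expRK mul0r addr0 mulrC divfK ?gt_eqF//; lra.
have {b0 bn0}b0 : 0 < b by rewrite lt_neqAle eq_sym bn0.
rewrite -EFinD lte_fin => h; exists (a / b); first by rewrite divr_gt0.
rewrite (_ : b * _ = b - a)//; by field; rewrite gt_eqF.
Qed.

Lemma klform_le_kl r s q p : 0 < r -> 0 < s -> 0 <= q <= 1 -> 0 <= p <= 1 ->
  ((klform r s q p)%:E <= kl q p)%E.
Proof.
move=> r0 s0 /andP[q0 q1] /andP[p0 p1].
by rewrite klformE kl_xlog EFinD; apply: leeD; apply: xform_le => //; lra.
Qed.

Lemma kl_sup_klform y q p : 0 <= q <= 1 -> 0 <= p <= 1 -> (y%:E < kl q p)%E ->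
  exists r s, [/\ 0 < r, 0 < s & y < klform r s q p].
Proof.
move=> /andP[q0 q1] /andP[p0 p1]; rewrite kl_xlog.
have q1' : 0 <= 1 - q by lra.
have p1' : 0 <= 1 - p by lra.
have := fun z => @xform_sup z _ _ q0 p0; have := fun z => @xform_sup z _ _ q1' p1'.
have N1 : xlog_ratio q p + (p - q)%:E != -oo%E by have := xlogNy q p; case: (xlog_ratio q p).
have N2 : xlog_ratio (1 - q) (1 - p) + (1 - p - (1 - q))%:E != -oo%E.
  by have := xlogNy (1 - q) (1 - p); case: (xlog_ratio (1 - q) (1 - p)).
move: (xlog_ratio q p + _)%E N1 => X1 N1.
move: (xlog_ratio (1 - q) _ + _)%E N2 => X2 N2 h2 h1 yX.
(* The level y is split into two parts, each strictly below its own half of [kl]; if both halves are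
   finite, each gives up half of the slack. *)
suff [y1 [y2 [Y1 Y2 ->]]] : exists y1 y2, [/\ (y1%:E < X1)%E, (y2%:E < X2)%E & y = y1 + y2].
  have [r r0 hr] := h1 _ Y1; have [s s0 hs] := h2 _ Y2.
  by exists r, s; split => //; rewrite klformE ltrD.
case: X1 X2 yX N1 N2 {h1 h2} => [x1| |] [x2| |] //= yX _ _.
- move: yX; rewrite -EFinD lte_fin => yX.
  exists (x1 - (x1 + x2 - y) / 2), (x2 - (x1 + x2 - y) / 2).
  by rewrite !lte_fin; split; [lra|lra|field].
- by exists (x1 - 1), (y - x1 + 1); rewrite lte_fin ltry; split => //; [lra|ring].
- by exists (y - x2 + 1), (x2 - 1); rewrite lte_fin ltry; split => //; [lra|ring].
- by exists 0, y; rewrite !ltry; split => //; ring.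
Qed.

Lemma kl_ge0 q p : 0 <= q <= 1 -> 0 <= p <= 1 -> (0 <= kl q p)%E.
Proof.
move=> q01 p01; have := @klform_le_kl 1 1 q p ltr01 ltr01 q01 p01.
by rewrite /klform ln1 (_ : _ - _ = 0)//; ring.
Qed.

Lemma kl_refl q : kl q q = 0%E.
Proof.
rewrite /kl; have xx x : xlog_ratio x x = 0%E.
  by rewrite /xlog_ratio; case: eqVneq => // x0; rewrite divff// ln1 mulr0.
by rewrite !xx adde0.
Qed.

(** Take a form that exceeds [kl q p] at (q', p). If r <= s, the form does not increase in q, so its
    value at (q, p) is at least as large, which is impossible. If s < r, it decreases in p, so its
    value at (q', p) is at most that at (q', q'), hence at most [kl q' q'] = 0. *)
Lemma kl_decr q q' p : 0 <= q -> q <= q' -> q' <= p -> p <= 1 ->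
  (kl q' p <= kl q p)%E.
Proof.
move=> q0 qq' q'p p1.
have q'01 : 0 <= q' <= 1 by lra.
have q01 : 0 <= q <= 1 by lra.
have p01 : 0 <= p <= 1 by lra.
rewrite leNgt; apply/negP => klt.
have [y yl yk] : exists2 y : R, (kl q p <= y%:E)%E & (y%:E < kl q' p)%E.
  have := kl_ge0 q01 p01.
  by case: (kl q p) klt => [z zk _|/lt_geF|]//; [exists z|rewrite leey].
have [r [s [r0 s0]]] := kl_sup_klform q'01 p01 yk.
apply/negP; rewrite -leNgt -lee_fin.
have [rs|sr] := leP r s.
  apply: le_trans yl; apply: le_trans (klform_le_kl r0 s0 q01 p01).
  have : ln r <= ln s by rewrite ler_ln ?posrE.
  by rewrite lee_fin /klform; move: (ln r) (ln s) => A B; nra.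
apply: le_trans yl; apply: le_trans (kl_ge0 q01 p01).
have := @klform_le_kl r s q' q' r0 s0 q'01 q'01; rewrite kl_refl.
by rewrite !lee_fin /klform; apply: le_trans; nra.
Qed.

Lemma sume_le_approx (I : finType) (a : I -> \bar R) (b : \bar R) :
  (forall i, 0 <= a i)%E ->
  (forall y : I -> R, (forall i, (y i)%:E < a i)%E -> ((\sum_i y i)%:E <= b)%E) ->
  (\sum_i a i <= b)%E.
Proof.
move=> a0 h; case: b => [b| |] in h *; last 2 first.
- by rewrite leey.
- have : ((\sum_(i : I) (-1))%:E <= -oo :> \bar R)%E.
    by apply: (h (fun=> -1)) => i; rewrite (lt_le_trans _ (a0 i))// lte_fin; lra.
  by rewrite leeNy_eq.
have [[j aj]|afin] := pselect (exists j, a j = +oo%E).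
  (* With one infinite term, a large entry there outweighs the entries -1 elsewhere and pushes the
     sum above [b]. *)
  pose y i : R := if i == j then `|b| + #|I|%:R + 1 else -1.
  have : ((\sum_i y i)%:E <= b%:E)%E.
    apply: h => i; rewrite /y; case: eqP => [->|_]; first by rewrite aj ltry.
    by rewrite (lt_le_trans _ (a0 i))// lte_fin; lra.
  rewrite lee_fin (bigD1 j)//= {1}/y eqxx => hb; exfalso.
  have : - #|I|%:R <= \sum_(i | i != j) y i :> R.
    rewrite (eq_bigr (fun=> -1)) => [|i /negbTE ij]; last by rewrite /y ij.
    rewrite sumr_const mulNrn lerN2 ler_nat.
    exact: max_card.
  by have := ler_norm b; lra.
have fa i : a i \is a fin_num.
  by rewrite ge0_fin_numE// ltey; apply/eqP => aio; apply: afin; exists i.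
apply/lee_addgt0Pr => e e0.
pose d := e / (#|I|%:R + 1); have d0 : 0 < d by rewrite divr_gt0// ltr_wpDl.
have : ((\sum_i (fine (a i) - d))%:E <= b%:E)%E.
  by apply: h => i; rewrite -[ltRHS]fineK// lte_fin; lra.
rewrite -(EFin_sum_fine _ (fun i _ => fa i)) -EFinD !lee_fin sumrB sumr_const.
have : d *+ #|I| <= e.
  rewrite -mulr_natr /d -mulrA -[leRHS]mulr1 ler_pM2l// mulrC ler_pdivrMr ?mul1r ?ltr_wpDl//.
  by lra.
by lra.
Qed.

(** Parameters chosen separately for each index turn a sum of suprema into a supremum of sums. This
    leads back from the affine forms to [kl]. *)
Lemma sum_kl_le (I : finType) (w : I -> nat) (q p : I -> R) (b : \bar R) :
  (forall i, (0 < w i)%N) -> (forall i, 0 <= q i <= 1) -> (forall i, 0 <= p i <= 1) ->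
  (forall r s : I -> R, (forall i, 0 < r i) -> (forall i, 0 < s i) ->
     ((\sum_i (w i)%:R * klform (r i) (s i) (q i) (p i))%:E <= b)%E) ->
  (\sum_i (w i)%:R%:E * kl (q i) (p i) <= b)%E.
Proof.
move=> w0 q01 p01 h; apply: sume_le_approx => [i|y hy].
  by rewrite mule_ge0// ?lee_fin// kl_ge0.
have /choice[rs hrs] : forall i, exists rs : R * R,
    [/\ 0 < rs.1, 0 < rs.2 & y i <= (w i)%:R * klform rs.1 rs.2 (q i) (p i)].
  move=> i; have wi : 0 < (w i)%:R :> R by rewrite ltr0n.
  have : ((y i / (w i)%:R)%:E < kl (q i) (p i))%E.
    by rewrite -(@lte_pmul2l _ (w i)%:R%:E)// -EFinM mulrC divfK ?gt_eqF.
  move=> /(kl_sup_klform (q01 i) (p01 i))[r [s [r0 s0 hy']]].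
  by exists (r, s); split => //=; rewrite mulrC -ler_pdivrMr// ltW.
apply: le_trans (h (fun i => (rs i).1) (fun i => (rs i).2) _ _).
- by rewrite lee_fin; apply: ler_sum => i _; case: (hrs i).
- by move=> i; case: (hrs i).
- by move=> i; case: (hrs i).
Qed.

End kl_forms.

(** * The e-value and its lower bound *)

Section evalue.
Variable R : realType.
Implicit Types (p q r s : R).

Lemma prod_add_setE (I : finType) (f g : I -> R) :
  \prod_i (f i + g i) = \sum_(J : {set I}) \prod_i (if i \in J then f i else g i).
Proof.
rewrite (eq_bigr (fun i => \sum_(b : bool) if b then f i else g i)); last first.
  by move=> i _; rewrite big_bool.
rewrite bigA_distr_bigA/=.
rewrite (reindex (fun J : {set I} => [ffun i => i \in J])) /=; last first.
  exists (fun f : {ffun I -> bool} => [set i | f i]%SET) => [J _|h _].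
    by apply/setP => i; rewrite inE ffunE.
  by apply/ffunP => i; rewrite ffunE inE.
by apply: eq_bigr => J _; apply: eq_bigr => i _; rewrite ffunE.
Qed.

Lemma sum_subset_card (I : finType) (A : {set I}) (f : nat -> R) :
  \sum_(J : {set I} | J \subset A) f #|J| = \sum_(k < #|A|.+1) 'C(#|A|, k)%:R * f k.
Proof.
rewrite (partition_big (fun J : {set I} => inord #|J| : 'I_#|A|.+1) xpredT)//=.
apply: eq_bigr => k _.
have -> : 'C(#|A|, k)%:R = \sum_(J in [set B : {set I} | B \subset A & #|B| == k]%SET) 1 :> R.
  by rewrite sumr_const cards_draws.
rewrite mulr_suml (eq_bigl (fun J => J \in [set B : {set I} | B \subset A & #|B| == k]%SET)).
  by apply: eq_bigr => J; rewrite inE => /andP[_ /eqP ->]; rewrite mul1r.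
move=> J; rewrite inE; case JA : (J \subset A) => //=.
have Jlt : (#|J| < #|A|.+1)%N by rewrite ltnS subset_leq_card.
apply/eqP/eqP => [<-|Jk]; first by rewrite inordK.
by apply: val_inj; rewrite /= inordK.
Qed.

(** The weights are a probability on words of length [#|A|]. After grouping by cardinality, Pascal's
    rule and [kt_split] reduce each length to the previous one. *)
Lemma sum_kt (I : finType) (A : {set I}) :
  \sum_(J : {set I} | J \subset A) kt R #|J| (#|A| - #|J|) = 1.
Proof.
rewrite (sum_subset_card A (fun k => kt R k (#|A| - k))); elim: #|A| => [|m ih].
  by rewrite big_ord1 /kt !big_ord0 !mul1r fact0 invr1.
rewrite -[RHS]ih big_ord_recl bin0 mul1r subn0.
have -> : \sum_(k < m.+1) 'C(m, k)%:R * kt R k (m - k) =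
    \sum_(k < m.+1) 'C(m, k)%:R * kt R k.+1 (m - k) +
    \sum_(k < m.+1) 'C(m, k)%:R * kt R k (m - k).+1.
  by rewrite -big_split/=; apply: eq_bigr => k _; rewrite -mulrDr kt_split.
rewrite [X in _ = _ + X]big_ord_recl/= bin0 mul1r subn0 addrCA; congr (_ + _).
have -> : \sum_(i < m) 'C(m, bump 0 i)%:R * kt R (bump 0 i) (m - bump 0 i).+1 =
    \sum_(i < m.+1) 'C(m, i.+1)%:R * kt R i.+1 (m - i).
  rewrite [RHS]big_ord_recr/= bin_small// mul0r addr0.
  by apply: eq_bigr => i _; rewrite /bump/= add1n subnSK.
rewrite -big_split/=; apply: eq_bigr => i _.
by rewrite /bump/= add1n subSS binS natrD mulrDl addrC.
Qed.

(** The quotient x / p, infinite at p = 0 < x so that the lower bound on the e-value persists there,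
    and 0 at p = x = 0 so that the mean stays at most 1. *)
Definition bern_ratio p x : \bar R :=
  if p == 0 then if x == 0 then 0%E else +oo%E else (x / p)%:E.

(** [a] tells whether the index is observed and [b] whether the word has a one there. An unobserved
    index contributes 0 or 1, which removes every word with a one outside the sample; a sample of
    random size thus fits a fixed index type. *)
Definition efactor (a b : bool) x p : \bar R :=
  if a then (if b then bern_ratio p x else bern_ratio (1 - p) (1 - x))
  else if b then 0%E else 1%E.

(* Mixture, with Krichevsky-Trofimov weights, of the likelihood ratios between
   Bernoulli words and the Bernoulli law of parameter [p], extended
   multilinearly from words to [x : I -> [0, 1]].  Only the coordinates in
   [A] are observed. *)
Definition evalue (I : finType) (A : {set I}) (x : I -> R) p : \bar R :=
  (\sum_(J : {set I}) (kt R #|J| (#|A| - #|J|))%:E *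
     \prod_i efactor (i \in A) (i \in J) (x i) p)%E.

Lemma bern_ratio_ge0 p x : 0 <= p -> 0 <= x -> (0 <= bern_ratio p x)%E.
Proof.
move=> p0 x0; rewrite /bern_ratio; case: ifP => _; first by case: ifP; rewrite ?leey.
by rewrite lee_fin divr_ge0.
Qed.

Lemma efactor_ge0 a b x p : 0 <= x <= 1 -> 0 <= p <= 1 -> (0 <= efactor a b x p)%E.
Proof.
by move=> /andP[x0 x1] /andP[p0 p1]; rewrite /efactor; case: a b => [] [];
  rewrite ?lee_fin// bern_ratio_ge0//; lra.
Qed.

Lemma evalue_ge0 (I : finType) (A : {set I}) (x : I -> R) p :
  (forall i, 0 <= x i <= 1) -> 0 <= p <= 1 -> (0 <= evalue A x p)%E.
Proof.
move=> x01 p01; apply: sume_ge0 => J _; apply: mule_ge0.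
  by rewrite lee_fin ltW// kt_gt0.
by apply: prode_ge0 => i _; rewrite efactor_ge0.
Qed.

(** Concavity of ln gives x ln r + (1 - x) ln s <= ln (x r + (1 - x) s), and 1 - c <= - ln c for c =
    p r + (1 - p) s. The resulting bound is affine in x, which suits the multilinear e-value. *)
Lemma expR_klform_le r s x p : 0 < r -> 0 < s -> 0 <= x <= 1 -> 0 <= p <= 1 ->
  expR (klform r s x p) <= (x * r + (1 - x) * s) / (p * r + (1 - p) * s).
Proof.
move=> r0 s0 /andP[x0 x1] /andP[p0 p1].
have comb_gt0 (t : R) : 0 <= t -> t <= 1 -> 0 < t * r + (1 - t) * s.
  move=> t0 t1; have [->|tn0] := eqVneq t 0; first by rewrite mul0r subr0 mul1r add0r.
  have {t0 tn0}t0 : 0 < t by rewrite lt_neqAle eq_sym tn0.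
  by rewrite ltr_pwDl ?mulr_gt0// mulr_ge0// ?subr_ge0// ltW.
have lnle (u : R) : 0 < u -> ln u <= u - 1.
  by move=> u0; have := @le_ln1Dx R (u - 1); rewrite [1 + _]addrC subrK; apply; lra.
set m := x * r + _; set c := p * r + _.
have m0 : 0 < m by exact: comb_gt0.
have c0 : 0 < c by exact: comb_gt0.
rewrite -[leRHS]lnK ?posrE ?divr_gt0// ler_expR ln_div ?posrE//.
have := lnle _ c0.
have := lnle _ (divr_gt0 r0 m0); have := lnle _ (divr_gt0 s0 m0).
rewrite !ln_div ?posrE// => hs hr hc.
have Hr : x * (ln r - ln m) <= x * (r / m - 1) by rewrite ler_wpM2l.
have Hs : (1 - x) * (ln s - ln m) <= (1 - x) * (s / m - 1) by rewrite ler_wpM2l// subr_ge0.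
have E : x * (r / m) + (1 - x) * (s / m) = 1.
  by rewrite !mulrA -mulrDl -/m divff// gt_eqF.
rewrite /klform.
have -> : x * ln r + (1 - x) * ln s + 1 - p * r - (1 - p) * s =
   (x * (ln r - ln m) + (1 - x) * (ln s - ln m)) + ln m + 1 - c by rewrite /c; ring.
have : x * (ln r - ln m) + (1 - x) * (ln s - ln m) <= 0.
  apply: le_trans (lerD Hr Hs) _.
  rewrite ![_ * (_ / m - 1)]mulrBr !mulr1.
  by move: (x * (r / m)) ((1 - x) * (s / m)) E => a b E; lra.
by lra.
Qed.

Lemma prode_eqy (I : finType) (f : I -> \bar R) j :
  (forall i, 0 < f i)%E -> f j = +oo%E -> (\prod_i f i = +oo)%E.
Proof.
move=> f0 fj; rewrite (bigD1 j)//= fj gt0_mulye//.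
by elim/big_rec: _ => [|i y _ y0]; [rewrite lte01|rewrite mule_gt0].
Qed.

Let evalue_eqy (I : finType) (A : {set I}) (x : I -> R) p (J : {set I}) j :
  (forall i, 0 <= x i <= 1) -> 0 <= p <= 1 ->
  (forall i, 0 < efactor (i \in A) (i \in J) (x i) p)%E ->
  efactor (j \in A) (j \in J) (x j) p = +oo%E -> evalue A x p = +oo%E.
Proof.
move=> x01 p01 f0 fj; rewrite /evalue (bigD1 J)//= (prode_eqy f0 fj).
rewrite gt0_muley ?lte_fin ?kt_gt0// addye// gt_eqF// (@lt_le_trans _ _ 0%E)//.
apply: sume_ge0 => K _; apply: mule_ge0; first by rewrite lee_fin ltW// kt_gt0.
by apply: prode_ge0 => i _; rewrite efactor_ge0.
Qed.

(** The product of the one-sample bounds expands over the subsets J of A into products of likelihood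
    ratios with weights q^|J| (1 - q)^(|A| - |J|), and [kt_dominates] replaces these weights by
    those of the e-value. *)
Lemma evalue_lb (I : finType) (A : {set I}) (x : I -> R) p r s :
  (0 < #|A|)%N -> (forall i, 0 <= x i <= 1) -> 0 <= p <= 1 -> 0 < r -> 0 < s ->
  ((expR (\sum_(i in A) klform r s (x i) p))%:E <=
   (2 * Num.sqrt #|A|%:R)%:E * evalue A x p)%E.
Proof.
move=> A0 x01 p01 r0 s0; have /andP[p0 p1] := p01.
have sA : 0 < 2 * Num.sqrt #|A|%:R :> R by rewrite mulr_gt0// sqrtr_gt0 ltr0n.
(* If p = 0 and some observed entry is nonzero, the word marking the nonzero entries has only
   positive factors, one of them infinite, so the e-value is [+oo]. The case p = 1 below uses the
   word marking the entries equal to 1. *)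
have [[j jA /andP[/eqP pE xj]]|good0] := pselect (exists2 j, j \in A & (p == 0) && (x j != 0)).
  rewrite (@evalue_eqy _ _ _ _ [set i in A | x i != 0]%SET j)//.
  - by rewrite gt0_muley ?leey ?lte_fin.
  - move=> i; rewrite /efactor inE; have [iA|//] := boolP (i \in A); rewrite /=.
    rewrite /bern_ratio pE eqxx subr0 oner_eq0 divr1; have [->|//] := eqVneq (x i) 0.
    by rewrite /= lte_fin subr0.
  - by rewrite /efactor inE jA xj /bern_ratio pE eqxx (negbTE xj).
have [[j jA /andP[/eqP pE xj]]|good1] := pselect (exists2 j, j \in A & (p == 1) && (x j != 1)).
  rewrite (@evalue_eqy _ _ _ _ [set i in A | x i == 1]%SET j)//.
  - by rewrite gt0_muley ?leey ?lte_fin.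
  - move=> i; rewrite /efactor inE; have [iA|//] := boolP (i \in A); rewrite /=.
    rewrite /bern_ratio pE subrr eqxx oner_eq0 divr1; have [->|xi1] := eqVneq (x i) 1.
      by rewrite /= lte_fin.
    by rewrite /= subr_eq0 eq_sym (negbTE xi1).
  - by rewrite /efactor inE jA (negbTE xj)/= /bern_ratio pE subrr eqxx subr_eq0 eq_sym (negbTE xj).
pose c := p * r + (1 - p) * s.
have c0 : 0 < c.
  rewrite /c; have [->|pn0] := eqVneq p 0; first by rewrite mul0r subr0 mul1r add0r.
  have {pn0}pp : 0 < p by rewrite lt_neqAle eq_sym pn0.
  by rewrite ltr_pwDl ?mulr_gt0// mulr_ge0// ?subr_ge0// ltW.
(* The Bernoulli parameter p tilted by the weights r and s: the one-sample bound is the mixture of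
   the two likelihood ratios with weights q and 1 - q. *)
pose q := p * r / c.
have q01 : 0 <= q <= 1.
  have pr0 : 0 <= p * r by rewrite mulr_ge0// ltW.
  rewrite /q divr_ge0 ?(ltW c0)//= ler_pdivrMr// mul1r /c lerDl mulr_ge0 ?subr_ge0//.
  exact: ltW.
have q1E : 1 - q = (1 - p) * s / c.
  by rewrite /q; apply/eqP; rewrite subr_eq -mulrDl [_ + p * r]addrC -/c divff// gt_eqF.
pose u (b : bool) i : R := if b then x i / p else (1 - x i) / (1 - p).
have fE i (J : {set I}) : efactor (i \in A) (i \in J) (x i) p =
    (if i \in A then u (i \in J) i else (i \notin J)%:R)%:E.
  rewrite /efactor; case: ifP => iA; last by case: ifP.
  rewrite /u /bern_ratio subr_eq0 [1 == p]eq_sym subr_eq0 [1 == x i]eq_sym.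
  case: ifP => iJ; case: eqP => // pE.
    case: eqP => [->|/eqP xi]; first by rewrite mul0r.
    by exfalso; apply: good0; exists i => //; rewrite pE eqxx.
  case: eqP => [->|/eqP xi]; first by rewrite subrr mul0r.
  by exfalso; apply: good1; exists i => //; rewrite pE eqxx.
have uE i : i \in A -> (x i * r + (1 - x i) * s) / c = q * u true i + (1 - q) * u false i.
  move=> iA; rewrite q1E /q /u mulrDl; congr (_ + _).
    have [pE|pn0] := eqVneq p 0; last by field; rewrite pn0 gt_eqF.
    have [->|xi] := eqVneq (x i) 0; first by rewrite !mul0r mulr0.
    by exfalso; apply: good0; exists i => //; rewrite pE eqxx.
  have [pE|pn0] := eqVneq p 1; last by field; rewrite subr_eq0 eq_sym pn0 gt_eqF.
  have [->|xi] := eqVneq (x i) 1; first by rewrite subrr !mul0r mulr0.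
  by exfalso; apply: good1; exists i => //; rewrite pE eqxx.
have u0 b i : 0 <= u b i.
  by have /andP[xi0 xi1] := x01 i; rewrite /u; case: b; rewrite divr_ge0// subr_ge0.
rewrite /evalue.
rewrite (eq_bigr (fun J : {set I} => (kt R #|J| (#|A| - #|J|) *
    \prod_i (if i \in A then u (i \in J) i else (i \notin J)%:R))%:E)); last first.
  by move=> J _; rewrite [RHS]EFinM -prodEFin; congr (_ * _)%E; apply: eq_bigr => i _; rewrite fE.
rewrite sumEFin -EFinM lee_fin expR_sum.
apply: (@le_trans _ _ (\prod_(i in A) (q * u true i + (1 - q) * u false i))).
  apply: ler_prod => i iA; rewrite expR_ge0/= -uE//; exact: expR_klform_le.
rewrite [leLHS]big_mkcond/=.
(* An unobserved index contributes 0 + 1, so the expansion can run over all subsets and those not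
   inside A vanish. *)
rewrite (eq_bigr (fun i => (if i \in A then q * u true i else 0) +
                           (if i \in A then (1 - q) * u false i else 1))); last first.
  by move=> i _; case: ifP; rewrite ?add0r.
rewrite prod_add_setE mulr_sumr; apply: ler_sum => J _.
have [JA|JA] := boolP (J \subset A); last first.
  have /fintype.subsetPn[i iJ iA] := JA.
  by rewrite (bigD1 i)//= iJ (negbTE iA) mul0r (bigD1 i)//= iJ (negbTE iA) mul0r !mulr0.
have -> : \prod_i (if i \in J then if i \in A then q * u true i else 0
      else if i \in A then (1 - q) * u false i else 1) =
    (q ^+ #|J| * (1 - q) ^+ (#|A| - #|J|)) *
    \prod_i (if i \in A then u (i \in J) i else (i \notin J)%:R).
  have <- : #|A :\: J| = (#|A| - #|J|)%N.
    by rewrite cardsD (finset.setIidPr JA).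
  rewrite -!prodr_const [in RHS](big_mkcond (mem J))/= [in RHS](big_mkcond (mem (A :\: J)))/=.
  rewrite -!big_split/=; apply: eq_bigr => i _; rewrite !inE.
  have [iJ|iJ] := boolP (i \in J); first by rewrite (fintype.subsetP JA _ iJ)/= mulr1.
  by case: ifP; rewrite /= ?mul1r// mulr1.
rewrite mulrA; apply: ler_wpM2r.
  by apply: prodr_ge0 => i _; case: ifP.
have := @kt_dominates R #|J| (#|A| - #|J|) q; rewrite subnKC ?subset_leq_card//.
exact.
Qed.

End evalue.

(** * Kernels and product laws *)

Section giry_kernel.
Local Open Scope ereal_scope.
Context d d' (E : measurableType d) (Z : measurableType d') (R : realType).
Variable k : E -> giry Z R.
Hypothesis mk : measurable_fun setT k.

(** The product of the Dirac mass at e with [k e]. Binding it to [mu] gives the joint law of e and a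
    draw from [k e]. *)
Definition giry_graph (e : E) : giry (E * Z)%type R := giry_prod (giry_ret e, k e).

Lemma measurable_giry_graph : measurable_fun setT giry_graph.
Proof.
apply: (measurableT_comp measurable_giry_prod).
by apply/measurable_fun_pairP; split => //; exact: measurable_giry_ret.
Qed.

Variable f : E * Z -> \bar R.
Hypotheses (mf : measurable_fun setT f) (f0 : forall x, 0 <= f x).

Lemma giry_graphE e : \int[giry_graph e]_x f x = \int[k e]_z f (e, z).
Proof.
rewrite -[LHS]/(giry_int (giry_prod (giry_ret e, k e)) f) giry_int_prod1//.
rewrite giry_int_ret//.
exact: (@measurable_fun_fubini_tonelli_F _ _ _ _ _ (k e) f mf f0).
Qed.

Lemma measurable_giry_kernel_int : measurable_fun setT (fun e => \int[k e]_z f (e, z)).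
Proof.
rewrite (_ : (fun e => _) = (giry_int ^~ f) \o giry_graph); last first.
  by apply/funext => e; rewrite /= -giry_graphE.
apply: measurableT_comp; first exact: measurable_giry_int.
exact: measurable_giry_graph.
Qed.

Definition giry_compprod (mu : giry E R) : giry (E * Z)%type R :=
  giry_bind mu measurable_giry_graph.

Lemma giry_compprodE (mu : giry E R) :
  \int[giry_compprod mu]_x f x = \int[mu]_e \int[k e]_z f (e, z).
Proof.
rewrite -[LHS]/(giry_int _ f) giry_int_bind//.
by apply: eq_integral => e _; rewrite -giry_graphE.
Qed.

End giry_kernel.

Section weighted_pushforward.
Local Open Scope ereal_scope.
Context d d' (T : measurableType d) (U : measurableType d') (R : realType).
Variables (P : {measure set T -> \bar R}) (a : T -> \bar R) (h : T -> U).
Hypotheses (ma : measurable_fun setT a) (a0 : forall x, 0 <= a x).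
Hypothesis mh : measurable_fun setT h.

(** The image under [h] of the measure with density [a] with respect to [P]. *)
Definition wpush (A : set U) := \int[P]_(x in h @^-1` A) a x.

Let wpush0 : wpush set0 = 0.
Proof. by rewrite /wpush preimage_set0 integral_set0. Qed.

Let wpush_ge0 A : 0 <= wpush A.
Proof. exact: integral_ge0. Qed.

Let mpre A : measurable A -> measurable (h @^-1` A).
Proof. by move=> mA; rewrite -[X in measurable X]setTI; exact: mh. Qed.

Let wpush_sigma_additive : semi_sigma_additive wpush.
Proof.
move=> F mF tF mUF; rewrite /wpush preimage_bigcup ge0_integral_bigcup//.
- by apply: is_cvg_nneseries => n _ _; exact: integral_ge0.
- by move=> k; exact: mpre.
- exact: measurable_funTS.
- by move=> i j _ _ [x [Fi Fj]]; apply: tF => //; exists (h x).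
Qed.

HB.instance Definition _ := isMeasure.Build _ _ _ wpush
  wpush0 wpush_ge0 wpush_sigma_additive.

Definition wpush_measure : {measure set U -> \bar R} := wpush.

Import HBNNSimple.

Lemma integral_wpush (f : U -> \bar R) : measurable_fun setT f -> (forall x, 0 <= f x) ->
  \int[wpush_measure]_x f x = \int[P]_x (a x * f (h x)).
Proof.
move=> mf f0; pose g := nnsfun_approx measurableT mf.
have gc x : (g n x)%:E @[n --> \oo] --> f x by exact: cvg_nnsfun_approx.
have ndg x : nondecreasing_seq (fun n => (g n x)%:E).
  by move=> m n mn; rewrite lee_fin; exact/lefP/nd_nnsfun_approx.
transitivity (limn (fun n => \int[wpush_measure]_x (g n x)%:E)).
  rewrite -monotone_convergence//.
  - by apply: eq_integral => x _; apply/esym/cvg_lim.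
  - by move=> n; exact/measurable_EFinP.
  - by move=> n x _; rewrite lee_fin.
transitivity (limn (fun n => \int[P]_x (a x * (g n (h x))%:E))); last first.
  rewrite -monotone_convergence//.
  - apply: eq_integral => x _; apply/cvg_lim => //.
    (* Values may be infinite and the product is not continuous at 0 * +oo, so zero factors are
       treated apart. *)
    have [ax0|ax0] := eqVneq (a x) 0.
      by rewrite ax0 mul0e; under eq_fun do rewrite mul0e; exact: cvg_cst.
    have [fx0|fx0] := eqVneq (f (h x)) 0.
      rewrite fx0 mule0 (_ : (fun n => _) = cst 0); first exact: cvg_cst.
      apply/funext => n /=; rewrite (_ : (g n (h x))%:E = 0) ?mule0//.
      apply/eqP; rewrite eq_le; apply/andP; split; last by rewrite lee_fin.
      by rewrite -fx0 /g nnsfun_approxE; exact: le_approx.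
    apply: cvgeM; [|exact: cvg_cst|exact: gc].
    by apply: neq0_mule_def; rewrite mule_eq0 negb_or ax0 fx0.
  - by move=> n; apply: emeasurable_funM => //; apply/measurable_EFinP; exact: measurableT_comp.
  - by move=> n x _; rewrite mule_ge0// lee_fin.
  - by move=> x _ m n mn; rewrite lee_wpmul2l// ndg.
apply: congr_lim; apply/funext => n.
rewrite integralT_nnsfun sintegralE.
have mgr r : measurable (g n @^-1` [set r]) by [].
transitivity (\int[P]_x \sum_(r \in range (g n)) (a x * (r * \1_(g n @^-1` [set r]) (h x))%:E)); last first.
  apply: eq_integral => x _; rewrite [in RHS](fimfunE (g n)) -fsumEFin// ge0_mule_fsumr//.
  by move=> r; rewrite EFinM nnfun_muleindic_ge0.
rewrite ge0_integral_fsum//.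
- apply: eq_fsbigr => r; rewrite inE => -[y _ ry].
  under eq_integral do rewrite EFinM muleCA.
  rewrite ge0_integralZl//.
  + congr (_ * _); rewrite -[LHS]/(wpush _) /wpush [LHS]integral_mkcond; apply: eq_integral => x _.
    rewrite patchE indicE (_ : (x \in h @^-1` _) = (h x \in g n @^-1` [set r])).
      by case: ifPn; rewrite ?mule1 ?mule0.
    by apply/idP/idP; rewrite !inE.
  + apply: emeasurable_funM => //; apply/measurable_EFinP.
    by apply: measurableT_comp mh => //; exact: measurable_indic.
  + by move=> x _; rewrite mule_ge0// lee_fin.
  + by rewrite -ry lee_fin.
- move=> r; apply: emeasurable_funM => //; apply/measurable_EFinP.
  apply: measurable_funM => //; apply: measurableT_comp mh => //; exact: measurable_indic.
- by move=> r x _; rewrite mule_ge0// EFinM nnfun_muleindic_ge0.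
Qed.

End weighted_pushforward.

Lemma measurable_prode d (T : measurableType d) (R : realType) (I : Type) (s : seq I)
    (Q : pred I) (f : I -> T -> \bar R) : (forall j, measurable_fun setT (f j)) ->
  measurable_fun setT (fun x => \prod_(j <- s | Q j) f j x)%E.
Proof.
move=> mf; elim: s => [|j s ih]; first by under eq_fun do rewrite big_nil; exact: measurable_cst.
under eq_fun do rewrite big_cons; case: (Q j) => //.
by apply: emeasurable_funM.
Qed.

(** * Conditionally independent sequences *)

Section product_law.
Local Open Scope ereal_scope.
Context d d1 d2 (O : measurableType d) (E : measurableType d1) (Z : measurableType d2).
Context (R : realType) (I : finType).
Variables (P : giry O R) (mu : giry E R) (k : E -> giry Z R).
Variables (e : O -> E) (z : I -> O -> Z).
Hypotheses (mk : measurable_fun setT k) (me : measurable_fun setT e).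
Hypothesis mz : forall i, measurable_fun setT (z i).
Hypothesis rect : forall (B : set E) (C : I -> set Z), measurable B ->
  (forall i, measurable (C i)) ->
  P [set w | B (e w) /\ forall i, C i (z i w)] = \int[mu]_(x in B) (\prod_i fine (k x (C i)))%:E.

Let nonneg_meas (f : E * Z -> \bar R) := measurable_fun setT f /\ forall x, 0 <= f x.
Let fam_integral_eq (g : I -> E * Z -> \bar R) :=
  \int[P]_w (\prod_i g i (e w, z i w)) = \int[mu]_x \prod_i \int[k x]_y g i (x, y).
Let is_rect (f : E * Z -> \bar R) := exists B C, [/\ measurable B, measurable C &
  f = fun p => (\1_(B `*` C) p)%:E].
Let is_indic (f : E * Z -> \bar R) := exists2 G, measurable G & f = fun p => (\1_G p)%:E.

Let is_rect_indic f : is_rect f -> is_indic f.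
Proof. by move=> [B [C [mB mC ->]]]; exists (B `*` C) => //; exact: measurableX. Qed.

Let is_indic_nonneg f : is_indic f -> nonneg_meas f.
Proof.
move=> [G mG ->]; split; last by move=> x; rewrite lee_fin.
by apply/measurable_EFinP; exact: measurable_indic.
Qed.

Let upd (g : I -> E * Z -> \bar R) i f j := if j == i then f else g j.

Let a (g : I -> E * Z -> \bar R) i w := \prod_(j | j != i) g j (e w, z j w).
Let b (g : I -> E * Z -> \bar R) i (p : E * Z) := \prod_(j | j != i) \int[k p.1]_y g j (p.1, y).
Let h i w := (e w, z i w).

Let mh i : measurable_fun setT (h i).
Proof. by apply/measurable_fun_pairP; split; [exact: me|exact: (mz i)]. Qed.

Let a_ge0 g i : (forall j, nonneg_meas (g j)) -> forall w, 0 <= a g i w.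
Proof. by move=> gP w; apply: prode_ge0 => j _; case: (gP j). Qed.

Let ma g i : (forall j, nonneg_meas (g j)) -> measurable_fun setT (a g i).
Proof.
move=> gP; apply: measurable_prode => j; case: (gP j) => mg _.
by apply: (measurableT_comp mg); exact: mh.
Qed.

Let b_ge0 g i : (forall j, nonneg_meas (g j)) -> forall p, 0 <= b g i p.
Proof.
move=> gP w; apply: prode_ge0 => j _; apply: integral_ge0 => y _.
by case: (gP j).
Qed.

Let mb g i : (forall j, nonneg_meas (g j)) -> measurable_fun setT (b g i).
Proof.
move=> gP; apply: measurable_prode => j; case: (gP j) => mg g0.
apply: (@measurableT_comp _ _ _ _ _ _ (fun x => \int[k x]_y g j (x, y))) => //.
exact: (measurable_giry_kernel_int mk).
Qed.

Let nu1 g i (gP : forall j, nonneg_meas (g j)) : {measure set (E * Z)%type -> \bar R} :=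
  wpush_measure P (ma i gP) (a_ge0 i gP) (mh i).
Let nu2 g i (gP : forall j, nonneg_meas (g j)) : {measure set (E * Z)%type -> \bar R} :=
  wpush_measure (giry_compprod mk mu) (mb i gP) (b_ge0 i gP) (@measurable_id _ _ setT).

(** With the other factors fixed, both sides are integrals of the i-th factor, against [nu1] and
    [nu2]. One factor at a time, the claim becomes an equality of two measures. *)
Let fam_integral_eqP g i f (gP : forall j, nonneg_meas (g j)) : nonneg_meas f ->
  fam_integral_eq (upd g i f) <->
  \int[nu1 i gP]_x f x = \int[nu2 i gP]_x f x.
Proof.
move=> [mf f0]; rewrite /fam_integral_eq.
rewrite !integral_wpush//.
rewrite giry_compprodE//; last 2 first.
- by apply: emeasurable_funM => //; exact: mb.
- by move=> x; rewrite mule_ge0// b_ge0.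
have -> : \int[P]_w (\prod_j upd g i f j (e w, z j w)) = \int[P]_x (a g i x * f (h i x)).
  apply: eq_integral => w _; rewrite (bigD1 i)//= {1}/upd eqxx muleC; congr (_ * _).
  by apply: eq_bigr => j /negbTE ji; rewrite /upd ji.
have -> : \int[mu]_x (\prod_j \int[k x]_y upd g i f j (x, y)) =
    \int[mu]_x \int[k x]_y (b g i (x, y) * f (x, y)) => //.
apply: eq_integral => x _; rewrite (bigD1 i)//= {1}/upd eqxx muleC.
have -> : \prod_(j | j != i) \int[k x]_y upd g i f j (x, y) = b g i (x, point).
  by apply: eq_bigr => j /negbTE ji; rewrite /upd ji.
transitivity (\int[k x]_y (b g i (x, point) * f (x, y))) => //.
rewrite [RHS]ge0_integralZl//.
- by apply: measurableT_comp mf _ => //; exact: measurable_pair1.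
- by rewrite b_ge0.
Qed.

Let measures_eq g i : (forall j, nonneg_meas (g j)) ->
  (forall f, is_indic f -> fam_integral_eq (upd g i f)) ->
  forall f, nonneg_meas f -> fam_integral_eq (upd g i f).
Proof.
move=> gP H f fP; apply/(fam_integral_eqP i gP fP).
apply: eq_measure_integral => A mA _.
have iA : is_indic (fun p => (\1_A p)%:E) by exists A.
have /(fam_integral_eqP i gP (is_indic_nonneg iA)) := H _ iA.
rewrite !integral_indic ?setIT//.
Qed.

(** Uniqueness of measures on the pi-system of rectangles requires finite mass. The other factors
    are indicators here, so [nu1] has mass at most 1; this is why all factors become indicators
    before any becomes a general function. *)
Let indic_step g i : (forall j, is_indic (g j)) ->
  (forall f, is_rect f -> fam_integral_eq (upd g i f)) ->
  forall f, is_indic f -> fam_integral_eq (upd g i f).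
Proof.
move=> gI H f fI.
have gP j : nonneg_meas (g j) by exact: is_indic_nonneg.
apply/(fam_integral_eqP i gP (is_indic_nonneg fI)).
have rectE A B : measurable A -> measurable B ->
    nu1 i gP (A `*` B) = nu2 i gP (A `*` B).
  move=> mA mB.
  have rAB : is_rect (fun p => (\1_(A `*` B) p)%:E) by exists A, B.
  have /(fam_integral_eqP i gP (is_indic_nonneg (is_rect_indic rAB))) := H _ rAB.
  rewrite !integral_indic ?setIT//; exact: measurableX.
have eqm A : measurable A ->
   nu1 i gP A = nu2 i gP A.
  rewrite measurable_prod_measurableType => mA.
  apply: (@g_sigma_algebra_measure_unique _ _ _
    [set A `*` B | A in measurable & B in measurable] _ (fun=> setT) _ _
    (nu1 i gP) (nu2 i gP)) => //.
  - by move=> _ [B mB [C mC <-]]; exact: measurableX.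
  - by move=> _; exists setT => //; exists setT => //; rewrite setXTT.
  - by rewrite bigcup_const.
  - move=> _ _ [B mB [C mC <-]] [B' mB' [C' mC' <-]].
    exists (B `&` B'); first exact: measurableI.
    by exists (C `&` C'); [exact: measurableI|rewrite setXI].
  - by move=> _ [B mB [C mC <-]]; exact: rectE.
  - move=> _; rewrite -[X in X < _]/(wpush P (a g i) (h i) setT) /wpush preimage_setT.
    apply: (@le_lt_trans _ _ (\int[P]_x 1)).
      apply: ge0_le_integral => //.
      + by move=> x _; exact: a_ge0.
      + exact: ma.
      + move=> x _; apply: (@big_rec _ (fun y => y <= 1)) => // j y _ y1.
        have [G mG ->] := gI j; rewrite indicE; case: (_ \in _); rewrite ?mul1e// mul0e.
        exact: lee01.
    rewrite integral_cst// mul1e; apply: le_lt_trans (ltry 1).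
    exact: sprobability_setT.
case: fI => G mG ->.
rewrite !integral_indic ?setIT//; exact: eqm.
Qed.

Let updE g i : upd g i (g i) = g.
Proof. by apply/funext => j; rewrite /upd; case: eqP => // ->. Qed.

(** All factors share the same environment, so the conditions [B j] merge into their intersection
    and [rect] applies. *)
Let rect_eq g : (forall j, is_rect (g j)) -> fam_integral_eq g.
Proof.
move=> /choice[B] /choice[C] gE.
have mB j : measurable (B j) by have [] := gE j.
have mC j : measurable (C j) by have [] := gE j.
have {}gE j p : g j p = (\1_(B j `*` C j) p)%:E by have [_ _ ->] := gE j.
pose B' := \bigcap_(j in [set: I]) B j.
have mB' : measurable B' by apply: fin_bigcap_measurable => //; exact: finite_finset.
have B'P x : reflect (forall j, x \in B j) (x \in B').
  apply: (iffP idP); rewrite inE; first by move=> H j; rewrite inE; exact: H.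
  by move=> H j _; have := H j; rewrite inE.
rewrite /fam_integral_eq.
transitivity (P [set w | B' (e w) /\ forall i, C i (z i w)]).
  have mS : measurable [set w | B' (e w) /\ forall i, C i (z i w)].
    rewrite (_ : mkset _ = (e @^-1` B') `&` \bigcap_(i in [set: I]) (z i @^-1` C i)).
      apply: measurableI; first by rewrite -[X in measurable X]setTI; exact: me.
      apply: fin_bigcap_measurable => [|i _]; first exact: finite_finset.
      by rewrite -[X in measurable X]setTI; exact: mz.
    by apply/seteqP; split => w /= [Bw Cw]; split => // i; [move=> _|]; exact: Cw.
  rewrite -[X in _ = P X](setIT) -[RHS]integral_indic//; apply: eq_integral => w _.
  rewrite indicE; case: (boolP (w \in _)) => [|wS].
    rewrite inE/= => -[Bw Cw]; apply: big1 => j _; rewrite gE indicE mem_set//=.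
    by split => //=; exact: Bw.
  have [j Hj] : exists j, ~ ((B j `*` C j) (e w, z j w)).
    apply/existsNP => H; move/negP: wS; apply; rewrite inE/=.
    by split => [j _|j]; case: (H j).
  by rewrite (bigD1 j)//= gE indicE memNset// mul0e.
rewrite rect// integral_mkcond; apply: eq_integral => x _; rewrite patchE.
have kE j : \int[k x]_y g j (x, y) = (\1_(B j) x)%:E * (fine (k x (C j)))%:E.
  under eq_integral do rewrite gE.
  rewrite (eq_integral (fun y => (\1_(B j) x)%:E * (\1_(C j) y)%:E)); last first.
    move=> y _; rewrite -EFinM !indicE; congr _%:E; rewrite -natrM mulnb; congr (nat_of_bool _)%:R.
    by apply/idP/andP; rewrite !inE => -[].
  rewrite ge0_integralZl//; last first.
    by apply/measurable_EFinP; exact: measurable_indic.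
  rewrite integral_indic// setIT fineK//.
  by rewrite fin_num_measure.
case: B'P => H.
  rewrite -prodEFin; apply: eq_bigr => j _; rewrite kE indicE H mul1e//.
have [j Hj] : exists j, ~~ (x \in B j).
  by apply: contrapT => H'; apply: H => j; apply/negPn/negP => jn; apply: H'; exists j.
by rewrite (bigD1 j)//= kE indicE (negbTE Hj) mul0e mul0e.
Qed.

Lemma integral_prod_law (g : I -> E * Z -> \bar R) :
  (forall i, measurable_fun setT (g i)) -> (forall i x, 0 <= g i x) ->
  \int[P]_w (\prod_i g i (e w, z i w)) = \int[mu]_x \prod_i \int[k x]_y g i (x, y).
Proof.
move=> mg g0.
(* [s] lists the slots that may hold arbitrary indicators while the others hold rectangles; [H2]
   repeats the scheme with general functions and indicators. *)
have H1 (s : seq I) g' : (forall j, is_indic (g' j)) -> (forall j, j \notin s -> is_rect (g' j)) ->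
    fam_integral_eq g'.
  elim: s g' => [|i s ih] g' gI gR; first by apply: rect_eq => j; exact: gR.
  rewrite -(updE g' i); apply: indic_step => // f fR.
  apply: ih => j; rewrite /upd; case: ifPn => ji //; first exact: is_rect_indic.
  by move=> js; apply: gR; rewrite inE negb_or ji.
have H2 (s : seq I) g' : (forall j, nonneg_meas (g' j)) ->
    (forall j, j \notin s -> is_indic (g' j)) -> fam_integral_eq g'.
  elim: s g' => [|i s ih] g' gP gI.
    by apply: (H1 (enum I)) => j; [exact: gI|rewrite mem_enum].
  rewrite -(updE g' i); apply: measures_eq => // f fI.
  apply: ih => j; rewrite /upd; case: ifPn => ji //; first exact: is_indic_nonneg.
  by move=> js; apply: gI; rewrite inE negb_or ji.
by apply: (H2 (enum I)) => j; [split|rewrite mem_enum].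
Qed.

End product_law.

(** * The Donsker-Varadhan inequality *)

Section donsker_varadhan.
Local Open Scope ereal_scope.
Context d (T : measurableType d) (R : realType).

Lemma bounded_integrable (P : {finite_measure set T -> \bar R}) (f : T -> R) M :
  measurable_fun setT f -> (forall x, `|f x| <= M)%R -> P.-integrable setT (EFin \o f).
Proof.
move=> mf fM; apply: measurable_bounded_integrable => //.
  by rewrite -ge0_fin_numE// fin_num_measure.
by exists M; split; [exact: num_real|] => N MN x _; rewrite /= (le_trans (fM x))// ltW.
Qed.

(** No integrability is asked for, since the logarithm of a density need not be integrable: positive
    and negative parts are compared separately. *)
Lemma le_integral_meas (P : {measure set T -> \bar R}) (f g : T -> \bar R) :
  measurable_fun setT f -> measurable_fun setT g -> (forall x, f x <= g x) ->
  \int[P]_x f x <= \int[P]_x g x.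
Proof.
move=> mf mg fg; rewrite [leLHS]integralE [leRHS]integralE; apply: leeB.
  apply: ge0_le_integral => //; [exact: measurable_funepos|exact: measurable_funepos|].
  by move=> x _; apply: (@funepos_le _ _ setT) => //; rewrite inE.
apply: ge0_le_integral => //; [exact: measurable_funeneg|exact: measurable_funeneg|].
by move=> x _; apply: (@funeneg_le _ _ setT) => //; rewrite inE.
Qed.

Variables (Q P : probability T R).

(** For a density h and a = phi - c, the inequality ln u <= u - 1 at u = exp a / h gives a + 1 - exp
    a / h <= ln h where h > 0. Integration under Q concludes, as the Q-integral of exp a / h is at
    most the P-integral of exp a, hence at most 1. *)
Lemma donsker_varadhan (phi : T -> R) M c : measurable_fun setT phi ->
  (forall x, `|phi x| <= M)%R ->
  \int[P]_x (expR (phi x))%:E <= (expR c)%:E ->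
  \int[Q]_x (phi x)%:E <= KL Q P + c%:E.
Proof.
move=> mphi phiM Hc; rewrite -leeBlDr//; apply: le_ereal_inf_tmp => _ [h [mh h0 hQ] <-].
have intQ (f : T -> \bar R) : measurable_fun setT f -> (forall x, 0 <= f x) ->
    \int[Q]_x f x = \int[P]_x ((h x)%:E * f x).
  move=> mf f0; have mEh : measurable_fun setT (EFin \o h) by exact/measurable_EFinP.
  have Eh0 x : 0 <= (EFin \o h) x by rewrite lee_fin.
  rewrite -(@integral_wpush _ _ _ _ _ P _ _ mEh Eh0 (@measurable_id _ _ setT))//.
  by apply: eq_measure_integral => A mA _; exact: hQ.
pose N := [set x | h x = 0%R].
have mN : measurable N.
  by have := mh measurableT _ (measurable_set1 0%R); rewrite setTI.
have QN : Q N = 0.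
  by rewrite (hQ _ mN) integral0_eq// => x Nx; rewrite Nx.
pose a x : R := (phi x - c)%R.
pose e x : R := (expR (a x) * (h x)^-1)%R.
have ma : measurable_fun setT a by exact: measurable_funB.
have me : measurable_fun setT e.
  apply: measurable_funM; first exact: measurableT_comp.
  by under eq_fun do rewrite -powR_inv1//; exact: (measurableT_comp (measurable_powR _)).
have e0 x : (0 <= e x)%R by rewrite mulr_ge0// ?expR_ge0// invr_ge0.
have e1 : \int[Q]_x (e x)%:E <= 1.
  rewrite intQ//; last exact/measurable_EFinP.
  apply: (@le_trans _ _ (\int[P]_x ((expR (- c))%:E * (expR (phi x))%:E))).
    apply: ge0_le_integral => //.
    - by move=> x _; rewrite -EFinM lee_fin mulr_ge0.
    - by apply/measurable_EFinP; exact: measurable_funM.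
    - apply/measurable_EFinP; apply: measurable_funM => //; exact: measurableT_comp.
    - move=> x _; rewrite -!EFinM lee_fin -expRD addrC -/(a x) /e.
      have [->|hx] := eqVneq (h x) 0%R; first by rewrite mul0r expR_ge0.
      by rewrite mulrCA divff// mulr1.
  rewrite ge0_integralZl//; last by apply/measurable_EFinP; exact: measurableT_comp.
  apply: le_trans (lee_wpmul2l _ Hc) _; first by rewrite lee_fin expR_ge0.
  by rewrite -EFinM -expRD addNr expR0.
have inte : Q.-integrable setT (EFin \o e).
  apply/integrableP; split; first exact/measurable_EFinP.
  under eq_integral do rewrite gee0_abs ?lee_fin//.
  by rewrite (le_lt_trans e1)// ltry.
have inta : Q.-integrable setT (EFin \o (fun x => a x + 1)%R).
  apply: (@bounded_integrable _ _ (M + `|c| + 1)%R); first exact: measurable_funD.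
  move=> x; rewrite /a; apply: (le_trans (ler_normD _ _)); rewrite normr1 lerD2r.
  by apply: (le_trans (ler_normB _ _)); rewrite lerD2r.
apply: (@le_trans _ _ (\int[Q]_x ((a x + 1)%:E - (e x)%:E))).
  rewrite integralB_EFin//.
  have intphi : Q.-integrable setT (EFin \o phi) by exact: bounded_integrable phiM.
  have -> : \int[Q]_x (a x + 1)%:E = \int[Q]_x (phi x)%:E - c%:E + 1.
    transitivity (\int[Q]_x ((phi x)%:E - (c - 1)%:E)).
      by apply: eq_integral => x _; rewrite -EFinB; congr _%:E; rewrite /a; ring.
    rewrite (@integralB_EFin _ _ _ _ _ phi (cst (c - 1)%R))//; last first.
      exact: finite_measure_integrable_cst.
    rewrite /= integral_cst//= probability_setT mule1.
    by rewrite EFinB fin_num_oppeB// addeA.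
  by rewrite -addeA leeDl// sube_ge0 ?orbT.
(* Cut to 0 on the Q-null set where h vanishes, to match the default [ln 0 = 0]; the comparison with
   [ln (h x)] then holds at every point. *)
pose f0 x : R := ((a x + 1 - e x) * \1_(~` N) x)%R.
have mf : measurable_fun setT (fun x => a x + 1 - e x)%R.
  by apply: measurable_funB => //; exact: measurable_funD.
have mf0 : measurable_fun setT f0.
  by apply: measurable_funM => //; apply: measurable_indic; exact: measurableC.
have -> : \int[Q]_x ((a x + 1)%:E - (e x)%:E) = \int[Q]_x (f0 x)%:E.
  apply: ae_eq_integral => //.
  - by under eq_fun do rewrite -EFinB; exact/measurable_EFinP.
  - exact/measurable_EFinP.
  exists N; split => // x /= H; apply: contrapT => Nx; apply: H => _.
  by rewrite /f0 indicE mem_set// mulr1 EFinB.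
apply: le_integral_meas.
- exact/measurable_EFinP.
- by apply/measurable_EFinP; exact: measurableT_comp.
move=> x; rewrite lee_fin /f0 indicE.
have [hx|hx] := eqVneq (h x) 0%R.
  by rewrite memNset ?mulr0 ?hx ?ln0//= /N /= hx; apply.
have hx0 : (0 < h x)%R by rewrite lt_neqAle eq_sym hx h0.
rewrite mem_set ?mulr1; last by rewrite /N /=; exact/eqP.
have : (ln (expR (a x) / h x) <= expR (a x) / h x - 1)%R.
  have := @le_ln1Dx R (expR (a x) / h x - 1); rewrite [(1 + _)%R]addrC subrK; apply.
  by rewrite ltrBrDr addNr divr_gt0// expR_gt0.
by rewrite ln_div ?posrE ?expR_gt0// expRK /e; lra.
Qed.

Lemma KL_ge0 : 0 <= KL Q P.
Proof.
have := @donsker_varadhan (cst 0%R) 0%R 0%R; rewrite adde0 integral0; apply => //.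
  by move=> x; rewrite /= normr0.
by under eq_integral do rewrite expR0; rewrite integral_cst//= probability_setT mul1e expR0.
Qed.

End donsker_varadhan.

(** * Joint priors for non-measurable families *)

Section hahn_banach.
Variables (R : realType) (V : lmodType R) (S : V -> Prop).
Hypothesis SD : forall x y, S x -> S y -> S (x + y).
Hypothesis SZ : forall (t : R) x, S x -> S (t *: x).
Hypothesis S0 : S 0.

Definition sublinear_on (q : V -> R) :=
  (forall x y, S x -> S y -> q (x + y) <= q x + q y) /\
  (forall (t : R) x, 0 < t -> S x -> q (t *: x) = t * q x).

Let sublin0 q : sublinear_on q -> q 0 = 0.
Proof.
by move=> [_ qZ]; have := qZ 2 0 (ltr0Sn _ 1) S0; rewrite scaler0 => H; lra.
Qed.

Let SN x : S x -> S (- x).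
Proof. by rewrite -scaleN1r; exact: SZ. Qed.

Let sublinN q x : sublinear_on q -> S x -> - q (- x) <= q x.
Proof.
move=> qs Sx; rewrite lerNl -subr_ge0 opprK -(sublin0 qs) -(subrr x) addrC.
by apply: (proj1 qs) => //; exact: SN.
Qed.

(** The values are bounded below by - p (- x), so the pointwise infimum is real. Subadditivity uses
    the chain condition: of two members, the smaller serves for both arguments. *)
Let chain_inf p (A : set (V -> R)) : sublinear_on p -> A !=set0 ->
  (forall q, A q -> sublinear_on q /\ forall x, S x -> q x <= p x) ->
  (forall q q', A q -> A q' -> (forall x, S x -> q x <= q' x) \/
                               (forall x, S x -> q' x <= q x)) ->
  exists2 q, sublinear_on q & forall q', A q' -> forall x, S x -> q x <= q' x.
Proof.
move=> ps [q0 Aq0] AP Ach; pose B x := [set q x | q in A].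
have B0 x : B x !=set0 by exists (q0 x), q0.
have Blb x : S x -> has_lbound (B x).
  move=> Sx; exists (- p (- x)) => _ [q /AP[qs qp] <-].
  by apply: le_trans (sublinN qs Sx); rewrite lerN2 qp//; exact: SN.
have le q x : A q -> S x -> inf (B x) <= q x.
  by move=> Aq Sx; apply: ge_inf; [exact: Blb|exists q].
exists (fun x => inf (B x)); last by move=> q Aq x Sx; exact: le.
split=> [x y Sx Sy|t x t0 Sx] /=.
  rewrite -lerBlDr; apply: lb_le_inf => // _ [q Aq <-].
  rewrite lerBlDr [q x + _]addrC -lerBlDr; apply: lb_le_inf => // _ [q' Aq' <-].
  rewrite lerBlDr; have [[qD _] _] := AP _ Aq; have [[q'D _] _] := AP _ Aq'.
  have [h|h] := Ach _ _ Aq Aq'.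
    apply: (le_trans (le _ _ Aq (SD Sx Sy))); apply: (le_trans (qD _ _ Sx Sy)).
    by rewrite addrC lerD2r h.
  apply: (le_trans (le _ _ Aq' (SD Sx Sy))); apply: (le_trans (q'D _ _ Sx Sy)).
  by rewrite addrC lerD2l h.
apply/eqP; rewrite eq_le; apply/andP; split.
  rewrite mulrC -ler_pdivrMr//; apply: lb_le_inf => // _ [q Aq <-].
  rewrite ler_pdivrMr// mulrC -(proj2 (AP _ Aq).1)//; apply: le => //; exact: SZ.
apply: lb_le_inf => // _ [q Aq <-]; rewrite (proj2 (AP _ Aq).1)// ler_pM2l//.
exact: le.
Qed.

(** The infimum over t >= 0 of q (y + t x) - t q x is a sublinear functional of y below q. By
    minimality it equals q on S, and t = 1 gives q x + q y <= q (x + y). *)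
Let minimal_additive q : sublinear_on q ->
  (forall q', sublinear_on q' -> (forall x, S x -> q' x <= q x) ->
     forall x, S x -> q x <= q' x) ->
  forall x y, S x -> S y -> q (x + y) = q x + q y.
Proof.
move=> qs qmin x y Sx Sy; have [qD qZ] := qs.
pose B y := [set q (y + t *: x) - t * q x | t in [set t | 0 <= t]].
have qZ0 t z : 0 <= t -> S z -> q (t *: z) = t * q z.
  rewrite le_eqVlt => /orP[/eqP<- _|t0]; last exact: qZ.
  by rewrite scale0r mul0r (sublin0 qs).
have B0 z : B z !=set0 by exists (q (z + 0 *: x) - 0 * q x), 0 => /=.
have Blb z : S z -> has_lbound (B z).
  move=> Sz; exists (- q (- z)) => _ [t /= t0 <-].
  rewrite lerBrDl lerBlDr -qZ0//.
  have {1}-> : t *: x = (z + t *: x) + - z by rewrite addrAC subrr add0r.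
  by apply: qD; [apply: SD => //; exact: SZ|exact: SN].
have le z t : S z -> 0 <= t -> inf (B z) <= q (z + t *: x) - t * q x.
  by move=> Sz t0; apply: ge_inf; [exact: Blb|exists t].
have homog_le t z : 0 < t -> S z -> t * inf (B z) <= inf (B (t *: z)).
  move=> t0 Sz; apply: lb_le_inf => // _ [s /= s0 <-].
  have -> : q (t *: z + s *: x) - s * q x = t * (q (z + (s / t) *: x) - (s / t) * q x).
    rewrite mulrBr -(qZ t (z + _))//; last by apply: SD => //; exact: SZ.
    have ts : t * (s / t) = s by rewrite mulrC divfK ?gt_eqF.
    by rewrite scalerDr scalerA ts mulrA ts.
  by rewrite ler_pM2l// le// divr_ge0// ltW.
have Bs : sublinear_on (fun z => inf (B z)).
  split=> [z w Sz Sw|t z t0 Sz] /=.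
    rewrite -lerBlDr; apply: lb_le_inf => // _ [t /= t0 <-].
    rewrite lerBlDr [q (z + _) - _ + _]addrC -lerBlDr; apply: lb_le_inf => // _ [s /= s0 <-].
    rewrite lerBlDr; apply: (le_trans (le _ (s + t) (SD Sz Sw) (addr_ge0 s0 t0))).
    have -> : z + w + (s + t) *: x = (w + s *: x) + (z + t *: x).
        by rewrite scalerDl [z + w]addrC addrACA.
    have := qD (w + s *: x) (z + t *: x) (SD Sw (SZ s Sx)) (SD Sz (SZ t Sx)).
    by rewrite mulrDl; lra.
  apply/eqP; rewrite eq_le homog_le// andbT.
  have := @homog_le t^-1 (t *: z); rewrite invr_gt0 scalerA mulVf ?gt_eqF// scale1r.
  by move=> /(_ t0 (SZ t Sz)); rewrite ler_pdivrMl.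
have Bq z : S z -> inf (B z) <= q z.
  by move=> Sz; have := le z 0 Sz (lexx _); rewrite scale0r addr0 mul0r subr0.
apply/eqP; rewrite eq_le qD//= -lerBrDr addrC.
have := le_trans (qmin _ Bs Bq _ Sy) (le y 1 Sy ler01).
by rewrite scale1r mul1r lerBrDr addrC [y + x]addrC => h; lra.
Qed.

(** Zorn's lemma is applied to sublinear functionals on the whole of S, ordered by decrease, instead
    of partial linear extensions: a minimal one is additive. *)
Lemma hahn_banach_sublinear (p : V -> R) : sublinear_on p -> exists L : V -> R,
  [/\ forall x y, S x -> S y -> L (x + y) = L x + L y,
      forall (t : R) x, 0 < t -> S x -> L (t *: x) = t * L x &
      forall x, S x -> L x <= p x].
Proof.
move=> ps; pose T := {q : V -> R | sublinear_on q /\ forall x, S x -> q x <= p x}.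
pose r (a b : T) := `[< forall x, S x -> sval b x <= sval a x >].
have pp : forall x, S x -> p x <= p x by [].
have [||A Ach|[q [qs qp]] qmin] := @ZL_preorder T (exist _ p (conj ps pp)) r.
- by move=> a; apply/asboolP.
- by move=> a b c /asboolP ab /asboolP bc; apply/asboolP => x Sx; rewrite (le_trans (bc _ Sx))// ab.
- have [[a0 Aa0]|A0] := pselect (A !=set0); last first.
    by exists (exist _ p (conj ps pp)) => s As; exfalso; apply: A0; exists s.
  have [|||q qs qA] := @chain_inf p [set sval a | a in A] ps.
  + by exists (sval a0), a0.
  + by move=> _ [a _ <-]; exact: (svalP a).
  + move=> _ _ [a Aa <-] [b Ab <-].
    by have [/asboolP h|/asboolP h] := Ach _ _ Aa Ab; [right|left].
  have qp x : S x -> q x <= p x.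
    move=> Sx; apply: le_trans (proj2 (svalP a0) _ Sx).
    by apply: qA => //; exists a0.
  exists (exist _ q (conj qs qp)) => s As; apply/asboolP => x Sx /=.
  by apply: qA => //; exists s.
exists q; split => //; last exact: (proj2 qs).
apply: minimal_additive => // q' q's q'q.
have q'p x : S x -> q' x <= p x by move=> Sx; rewrite (le_trans (q'q _ Sx))// qp.
have := qmin (exist _ q' (conj q's q'p)); rewrite /r/= => H.
have /asboolP := H (introT (asboolP _) q'q).
exact.
Qed.

End hahn_banach.

(** * A finitely additive extension of the expectation *)

Section integral_extension.
Context d (T : measurableType d) (R : realType) (P : probability T R).

Definition bounded_fct (S : Type) (f : S -> R) := exists M, forall x, `|f x| <= M.

Lemma bounded_fctD (S : Type) (f g : S -> R) : bounded_fct f -> bounded_fct g ->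
  bounded_fct (fun x => f x + g x).
Proof.
move=> [M fM] [N gN]; exists (M + N) => x.
by rewrite (le_trans (ler_normD _ _))// lerD.
Qed.

Lemma bounded_fctZ (S : Type) t (f : S -> R) : bounded_fct f ->
  bounded_fct (fun x => t * f x).
Proof.
by move=> [M fM]; exists (`|t| * M) => x; rewrite normrM ler_wpM2l.
Qed.

Lemma bounded_fct_cst (S : Type) t : bounded_fct (fun _ : S => t).
Proof. by exists `|t|. Qed.

Let I (u : T -> R) : R := \int[P]_x u x.

Let major (f u : T -> R) := [/\ measurable_fun setT u, bounded_fct u & forall x, f x <= u x].

Let int_bdd u : measurable_fun setT u -> bounded_fct u -> P.-integrable setT (EFin \o u).
Proof. by move=> mu [M uM]; exact: bounded_integrable mu uM. Qed.

Let ID u v : measurable_fun setT u -> bounded_fct u -> measurable_fun setT v -> bounded_fct v ->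
  I (fun x => u x + v x) = I u + I v.
Proof. by move=> *; rewrite /I RintegralD//; exact: int_bdd. Qed.

Let IZ t u : measurable_fun setT u -> bounded_fct u -> I (fun x => t * u x) = t * I u.
Proof. by move=> *; rewrite /I RintegralZl//; exact: int_bdd. Qed.

Let le_I u v : measurable_fun setT u -> bounded_fct u -> measurable_fun setT v -> bounded_fct v ->
  (forall x, u x <= v x) -> I u <= I v.
Proof. by move=> *; apply: le_Rintegral => //; exact: int_bdd. Qed.

Let Icst t : I (fun=> t) = t.
Proof. by rewrite /I Rintegral_cst//= probability_setT mulr1. Qed.

Let upper (f : T -> R) := inf [set I u | u in major f].

Let upper_lb f : bounded_fct f -> has_lbound [set I u | u in major f].
Proof.
move=> [M fM]; exists (- M) => _ [u [mu bu fu] <-]; rewrite -(Icst (- M)).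
apply: le_I => //; first exact: bounded_fct_cst.
by move=> x; apply: le_trans (fu x); have := fM x; rewrite ler_norml => /andP[].
Qed.

Let upper_ne f : bounded_fct f -> [set I u | u in major f] !=set0.
Proof.
move=> [M fM]; exists (I (fun=> M)), (fun=> M) => //; split => //.
  exact: bounded_fct_cst.
by move=> x; exact: le_trans (ler_norm _) (fM x).
Qed.

Let upper_le f u : bounded_fct f -> major f u -> upper f <= I u.
Proof. by move=> bf fu; apply: ge_inf; [exact: upper_lb|exists u]. Qed.

Let upper_sublinear : @sublinear_on R (T -> R^o) (@bounded_fct T) upper.
Proof.
split=> [f g bf bg|t f t0 bf].
  have bfg : bounded_fct (f + g : T -> R^o) by exact: bounded_fctD.
  rewrite -lerBlDr; apply: lb_le_inf; first exact: upper_ne.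
  move=> _ [u [mu bu fu] <-]; rewrite lerBlDr [I u + _]addrC -lerBlDr.
  apply: lb_le_inf; first exact: upper_ne.
  move=> _ [v [mv bv gv] <-]; rewrite lerBlDr [I v + _]addrC -ID//.
  apply: upper_le; [exact: bfg|split; [exact: measurable_funD|exact: bounded_fctD|]].
  by move=> x; rewrite lerD.
have scale_le s h : 0 < s -> bounded_fct h -> upper (s *: (h : T -> R^o)) <= s * upper h.
  move=> s0 bh; rewrite mulrC -ler_pdivrMr//; apply: lb_le_inf; first exact: upper_ne.
  move=> _ [u [mu bu fu] <-]; rewrite ler_pdivrMr// mulrC -IZ//.
  apply: upper_le; first exact: bounded_fctZ.
  split; [exact: measurable_funM|exact: bounded_fctZ|].
  by move=> x; rewrite /GRing.scale/= ler_pM2l.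
apply/eqP; rewrite eq_le scale_le//=.
rewrite -ler_pdivlMl//.
have := @scale_le t^-1 (t *: f); rewrite invr_gt0 scalerA mulVf ?gt_eqF// scale1r.
by apply => //; exact: bounded_fctZ.
Qed.

Lemma integral_extension : exists L : (T -> R) -> R,
  [/\ forall f g, bounded_fct f -> bounded_fct g -> L (fun x => f x + g x) = L f + L g,
      forall t f, 0 < t -> bounded_fct f -> L (fun x => t * f x) = t * L f,
      forall f g, bounded_fct f -> bounded_fct g -> (forall x, f x <= g x) -> L f <= L g &
      forall u, measurable_fun setT u -> bounded_fct u -> L u = \int[P]_x u x].
Proof.
have [|||L [LD LZ Lup]] := @hahn_banach_sublinear R (T -> R^o) (@bounded_fct T) _ _ _ _ upper_sublinear.
- by move=> f g; exact: bounded_fctD.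
- by move=> t f; exact: bounded_fctZ.
- exact: bounded_fct_cst.
have L0 : L (fun=> 0) = 0.
  have := LD (fun=> 0) (fun=> 0) (bounded_fct_cst _ 0) (bounded_fct_cst _ 0).
  have -> : (fun=> 0) + (fun=> 0) = (fun=> 0) :> (T -> R^o) by apply/funext => x; rewrite /= addr0.
  by move=> h; lra.
have LN f : bounded_fct f -> L (fun x => - f x) = - L f.
  move=> bf; have bNf : bounded_fct (fun x => - f x).
    by have := bounded_fctZ (-1) bf; under eq_fun do rewrite mulN1r.
  have := LD f (fun x => - f x) bf bNf.
  have -> : (f : T -> R^o) + (fun x => - f x) = (fun=> 0) by apply/funext => x; rewrite /= subrr.
  by rewrite L0 => h; lra.
have Lle u f : measurable_fun setT u -> bounded_fct u -> bounded_fct f -> (forall x, f x <= u x) ->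
    L f <= I u.
  by move=> mu bu bf fu; apply: le_trans (Lup _ bf) _; exact: upper_le.
exists L; split => //.
- move=> f g bf bg fg.
  have bNf : bounded_fct (fun x => - f x).
    by have := bounded_fctZ (-1) bf; under eq_fun do rewrite mulN1r.
  have bNg : bounded_fct (fun x => - g x).
    by have := bounded_fctZ (-1) bg; under eq_fun do rewrite mulN1r.
  rewrite -subr_le0 -LN// -(LD f _ bf bNg) -[leRHS](Icst 0).
  apply: Lle => //; [exact: bounded_fct_cst|exact: bounded_fctD|].
  by move=> x /=; rewrite /GRing.add/= subr_le0.
- move=> u mu bu; apply/eqP; rewrite eq_le Lle//=.
  have bNu : bounded_fct (fun x => - u x).
    by have := bounded_fctZ (-1) bu; under eq_fun do rewrite mulN1r.
  rewrite -lerN2 -LN// -[- _]mulN1r -[X in _ <= -1 * X]/(I u) -IZ//.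
  apply: Lle => //; [exact: measurable_funM|exact: bounded_fctZ|].
  by move=> x; rewrite mulN1r.
Qed.

End integral_extension.

(** * The countably additive part of a content *)

Section sigma_additive_part.
Local Open Scope ereal_scope.
Local Open Scope measure_scope.
Context d (T : measurableType d) (R : realType) (mu : {content set T -> \bar R}).

(** On measurable sets, the largest measure below [mu]; it may be strictly smaller, as [mu] is only
    finitely additive. *)
Definition content_measure (A : set T) : \bar R := mu^* A.

(** A cover of X splits along A into covers of both pieces, and finite additivity of [mu] preserves
    the total cost. *)
Let cover_caratheodory (A : set T) : measurable A -> (mu^*)%mu.-caratheodory A.
Proof.
move=> mA; apply: le_caratheodory_measurable => X.
apply: le_ereal_inf_tmp => _ [B [mB XB] <-].
have BA k : measurable (B k `&` A) by exact: measurableI.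
have BNA k : measurable (B k `&` ~` A) by apply: measurableI => //; exact: measurableC.
rewrite (@eq_eseriesr _ _ (fun k => mu (B k `&` A) + mu (B k `&` ~` A))); last first.
  move=> k _; rewrite -measureU//; first by rewrite -setIUr setUv setIT.
  by rewrite setIACA setICr setI0.
rewrite nneseriesD//; apply: leeD; apply: ereal_inf_lbound.
  exists (fun k => B k `&` A) => //; split => // x [Xx Ax].
  by have [k _ Bk] := XB _ Xx; exists k.
exists (fun k => B k `&` ~` A) => //; split => // x [Xx Ax].
by have [k _ Bk] := XB _ Xx; exists k.
Qed.

Let content_measure0 : content_measure set0 = 0.
Proof. exact: outer_measure0. Qed.

Let content_measure_ge0 A : 0 <= content_measure A.
Proof. exact: outer_measure_ge0. Qed.

Let content_measure_sigma_additive : semi_sigma_additive content_measure.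
Proof.
move=> F mF tF mUF; apply: (@caratheodory_measure_sigma_additive _ _ (mu^*)%mu) => //.
- by move=> i; exact: cover_caratheodory.
- exact: cover_caratheodory.
Qed.

HB.instance Definition _ := isMeasure.Build _ _ _ content_measure
  content_measure0 content_measure_ge0 content_measure_sigma_additive.

Lemma content_measure_le A : measurable A -> content_measure A <= mu A.
Proof.
move=> mA; apply: ereal_inf_lbound; exists (fun k => if k is 0%N then A else set0).
  by split => [[|k]//|x Ax]; exists 0%N.
rewrite nneseries_recl//.
rewrite eseries0 ?adde0// => -[|i]//.
Qed.

Lemma content_measure_cover A e : measurable A -> (0 < e)%R -> mu setT < +oo ->
  exists F : (set T)^nat, [/\ forall k, measurable (F k), A `<=` \bigcup_k F k &
    forall N, \sum_(k < N) mu (F k) <= content_measure A + e%:E].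
Proof.
move=> mA e0 muT.
have fA : content_measure A \is a fin_num.
  rewrite ge0_fin_numE ?content_measure_ge0// (le_lt_trans (content_measure_le mA))//.
  by apply: le_lt_trans muT; rewrite le_measure ?inE.
have [_ [F [mF AF] <-] Fe] := lb_ereal_inf_adherent e0 fA.
exists F; split => // N; apply: le_trans (ltW Fe).
rewrite -(big_mkord xpredT (mu \o F)).
by apply: nneseries_lim_ge.
Qed.

End sigma_additive_part.

Lemma bounded_xsection d1 d2 (T1 : measurableType d1) (T2 : measurableType d2) (R : realType)
    (K : T1 -> probability T2 R) (A : set (T1 * T2)) : measurable A ->
  bounded_fct (fun a => fine (K a (xsection A a))).
Proof.
move=> mA; exists 1 => a; rewrite ger0_norm ?fine_ge0// -lee_fin fineK.
  by apply: probability_le1; exact: measurable_xsection.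
by rewrite fin_num_measure//; exact: measurable_xsection.
Qed.

Section joint_prior.
Local Open Scope ereal_scope.
Context d1 d2 (T1 : measurableType d1) (T2 : measurableType d2) (R : realType).
Variables (P : probability T1 R) (K : T1 -> probability T2 R) (L : (T1 -> R) -> R).
Hypothesis LD : forall f g, bounded_fct f -> bounded_fct g ->
  L (fun x => f x + g x)%R = (L f + L g)%R.
Hypothesis Lle : forall f g, bounded_fct f -> bounded_fct g ->
  (forall x, f x <= g x)%R -> (L f <= L g)%R.
Hypothesis Lint : forall u, measurable_fun setT u -> bounded_fct u -> L u = (\int[P]_x u x)%R.

Let sec (A : set (T1 * T2)) a : R := fine (K a (xsection A a)).

Let sec_bounded A : measurable A -> bounded_fct (sec A).
Proof. exact: bounded_xsection. Qed.

Let L0 : L (fun=> 0)%R = 0%R.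
Proof. by rewrite Lint//; [rewrite Rintegral_cst//= mul0r|exact: bounded_fct_cst]. Qed.

(* Sections of measurable sets are bounded functions of [a], to which [L] applies
   although they need not be measurable. *)
Definition joint_content (A : set (T1 * T2)) : \bar R :=
  if `[< measurable A >] then (L (sec A))%:E else 0.

Let joint_contentE A : measurable A -> joint_content A = (L (sec A))%:E.
Proof. by move=> mA; rewrite /joint_content asboolT. Qed.

Let joint_content_ge0 A : 0 <= joint_content A.
Proof.
rewrite /joint_content; case: asboolP => // mA; rewrite lee_fin -L0.
apply: Lle; [exact: bounded_fct_cst|exact: sec_bounded|].
by move=> a; rewrite fine_ge0.
Qed.

Let joint_content_additive : measure_function.semi_additive joint_content.
Proof.
have c0 : joint_content set0 = 0.
  rewrite joint_contentE//; congr _%:E; rewrite -L0; congr L.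
  by apply/funext => a; rewrite /sec xsection0 measure0.
apply/(additive2P c0) => A B mA mB AB.
rewrite !joint_contentE//; last exact: measurableU.
rewrite -EFinD -LD; [congr (L _)%:E|exact: sec_bounded|exact: sec_bounded].
apply/funext => a; rewrite /sec xsectionE preimage_setU -!xsectionE measureU.
- by rewrite fineD// fin_num_measure//; exact: measurable_xsection.
- exact: measurable_xsection.
- exact: measurable_xsection.
- by rewrite -xsectionI AB xsection0.
Qed.

HB.instance Definition _ := isContent.Build _ _ _ joint_content
  joint_content_ge0 joint_content_additive.

Let jc : {content set (T1 * T2)%type%type -> \bar R} := joint_content.

Definition joint_prior : {measure set (T1 * T2)%type -> \bar R} := content_measure jc.

Let jcT : joint_content setT = 1.
Proof.
rewrite joint_contentE//; congr _%:E; rewrite (_ : sec setT = fun=> 1%R).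
  by rewrite Lint//; [rewrite Rintegral_cst//= probability_setT mulr1|exact: bounded_fct_cst].
by apply/funext => a; rewrite /sec xsectionE preimage_setT probability_setT.
Qed.

(** Mass can be lost in the passage to the outer measure; a subprobability is enough for Tonelli and
    Markov. *)
Lemma joint_prior_le1 : joint_prior setT <= 1.
Proof. by rewrite -jcT; exact: content_measure_le. Qed.

Lemma joint_prior_cover A e : measurable A -> (0 < e)%R ->
  exists F : (set (T1 * T2)%type)^nat, [/\ forall k, measurable (F k), A `<=` \bigcup_k F k &
    forall N, (\sum_(k < N) L (fun a => fine (K a (xsection (F k) a))))%:E <= joint_prior A + e%:E].
Proof.
move=> mA e0; have [|F [mF AF Fe]] := @content_measure_cover _ _ _ jc A e mA e0.
  by rewrite -[X in X < _]/(joint_content setT) jcT ltry.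
exists F; split => // N; apply: le_trans (Fe N); rewrite -sumEFin.
by apply: lee_sum => k _; rewrite -[leRHS]/(joint_content _) joint_contentE.
Qed.

End joint_prior.

Lemma measurable_fun_levels d (T : measurableType d) (R : realType) J (lev : T -> 'I_J)
    (c : 'I_J -> R) : (forall j, measurable (lev @^-1` [set j])) ->
  measurable_fun setT (fun x => c (lev x)).
Proof.
move=> mX; rewrite (_ : (fun x => _) = fun x => \sum_j c j * \1_(lev @^-1` [set j]) x).
  by apply: measurable_sum => j; apply: measurable_funM => //; exact: measurable_indic.
apply/funext => x; rewrite (bigD1 (lev x))//= indicE mem_set// mulr1 big1 ?addr0//.
by move=> j jx; rewrite indicE memNset ?mulr0//= => h; rewrite h eqxx in jx.
Qed.

(** * The chain rule relative to the joint prior *)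

Section key.
Local Open Scope ereal_scope.
Context d1 d2 (T1 : measurableType d1) (T2 : measurableType d2) (R : realType).

Lemma integral_shift d (T : measurableType d) (P : probability T R) (f : T -> R) M b :
  measurable_fun setT f -> (forall x, `|f x| <= M)%R ->
  \int[P]_x (f x + b)%:E = \int[P]_x (f x)%:E + b%:E.
Proof.
move=> mf fM; have intf : P.-integrable setT (EFin \o f) by exact: bounded_integrable fM.
under eq_integral do rewrite EFinD.
rewrite integralD//; last exact: finite_measure_integrable_cst.
by rewrite integral_cst//= probability_setT mule1.
Qed.

Variables (P : probability T1 R) (K : T1 -> probability T2 R) (L : (T1 -> R) -> R).
Hypothesis LD : forall f g, bounded_fct f -> bounded_fct g ->
  L (fun x => f x + g x)%R = (L f + L g)%R.
Hypothesis LZ : forall (t : R) f, (0 < t)%R -> bounded_fct f ->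
  L (fun x => t * f x)%R = (t * L f)%R.
Hypothesis Lle : forall f g, bounded_fct f -> bounded_fct g ->
  (forall x, f x <= g x)%R -> (L f <= L g)%R.
Hypothesis Lint : forall u, measurable_fun setT u -> bounded_fct u -> L u = (\int[P]_x u x)%R.

Let sec (A : set (T1 * T2)) a : R := fine (K a (xsection A a)).

Variable Mc : {measure set (T1 * T2)%type -> \bar R}.
Hypothesis Mc_le1 : Mc setT <= 1.
Hypothesis Mc_cover : forall A e, measurable A -> (0 < e)%R ->
  exists F : (set (T1 * T2)%type)^nat, [/\ forall k, measurable (F k), A `<=` \bigcup_k F k &
    forall N, (\sum_(k < N) L (sec (F k)))%:E <= Mc A + e%:E].

Variables (rho : probability T1 R) (Q : T1 -> probability T2 R).
Variable QQ : probability (T1 * T2)%type R.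
Hypothesis QQE : forall f : T1 * T2 -> \bar R, measurable_fun setT f -> (forall x, 0 <= f x) ->
  \int[QQ]_x f x = \int[rho]_a \int[Q a]_y f (a, y).
Hypothesis mQint : forall f : T1 * T2 -> \bar R, measurable_fun setT f -> (forall x, 0 <= f x) ->
  measurable_fun setT (fun a => \int[Q a]_y f (a, y)).
Variable D : T1 -> \bar R.
Hypotheses (mD : measurable_fun setT D) (D0 : forall a, 0 <= D a).
Hypothesis HQ : forall a (phi : T2 -> R) M c, measurable_fun setT phi ->
  (forall y, `|phi y| <= M)%R ->
  \int[K a]_y (expR (phi y))%:E <= (expR c)%:E -> \int[Q a]_y (phi y)%:E <= D a + c%:E.

Let sec_bounded A : measurable A -> bounded_fct (sec A).
Proof. exact: bounded_xsection. Qed.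

Let bounded_sum (I : Type) (s : seq I) (f : I -> T1 -> R) :
  (forall i, bounded_fct (f i)) -> bounded_fct (fun a => \sum_(i <- s) f i a)%R.
Proof.
move=> bf; elim: s => [|i s ih].
  by exists 0%R => a; rewrite big_nil normr0.
by under eq_fun do rewrite big_cons; apply: bounded_fctD.
Qed.

Let Lcst t : L (fun=> t) = t.
Proof. by rewrite Lint//; [rewrite Rintegral_cst//= probability_setT mulr1|exact: bounded_fct_cst]. Qed.

Let Lsum (I : Type) (s : seq I) (f : I -> T1 -> R) :
  (forall i, bounded_fct (f i)) -> L (fun a => \sum_(i <- s) f i a)%R = (\sum_(i <- s) L (f i))%R.
Proof.
move=> bf; elim: s => [|i s ih].
  by under eq_fun do rewrite big_nil; rewrite big_nil Lcst.
under eq_fun do rewrite big_cons.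
by rewrite big_cons LD ?ih//; exact: bounded_sum.
Qed.

(* [psi] is a step function and [F j] covers its [j]-th level set.  Finite
   additivity only controls the first [N] sets of each cover, hence the truncation
   [w N] of [psi + B] to [Y N]; the truncation is removed at the end by monotone
   convergence under [QQ], which is countably additive. *)
Section step.
Variables (J : nat) (lev : (T1 * T2)%type -> 'I_J) (cj : 'I_J -> R) (B eps c : R).
Variable F : 'I_J -> (set (T1 * T2)%type)^nat.
Let X j := lev @^-1` [set j].
Hypothesis mX : forall j, measurable (X j).
Hypothesis cB : forall j, (`|cj j| <= B)%R.
Hypothesis mF : forall j k, measurable (F j k).
Hypothesis XF : forall j, X j `<=` \bigcup_k F j k.
Hypothesis Fle : forall j N, (\sum_(k < N) L (sec (F j k)) <= fine (Mc (X j)) + eps)%R.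
Hypothesis sum_le : (\sum_j expR (cj j) * (fine (Mc (X j)) + eps) + expR (- B) + expR (- B) <= expR c)%R.

Let psi x : R := cj (lev x).

Let mpsi : measurable_fun setT psi.
Proof. exact: measurable_fun_levels. Qed.

Let Y N : set (T1 * T2) := \bigcup_(j in [set: 'I_J]) (X j `&` \bigcup_(k in `I_N) F j k).

Let mY N : measurable (Y N).
Proof.
apply: fin_bigcup_measurable => [|j _]; first exact: finite_finset.
by apply: measurableI => //; apply: fin_bigcup_measurable => //; exact: finite_II.
Qed.

Let YP N x : Y N x <-> exists2 k, (k < N)%N & F (lev x) k x.
Proof.
split=> [[j _ [jx [k kN Fk]]]|[k kN Fk]]; first by exists k => //; rewrite jx.
by exists (lev x) => //; split => //; exists k.
Qed.

Let w N x : R := ((psi x + B) * \1_(Y N) x)%R.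

Let psiB x : (0 <= psi x + B <= 2 * B)%R.
Proof. by have := cB (lev x); rewrite /psi ler_norml => /andP[? ?]; lra. Qed.

Let w_bound N x : (0 <= w N x <= 2 * B)%R.
Proof.
have /andP[h1 h2] := psiB x.
by rewrite /w indicE; case: (_ \in _); rewrite ?mulr1 ?mulr0 ?lexx ?h1//=; lra.
Qed.

Let mw N : measurable_fun setT (w N).
Proof. by apply: measurable_funM; [exact: measurable_funD|exact: measurable_indic]. Qed.

Let w_nd x M N : (M <= N)%N -> (w M x <= w N x)%R.
Proof.
move=> MN; rewrite /w ler_wpM2l//; first by case/andP: (psiB x).
rewrite !indicE ler_nat; case: (boolP (x \in Y M)) => //=.
rewrite inE => /YP[k kM Fk]; rewrite mem_set//; apply/YP; exists k => //.
exact: leq_trans MN.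
Qed.

(** Bound for the [K a]-integral of exp (w N - B): on [Y N] the exponent is [psi], paid for by the
    covering sets, and elsewhere it is - B. [H N] need not be measurable, but [L] applies to it. *)
Let H N a : R := (\sum_j expR (cj j) * \sum_(k < N) sec (F j k) a + expR (- B))%R.

Let H_gt0 N a : (0 < H N a)%R.
Proof.
rewrite /H ltr_wpDl ?expR_gt0//; apply: sumr_ge0 => j _; rewrite mulr_ge0 ?expR_ge0//.
by apply: sumr_ge0 => k _; rewrite fine_ge0.
Qed.

Let exp_w N a : \int[K a]_y (expR (w N (a, y) - B))%:E <= (H N a)%:E.
Proof.
pose g y : R := (\sum_j expR (cj j) * \sum_(k < N) \1_(F j k) (a, y) + expR (- B))%R.
have mFa j k : measurable (xsection (F j k) a) by exact: measurable_xsection.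
have indE j k y : \1_(F j k) (a, y) = \1_(xsection (F j k) a) y :> R.
  by rewrite !indicE mem_xsection.
apply: (@le_trans _ _ (\int[K a]_y (g y)%:E)).
  apply: ge0_le_integral => //.
  - apply/measurable_EFinP; apply: measurableT_comp => //; apply: measurable_funB => //.
    by apply: measurableT_comp (mw N) _ => //; exact: measurable_pair1.
  - apply/measurable_EFinP; apply: measurable_funD => //; apply: measurable_sum => j.
    apply: measurable_funM => //; apply: measurable_sum => k.
    by under eq_fun do rewrite indE; exact: measurable_indic.
  - move=> y _; rewrite lee_fin /g; have [yY|yY] := pselect (Y N (a, y)); last first.
      rewrite /w indicE memNset// mulr0 add0r lerDr; apply: sumr_ge0 => j _.
      by rewrite mulr_ge0 ?expR_ge0//; apply: sumr_ge0 => k _; rewrite indicE.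
    rewrite /w indicE mem_set// mulr1 addrK; apply: ler_wpDr; first exact: expR_ge0.
    rewrite (bigD1 (lev (a, y)))//= ler_wpDr//.
      apply: sumr_ge0 => j _; rewrite mulr_ge0 ?expR_ge0//.
      by apply: sumr_ge0 => k _; rewrite indicE.
    rewrite -[leLHS]mulr1 ler_wpM2l ?expR_ge0//.
    have /YP[k kN Fk] := yY; rewrite (bigD1 (Ordinal kN))//= indicE mem_set// lerDl.
    by apply: sumr_ge0 => k' _; rewrite indicE.
have mI j k : measurable_fun setT (fun y => (\1_(F j k) (a, y))%:E : \bar R).
  by apply/measurable_EFinP; under eq_fun do rewrite indE; exact: measurable_indic.
have mI1 j : measurable_fun setT (fun y => \sum_(k < N) (\1_(F j k) (a, y))%:E : \bar R).
  exact: emeasurable_sum.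
have I1_ge0 j y : 0 <= \sum_(k < N) (\1_(F j k) (a, y))%:E :> \bar R.
  by apply: sume_ge0 => k _; rewrite lee_fin.
have mI2 j : measurable_fun setT (fun y => (expR (cj j))%:E * \sum_(k < N) (\1_(F j k) (a, y))%:E).
  exact: emeasurable_funM.
have I2_ge0 j y : 0 <= (expR (cj j))%:E * \sum_(k < N) (\1_(F j k) (a, y))%:E.
  by rewrite mule_ge0// lee_fin expR_ge0.
have mI3 : measurable_fun setT (fun y => \sum_j (expR (cj j))%:E * \sum_(k < N) (\1_(F j k) (a, y))%:E).
  exact: emeasurable_sum.
have -> : \int[K a]_y (g y)%:E =
    \int[K a]_y (\sum_j (expR (cj j))%:E * \sum_(k < N) (\1_(F j k) (a, y))%:E + (expR (- B))%:E).
  apply: eq_integral => y _; rewrite /g EFinD -sumEFin; congr (_ + _).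
  by apply: eq_bigr => j _; rewrite EFinM -sumEFin.
rewrite ge0_integralD//; last by move=> y _; exact: sume_ge0.
rewrite integral_cst//= probability_setT mule1 /H EFinD leeD2r// -sumEFin.
rewrite ge0_integral_sum//; apply: lee_sum => j _.
rewrite ge0_integralZl//.
rewrite EFinM lee_wpmul2l ?lee_fin ?expR_ge0// -sumEFin ge0_integral_sum//.
apply: lee_sum => k _; under eq_integral do rewrite indE.
by rewrite integral_indic// setIT /sec fineK// fin_num_measure.
Qed.

Let U N a := \int[Q a]_y (w N (a, y))%:E.

Let U_bound N a : 0 <= U N a <= (2 * B)%:E.
Proof.
apply/andP; split.
  by apply: integral_ge0 => y _; rewrite lee_fin; case/andP: (w_bound N (a, y)).
rewrite -[leRHS]mule1 -(probability_setT (Q a)) -integral_cst//=.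
apply: ge0_le_integral => //.
- by move=> y _; rewrite lee_fin; case/andP: (w_bound N (a, y)).
- by apply/measurable_EFinP; apply: measurableT_comp (mw N) _ => //; exact: measurable_pair1.
- by move=> y _; rewrite lee_fin; case/andP: (w_bound N (a, y)).
Qed.

Let U_fin N a : U N a \is a fin_num.
Proof.
by have /andP[h1 h2] := U_bound N a; rewrite ge0_fin_numE// (le_lt_trans h2)// ltry.
Qed.

Let U_le N a : U N a - B%:E <= D a + (ln (H N a))%:E.
Proof.
have m2 : measurable_fun setT (fun y => w N (a, y)).
  by apply: measurableT_comp (mw N) _ => //; exact: measurable_pair1.
rewrite -(@integral_shift _ _ (Q a) _ (2 * B)%R (- B)%R)//; last first.
  by move=> y; have /andP[h1 h2] := w_bound N (a, y); rewrite ger0_norm.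
apply: (@HQ a _ B%R).
- exact: measurable_funB.
- by move=> y; have /andP[h1 h2] := w_bound N (a, y); rewrite ler_norml; lra.
- by rewrite lnK ?posrE//; exact: exp_w.
Qed.

(** The function of a to which the Donsker-Varadhan inequality is applied on [T1]. The truncation at
    - B keeps it bounded where [D a] is large or infinite, at the cost of the second [expR (- B)] in
    [sum_le]. *)
Let v N a : R := fine (maxe (U N a - B%:E - D a) (- B)%:E).

Let v_EFin N a : (v N a)%:E = maxe (U N a - B%:E - D a) (- B)%:E.
Proof.
rewrite /v fineK//; have := D0 a; have := U_fin N a.
case: (U N a) => [u| |]// _; case: (D a) => [t| |]//=; rewrite -?EFinB ?maxNye//.
by rewrite -EFin_max.
Qed.

Let mv N : measurable_fun setT (v N).
Proof.
apply: measurableT_comp; first exact: fine_measurable.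
apply: measurable_maxe => //; apply: emeasurable_funB => //; apply: emeasurable_funB => //.
apply: (@mQint (EFin \o w N)); first exact/measurable_EFinP.
by move=> x; rewrite lee_fin; case/andP: (w_bound N x).
Qed.

Let v_bound N a : (`|v N a| <= B)%R.
Proof.
have : (- B)%:E <= (v N a)%:E by rewrite v_EFin le_max lexx orbT.
have : (v N a)%:E <= B%:E.
  rewrite v_EFin ge_max; have /andP[u0 u2] := U_bound N a.
  have Bge0 : (0 <= B)%R.
    by have := le_trans u0 u2; rewrite lee_fin; lra.
  apply/andP; split; last by rewrite lee_fin; lra.
  move: u2 u0 (D0 a); case: (U N a) (U_fin N a) => [u| |]// _; rewrite !lee_fin => u2 u0.
  case: (D a) => [t| |]//=; rewrite -?EFinB ?lee_fin ?leNye// => t0; lra.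
by rewrite !lee_fin ler_norml => -> ->.
Qed.

Let exp_v N a : (expR (v N a) <= H N a + expR (- B))%R.
Proof.
have : (v N a)%:E <= maxe (ln (H N a))%:E (- B)%:E.
  rewrite v_EFin ge_max !le_max lexx orbT andbT; apply/orP.
  have := U_le N a; have := D0 a; case: (U N a) (U_fin N a) => [u| |]// _.
  case: (D a) => [t| |]//=; rewrite -?EFinB -?EFinD ?lee_fin ?leNye; last by left.
  by move=> t0 h; left; lra.
rewrite -EFin_max lee_fin => h.
have {}h : (expR (v N a) <= expR (Num.max (ln (H N a)) (- B)))%R by rewrite ler_expR.
apply: (le_trans h).
rewrite /Num.max; case: ifP => _; first by rewrite lerDr ltW.
by rewrite lnK ?posrE// lerDl expR_ge0.
Qed.

Let int_exp_v N : \int[P]_a (expR (v N a))%:E <= (expR c)%:E.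
Proof.
have be : bounded_fct (fun a => expR (v N a)).
  exists (expR B) => a; rewrite ger0_norm ?expR_ge0// ler_expR.
  by rewrite (le_trans (ler_norm _)).
have me : measurable_fun setT (fun a => expR (v N a)) by exact: measurableT_comp.
have bj j : bounded_fct (fun a => expR (cj j) * \sum_(k < N) sec (F j k) a)%R.
  by apply: bounded_fctZ; apply: bounded_sum => k; exact: sec_bounded.
have bH : bounded_fct (H N).
  by apply: bounded_fctD; [exact: bounded_sum|exact: bounded_fct_cst].
have [M eM] := be.
rewrite -[leLHS]fineK; last by apply: integrable_fin_num => //; exact: bounded_integrable eM.
(* The integrand is measurable, so its integral is a value of [L], which can then be compared with
   the value of [L] at the possibly non-measurable [H N]. *)
rewrite lee_fin -[X in (X <= _)%R]/(\int[P]_a expR (v N a))%R -Lint//.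
apply: (@le_trans _ _ (L (fun a => H N a + expR (- B)))%R).
  by apply: Lle => //; apply: bounded_fctD => //; exact: bounded_fct_cst.
rewrite LD//; last exact: bounded_fct_cst.
rewrite LD; [|exact: bounded_sum|exact: bounded_fct_cst].
rewrite !Lcst Lsum//; apply: le_trans sum_le; rewrite !lerD2r; apply: ler_sum => j _.
rewrite LZ ?expR_gt0//; last by apply: bounded_sum => k; exact: sec_bounded.
by rewrite ler_wpM2l ?expR_ge0// Lsum// => k; exact: sec_bounded.
Qed.

Let int_w N : \int[QQ]_x (w N x)%:E <= KL rho P + \int[rho]_a D a + (c + B)%:E.
Proof.
rewrite QQE//; last 2 first.
- exact/measurable_EFinP.
- by move=> x; rewrite lee_fin; case/andP: (w_bound N x).
have vB a : (0 <= v N a + B)%R.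
  by have := v_bound N a; rewrite ler_norml; lra.
apply: (@le_trans _ _ (\int[rho]_a ((v N a + B)%:E + D a))).
  apply: ge0_le_integral => //.
  - by move=> a _; have /andP[] := U_bound N a.
  - apply: (@mQint (EFin \o w N)); first exact/measurable_EFinP.
    by move=> x; rewrite lee_fin; case/andP: (w_bound N x).
  - by apply: emeasurable_funD => //; apply/measurable_EFinP; exact: measurable_funD.
  - move=> a _; rewrite -/(U N a); have [->|Dy] := eqVneq (D a) +oo; first by rewrite addey// leey.
    rewrite EFinD v_EFin.
    have := D0 a; case: (U N a) (U_fin N a) => [u| |]// _.
    case: (D a) Dy => [t| |]//= _ t0.
    rewrite -EFinB -EFin_max -!EFinD lee_fin.
    have : (u - B - t <= Num.max (u - B - t) (- B))%R by rewrite le_max lexx.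
    by move: (Num.max _ _) => m; lra.
rewrite ge0_integralD//; last 2 first.
- by move=> a _; rewrite lee_fin.
- by apply/measurable_EFinP; exact: measurable_funD.
rewrite (@integral_shift _ _ _ _ B)//.
rewrite [leRHS]addeAC; apply: leeD2r; rewrite [in leRHS]EFinD addeA; apply: leeD2r.
have h := donsker_varadhan rho (mv N) (v_bound N) (int_exp_v N). exact: h.
Qed.

Lemma step_bound : \int[QQ]_x (psi x)%:E <= KL rho P + \int[rho]_a D a + c%:E.
Proof.
(* The shift by B makes the integrands nonnegative for monotone convergence. *)
suff : \int[QQ]_x (psi x + B)%:E <= KL rho P + \int[rho]_a D a + (c + B)%:E.
  rewrite (@integral_shift _ _ _ _ B)//; last by move=> x; exact: cB.
  by rewrite EFinD addeA leeD2rE.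
have lim_w x : (w N x)%:E @[N --> \oo] --> (psi x + B)%:E.
  have [k _ Fk] := XF (erefl (lev x)).
  apply: cvg_near_cst; exists k.+1 => //= N /= kN.
  by rewrite /w indicE mem_set ?mulr1//; apply/YP; exists k.
have -> : \int[QQ]_x (psi x + B)%:E = limn (fun N => \int[QQ]_x (w N x)%:E).
  rewrite -monotone_convergence//.
  - by apply: eq_integral => x _; apply/esym/cvg_lim.
  - by move=> N; exact/measurable_EFinP.
  - by move=> N x _; rewrite lee_fin; case/andP: (w_bound N x).
  - by move=> x _ M N MN; rewrite lee_fin; exact: w_nd.
apply: lime_le.
  apply: ereal_nondecreasing_is_cvgn => M N MN.
  apply: ge0_le_integral => //.
  - by move=> x _; rewrite lee_fin; case/andP: (w_bound M x).
  - exact/measurable_EFinP.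
  - exact/measurable_EFinP.
  - by move=> x _; rewrite lee_fin; exact: w_nd.
by apply: nearW => N; exact: int_w.
Qed.

End step.
Let Mc_fin A : measurable A -> Mc A \is a fin_num.
Proof.
move=> mA; rewrite ge0_fin_numE// (@le_lt_trans _ _ 1) ?ltry//.
by apply: le_trans Mc_le1; rewrite le_measure ?inE.
Qed.

Let simple_bound (J : nat) (lev : (T1 * T2)%type -> 'I_J) (cj : 'I_J -> R) c :
  (forall j, measurable (lev @^-1` [set j])) ->
  (\sum_j expR (cj j) * fine (Mc (lev @^-1` [set j])) < expR c)%R ->
  \int[QQ]_x (cj (lev x))%:E <= KL rho P + \int[rho]_a D a + c%:E.
Proof.
move=> mX; set S := (\sum_j _)%R => Sc.
pose s := (\sum_j expR (cj j))%R.
have s0 : (0 <= s)%R by apply: sumr_ge0 => j _; exact: expR_ge0.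
(* The slack exp c - S is shared out: at most half goes to the excess of the covers, and a quarter
   to each of the two terms exp (- B). *)
pose eps := ((expR c - S) / (2 * (s + 1)))%R.
have eps0 : (0 < eps)%R by rewrite divr_gt0 ?subr_gt0//; lra.
pose B := (\sum_j `|cj j| + `|ln ((expR c - S) / 4)|)%R.
have cB j : (`|cj j| <= B)%R.
  by rewrite /B (bigD1 j)//= -addrA lerDl addr_ge0// sumr_ge0.
have eB : (expR (- B) <= (expR c - S) / 4)%R.
  rewrite -[leRHS]lnK ?posrE ?divr_gt0 ?subr_gt0// ler_expR.
  rewrite lerNl (le_trans (ler_norm _))// normrN /B lerDr.
  by apply: sumr_ge0.
have /choice[F FP] : forall j, exists F : (set (T1 * T2)%type)^nat,
    [/\ forall k, measurable (F k), lev @^-1` [set j] `<=` \bigcup_k F k &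
    forall N, (\sum_(k < N) L (sec (F k)))%:E <= Mc (lev @^-1` [set j]) + eps%:E].
  by move=> j; exact: Mc_cover.
apply: (@step_bound J lev cj B eps c F) => //.
- by move=> j k; case: (FP j).
- by move=> j; case: (FP j).
- move=> j N; rewrite -lee_fin EFinD fineK ?Mc_fin//; by case: (FP j).
- have -> : (\sum_j expR (cj j) * (fine (Mc (lev @^-1` [set j])) + eps) = S + s * eps)%R.
    by rewrite /s mulr_suml -big_split/=; apply: eq_bigr => j _; rewrite mulrDr.
  have : (s * eps <= (expR c - S) / 2)%R.
    rewrite /eps mulrA ler_pdivrMr; last by lra.
    by nra.
  by lra.
Qed.

(** Rounding [phi] down to a grid reduces to step functions. [D a] enters through [HQ] only, so it
    may be the relative entropy of larger laws having [Q a] and [K a] as marginals. *)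
Lemma KL_joint_bound (phi : T1 * T2 -> R) M c : measurable_fun setT phi ->
  (forall x, `|phi x| <= M)%R ->
  \int[Mc]_x (expR (phi x))%:E <= (expR c)%:E ->
  \int[QQ]_x (phi x)%:E <= KL rho P + \int[rho]_a D a + c%:E.
Proof.
move=> mphi phiM Hc; apply/lee_addgt0Pr => e e0.
(* One h pays for the rounding of [phi], the other for the strict inequality that [simple_bound]
   asks for. *)
pose h := (e / 2)%R; have h0 : (0 < h)%R by rewrite divr_gt0.
pose t x := ((phi x + M) / h)%R.
have t0 x : (0 <= t x)%R.
  rewrite /t divr_ge0 ?(ltW h0)//.
  by have := phiM x; rewrite ler_norml => /andP[? ?]; lra.
pose J := (Num.truncn ((M + M) / h)%R).+1.
have tJ x : (Num.truncn (t x) < J)%N.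
  rewrite ltnS; apply: Num.Theory.le_truncn; rewrite /t ler_pM2r ?invr_gt0// lerD2r.
  by apply: le_trans (phiM x); exact: ler_norm.
pose lev x : 'I_J := Ordinal (tJ x).
pose cj (j : 'I_J) := (j%:R * h - M)%R.
have levP x : (cj (lev x) <= phi x < cj (lev x) + h)%R.
  have /andP[h1 h2] := Num.Theory.truncn_itv (t0 x).
  move: h1 h2; rewrite /t ler_pdivlMr// ltr_pdivrMr// -natr1 (mulrDl _ 1%R) mul1r /cj/=.
  by rewrite -/(t x); move: (_ * h)%R => y h1 h2; lra.
have levE x j : lev x = j <-> (cj j <= phi x < cj j + h)%R.
  split=> [<-//|/andP[h1 h2]]; apply: val_inj => /=; apply/eqP; rewrite Num.Theory.truncn_eq//.
  rewrite /t ler_pdivlMr// ltr_pdivrMr// -natr1 (mulrDl _ 1%R) mul1r.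
  by move: h1 h2; rewrite /cj; move: (_ * h)%R => y; lra.
have mX j : measurable (lev @^-1` [set j]).
  have -> : lev @^-1` [set j] = setT `&` phi @^-1` `[cj j, (cj j + h)%R[%classic.
    by apply/seteqP; split=> x /=; rewrite in_itv/=; [move/levE|move=> [_ /levE]].
  exact: mphi.
have mpsi : measurable_fun setT (fun x => cj (lev x)) by exact: measurable_fun_levels.
have psiM x : (`|cj (lev x)| <= M + h)%R.
  by have := levP x; have := phiM x; rewrite !ler_norml; lra.
apply: (@le_trans _ _ (\int[QQ]_x (cj (lev x) + h)%:E)).
  apply: le_integral_meas; [exact/measurable_EFinP| |].
    by apply/measurable_EFinP; exact: measurable_funD.
  by move=> x; rewrite lee_fin ltW//; case/andP: (levP x).
rewrite (integral_shift _ _ mpsi psiM).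
rewrite (_ : e%:E = h%:E + h%:E); last by rewrite -EFinD; congr _%:E; rewrite /h; lra.
set X := KL rho P + _.
rewrite addeA; apply: leeD2r; rewrite -[leRHS]addeA -EFinD; apply: (@simple_bound J lev cj (c + h)%R) => //.
rewrite -lte_fin -sumEFin; apply: (@le_lt_trans _ _ (expR c)%:E); last first.
  by rewrite lte_fin ltr_expR; lra.
apply: le_trans Hc.
have -> : \sum_j (expR (cj j) * fine (Mc (lev @^-1` [set j])))%:E =
    \int[Mc]_x \sum_j ((expR (cj j))%:E * (\1_(lev @^-1` [set j]) x)%:E).
  rewrite ge0_integral_sum//; last first.
    by move=> j; apply/measurable_EFinP/measurable_funM => //; exact: measurable_indic.
  apply: eq_bigr => j _; rewrite ge0_integralZl//; last first.
    by apply/measurable_EFinP; exact: measurable_indic.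
  by rewrite integral_indic// setIT EFinM fineK// Mc_fin.
apply: ge0_le_integral => //.
- by move=> x _; apply: sume_ge0 => j _; rewrite mule_ge0// lee_fin ?expR_ge0.
- apply: emeasurable_sum => j.
  by apply/measurable_EFinP/measurable_funM => //; exact: measurable_indic.
- by apply/measurable_EFinP; exact: measurableT_comp.
move=> x _; rewrite (bigD1 (lev x))//= indicE mem_set// mule1 big1 ?adde0.
  by rewrite lee_fin ler_expR; case/andP: (levP x).
by move=> j jx; rewrite indicE memNset ?mule0//= => H; rewrite H eqxx in jx.
Qed.

End key.

(** * Expectation of the e-values *)

Lemma measurable_nat_case d d' (T : measurableType d) (U : measurableType d')
    (N : T -> nat) (f : nat -> T -> U) :
  measurable_fun setT N -> (forall k, measurable_fun setT (f k)) ->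
  measurable_fun setT (fun x => f (N x) x).
Proof.
move=> mN mf _ B mB; rewrite setTI.
rewrite (_ : _ @^-1` B = \bigcup_k ((N @^-1` [set k]) `&` (f k @^-1` B))).
  apply: bigcupT_measurable => k; apply: measurableI.
    by rewrite -[X in measurable X]setTI; exact: mN.
  by rewrite -[X in measurable X]setTI; exact: mf.
by apply/seteqP; split=> [x Bx|x [k _ [/= <-]//]]; exists (N x).
Qed.

Lemma measurable_fine_fun d (T : measurableType d) (R : realType) (f : T -> \bar R) :
  measurable_fun setT f -> measurable_fun setT (fun x => fine (f x)).
Proof. by move=> mf; apply: measurableT_comp => //; exact: fine_measurable. Qed.

Lemma measurable_fun_tnth d d' (T : measurableType d) (U : measurableType d') n
    (f : T -> n.-tuple U) (i : 'I_n) :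
  measurable_fun setT f -> measurable_fun setT (fun x => tnth (f x) i).
Proof. by move=> /measurable_fun_tnthP /(_ i). Qed.

Lemma measurable_fun_comp2 d d1 d2 d3 (T : measurableType d) (T1 : measurableType d1)
    (T2 : measurableType d2) (T3 : measurableType d3) (f : T1 -> T2 -> T3)
    (g : T -> T1) (h : T -> T2) :
  measurable_fun setT (fun p : (T1 * T2)%type => f p.1 p.2) ->
  measurable_fun setT g -> measurable_fun setT h -> measurable_fun setT (fun x => f (g x) (h x)).
Proof. by move=> mf mg mh; exact: (measurableT_comp mf (measurable_fun_pair mg mh)). Qed.

Section prob_of.
Context d (T : measurableType d) (R : realType) (m : {measure set T -> \bar R}).

Definition subprob_fun (H : (m setT <= 1)%E) (A : set T) : \bar R := m A.
Section subprob.
Variable H : (m setT <= 1)%E.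
HB.instance Definition _ := isMeasure.Build _ _ _ (subprob_fun H)
  (measure0 m) (measure_ge0 m) (@measure_semi_sigma_additive _ _ _ m).
HB.instance Definition _ := Measure_isSubProbability.Build _ _ _ (subprob_fun H) H.
Definition subprob_of : giry T R := subprob_fun H.
End subprob.

Definition prob_fun (H : m setT = 1%E) (A : set T) : \bar R := m A.
Section prob.
Variable H : m setT = 1%E.
HB.instance Definition _ := isMeasure.Build _ _ _ (prob_fun H)
  (measure0 m) (measure_ge0 m) (@measure_semi_sigma_additive _ _ _ m).
HB.instance Definition _ := Measure_isProbability.Build _ _ _ (prob_fun H) H.
Definition prob_of : probability T R := prob_fun H.
End prob.

End prob_of.

Section evalue_integral.
Local Open Scope ereal_scope.
Context d (T : measurableType d) (R : realType).

Lemma measurable_bern_ratio (p x : T -> R) : measurable_fun setT p -> measurable_fun setT x ->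
  (forall t, 0 <= p t)%R -> measurable_fun setT (fun t => bern_ratio (p t) (x t)).
Proof.
move=> mp mx p0; rewrite /bern_ratio; apply: measurable_fun_ifT.
- exact: measurable_fun_eqr.
- by apply: measurable_fun_ifT => //; exact: measurable_fun_eqr.
- apply/measurable_EFinP; apply: measurable_funM => //.
  under eq_fun do rewrite -powR_inv1//.
  exact: (@measurableT_comp _ _ _ _ _ _ (fun u : R => u `^ (-1))%R _ p (measurable_powR _)).
Qed.

Lemma measurable_efactor a b (p x : T -> R) : measurable_fun setT p -> measurable_fun setT x ->
  (forall t, 0 <= p t <= 1)%R -> measurable_fun setT (fun t => efactor a b (x t) (p t)).
Proof.
move=> mp mx p01; rewrite /efactor; case: a; case: b => //; apply: measurable_bern_ratio => //.
- by move=> t; case/andP: (p01 t).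
- exact: measurable_funB.
- exact: measurable_funB.
- by move=> t; case/andP: (p01 t); rewrite subr_ge0.
Qed.

Lemma measurable_evalue (I : finType) (A : {set I}) (x : T -> I -> R) (p : T -> R) :
  measurable_fun setT p -> (forall i, measurable_fun setT (x ^~ i)) ->
  (forall t, 0 <= p t <= 1)%R -> measurable_fun setT (fun t => evalue A (x t) (p t)).
Proof.
move=> mp mx p01; apply: emeasurable_sum => J; apply: emeasurable_funM => //.
by apply: measurable_prode => i; exact: measurable_efactor.
Qed.

(** At p = 0 the hypothesis forces x = 0 almost everywhere, so the infinite value is taken on a null
    set only. *)
Lemma integral_bern_ratio_le1 (m : {measure set T -> \bar R}) (x : T -> R) p :
  measurable_fun setT x -> (forall t, 0 <= x t)%R -> (0 <= p)%R ->
  \int[m]_t (x t)%:E <= p%:E -> \int[m]_t bern_ratio p (x t) <= 1.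
Proof.
move=> mx x0 p0 xp; have [pE|pn0] := eqVneq p 0%R.
  rewrite (_ : \int[m]_t _ = 0) ?lee01//.
  rewrite -(integral0 m setT); apply: ae_eq_integral => //.
    by apply: measurable_bern_ratio.
  have mE : measurable_fun setT (EFin \o x) by exact/measurable_EFinP.
  have /(ae_eq_integral_abs m measurableT mE) : \int[m]_t `|(EFin \o x) t| = 0.
    apply/eqP; rewrite eq_le integral_ge0// andbT.
    under eq_integral do rewrite gee0_abs ?lee_fin//.
    by move: xp; rewrite pE.
  apply: filterS => t /(_ I) /= [xt] _.
  by rewrite /bern_ratio pE eqxx xt eqxx.
rewrite /bern_ratio (negbTE pn0).
under eq_integral do rewrite EFinM muleC.
have mE : measurable_fun setT (EFin \o x) by exact/measurable_EFinP.
rewrite (@ge0_integralZl _ _ _ m _ measurableT _ mE) ?lee_fin ?invr_ge0//; last first.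
  by move=> t _; rewrite /= lee_fin.
have pp : (0 < p)%R by rewrite lt_neqAle eq_sym pn0.
apply: (@le_trans _ _ (p^-1%:E * p%:E)).
  by rewrite lee_wpmul2l// lee_fin invr_ge0.
by rewrite -EFinM mulVf.
Qed.

(** As [m] has mass at most 1, the integral of 1 - x is at most 1 minus that of x; an inequality is
    all that both kinds of ratio require. *)
Lemma integral_efactor_le (m : giry T R) a b (x : T -> R) :
  measurable_fun setT x -> (forall t, 0 <= x t <= 1)%R ->
  \int[m]_t efactor a b (x t) (fine (\int[m]_t (x t)%:E)) <=
  (if a then 1 else if b then 0 else 1).
Proof.
move=> mx x01; have x0 t : (0 <= x t)%R by case/andP: (x01 t).
have x1 t : (0 <= 1 - x t)%R by case/andP: (x01 t); rewrite subr_ge0.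
have int1 : \int[m]_t (x t)%:E + \int[m]_t (1 - x t)%:E <= 1.
  have mE : measurable_fun setT (fun t => (x t)%:E) by exact/measurable_EFinP.
  have mE1 : measurable_fun setT (fun t => (1 - x t)%:E).
    by apply/measurable_EFinP; exact: measurable_funB.
  have E0 t : setT t -> 0 <= (x t)%:E by rewrite lee_fin.
  have E1 t : setT t -> 0 <= (1 - x t)%:E by rewrite lee_fin.
  rewrite -ge0_integralD//.
  under eq_integral do rewrite -EFinD addrC subrK.
  by rewrite integral_cst// mul1e; exact: sprobability_setT.
have I0 : 0 <= \int[m]_t (x t)%:E by apply: integral_ge0 => t _; rewrite lee_fin.
have I1 : 0 <= \int[m]_t (1 - x t)%:E by apply: integral_ge0 => t _; rewrite lee_fin.
have px : \int[m]_t (x t)%:E \is a fin_num.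
  rewrite ge0_fin_numE//; apply: le_lt_trans (ltry 1).
  by apply: le_trans int1; rewrite leeDl.
rewrite /efactor; case: a; case: b.
- by apply: integral_bern_ratio_le1; rewrite ?fineK ?fine_ge0.
- apply: integral_bern_ratio_le1 => //; first exact: measurable_funB.
    by rewrite subr_ge0 -lee_fin fineK//; apply: le_trans int1; rewrite leeDl.
  by rewrite EFinB fineK// leeBrDl.
- by rewrite integral0.
- by rewrite integral_cst// mul1e; exact: sprobability_setT.
Qed.

Lemma lee_prode (I : finType) (f g : I -> \bar R) : (forall i, 0 <= f i <= g i) ->
  \prod_i f i <= \prod_i g i.
Proof.
move=> fg; suff : 0 <= \prod_i f i <= \prod_i g i by case/andP.
elim/big_ind2 : _ => [|a b c e /andP[a0 ab] /andP[c0 ce]|i _].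
- by rewrite lee01 lexx.
- by rewrite mule_ge0// lee_pmul.
- exact: fg.
Qed.

Lemma prod_efactor_bound (I : finType) (A J : {set I}) (c : I -> \bar R) :
  (forall i, 0 <= c i <= (if i \in A then 1 else if i \in J then 0 else 1)) ->
  \prod_i c i <= ((J \subset A)%:R)%:E.
Proof.
move=> hc; have c1 i : c i <= 1.
  by have /andP[_] := hc i; case: ifP => // _; case: ifP => // _ h; exact: le_trans lee01.
have [JA|/fintype.subsetPn[i iJ iA]] := boolP (J \subset A).
  suff : 0 <= \prod_i c i <= 1 by case/andP.
  elim/big_rec: _ => [|i y _ /andP[y0 y1]]; first by rewrite lee01 lexx.
  have /andP[ci0 _] := hc i; rewrite mule_ge0//=.
  by rewrite -[leRHS]mule1 lee_pmul.
have := hc i; rewrite (negbTE iA) iJ => ci.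
by rewrite (bigD1 i)//= (_ : c i = 0) ?mul0e//; apply/eqP; rewrite eq_le andbC.
Qed.

(** Under the bounds on the factors, each product is at most the indicator of J being inside A, and
    the weights of those J sum to 1. *)
Lemma sum_kt_bound (I : finType) (A : {set I}) (c : {set I} -> I -> \bar R) :
  (forall J i, 0 <= c J i <= (if i \in A then 1 else if i \in J then 0 else 1)) ->
  \sum_(J : {set I}) (kt R #|J| (#|A| - #|J|))%:E * \prod_i c J i <= 1.
Proof.
move=> hc; apply: (@le_trans _ _
    (\sum_(J : {set I}) (if J \subset A then kt R #|J| (#|A| - #|J|) else 0%R)%:E)); last first.
  by rewrite sumEFin -big_mkcond sum_kt.
apply: lee_sum => J _.
apply: (@le_trans _ _ ((kt R #|J| (#|A| - #|J|))%:E * ((J \subset A)%:R)%:E)).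
  by rewrite lee_wpmul2l ?lee_fin ?(ltW (kt_gt0 _ _ _))//; exact: prod_efactor_bound.
by case: ifP => _; rewrite ?mule1// mule0.
Qed.

Lemma markov_le1 (P : probability T R) (X : T -> \bar R) (a : R) : (0 < a)%R ->
  measurable_fun setT X -> (forall t, 0 <= X t) -> \int[P]_t X t <= 1 ->
  measurable [set t | X t < a%:E] /\ (1 - a^-1)%:E <= P [set t | X t < a%:E].
Proof.
move=> a0 mX X0 X1.
have mS : measurable [set t | X t < a%:E].
  by rewrite -[X in measurable X]setTI; exact: emeasurable_fun_infty_o.
split=> //; have := @le_integral_comp_abse _ _ _ P _ measurableT X a id (@measurable_id _ _ _) _ _ mX a0.
rewrite setTI => /(_ _ _) h.
have {}h : a%:E * P [set x | a%:E <= X x] <= 1.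
  apply: le_trans X1; have -> : [set x | a%:E <= X x] = [set x | a%:E <= `|X x|].
    by apply/seteqP; split => x /=; rewrite gee0_abs.
  have -> : \int[P]_x X x = \int[P]_x `|X x| by apply: eq_integral => x _; rewrite gee0_abs.
  by apply: h => // x y _ _.
rewrite -(setCK [set t | _]) probability_setC; last exact: measurableC.
rewrite EFinB leeB//.
have -> : ~` [set t | X t < a%:E] = [set x | a%:E <= X x].
  by apply/seteqP; split => x /=; rewrite leNgt => /negP.
by rewrite -[leRHS]mule1 lee_pdivlMl.
Qed.

End evalue_integral.

(** * Means of the e-values under the sampling laws *)

Section laws.
Local Open Scope ereal_scope.
Context (R : realType).

Lemma integral_iid_prod d (T : measurableType d) n (tau : probability T R)
    (Pr : probability (n.-tuple T) R) (g : 'I_n -> T -> \bar R) : iid_law tau Pr ->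
  (forall i, measurable_fun setT (g i)) -> (forall i t, 0 <= g i t) ->
  \int[Pr]_w \prod_i g i (tnth w i) = \prod_i \int[tau]_t g i t.
Proof.
move=> Pr_law mg g0.
(* Plain independence is conditional independence given a one-point environment. *)
pose mu : giry unit R := giry_ret tt.
pose k : unit -> giry T R := fun _ => tau.
have mk : measurable_fun setT k by exact: measurable_cst.
have intmu (f : unit -> \bar R) B : measurable B -> \int[mu]_(x in B) f x = (\1_B tt)%:E * f tt.
  move=> mB; rewrite integral_mkcond -[LHS]/(giry_int mu (f \_ B)) giry_int_ret//.
  by rewrite patchE indicE; case: ifP => _; rewrite ?mul1e ?mul0e.
have rect (B : set unit) (C : 'I_n -> set T) : measurable B -> (forall i, measurable (C i)) ->
    Pr [set w | B tt /\ forall i, C i (tnth w i)] = \int[mu]_(x in B) (\prod_i fine (k x (C i)))%:E.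
  move=> mB mC; rewrite intmu// indicE; have [Bt|nBt] := pselect (B tt).
    rewrite mem_set// mul1e -Pr_law//; congr (Pr _).
    by apply/seteqP; split => w /=; [case|split].
  rewrite memNset// mul0e (_ : mkset _ = set0) ?measure0//.
  by apply/seteqP; split => w //= [].
have := @integral_prod_law _ _ _ _ _ _ _ _ Pr mu k (fun=> tt) (fun i w => tnth w i) mk _ _ rect
  (fun i p => g i p.2).
move=> /(_ _ _ _ _) h; rewrite h//.
- by rewrite intmu// indicE in_setT mul1e.
- by move=> i; exact: measurable_tnth.
- by move=> i; exact: measurableT_comp.
Qed.

(** The weight depends on the environment alone and is absorbed into the factor of one chosen index
    [i0]. *)
Lemma integral_prod_law_weight d d1 d2 (O : measurableType d) (E : measurableType d1)
    (Z : measurableType d2) (I : finType) (P : giry O R) (mu : giry E R) (k : E -> giry Z R)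
    (e : O -> E) (z : I -> O -> Z) (i0 : I) (u : E -> \bar R) (g : I -> E * Z -> \bar R) :
  measurable_fun setT k -> measurable_fun setT e -> (forall i, measurable_fun setT (z i)) ->
  (forall (B : set E) (C : I -> set Z), measurable B -> (forall i, measurable (C i)) ->
    P [set w | B (e w) /\ forall i, C i (z i w)] =
    \int[mu]_(x in B) (\prod_i fine (k x (C i)))%:E) ->
  measurable_fun setT u -> (forall x, 0 <= u x) ->
  (forall i, measurable_fun setT (g i)) -> (forall i x, 0 <= g i x) ->
  \int[P]_w (u (e w) * \prod_i g i (e w, z i w)) =
  \int[mu]_x (u x * \prod_i \int[k x]_y g i (x, y)).
Proof.
move=> mk me mz rect mu' u0 mg g0.
pose h i (p : E * Z) := if i == i0 then u p.1 * g i p else g i p.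
have hE (p q : I -> \bar R) (a : \bar R) : (forall i, q i = if i == i0 then a * p i else p i) ->
    \prod_i q i = a * \prod_i p i.
  move=> qE; rewrite (bigD1 i0)//= [in RHS](bigD1 i0)//= qE eqxx -muleA; congr (_ * (_ * _)).
  by apply: eq_bigr => i /negbTE ii0; rewrite qE ii0.
transitivity (\int[P]_w \prod_i h i (e w, z i w)).
  apply: eq_integral => w _; symmetry; apply: hE => i; by rewrite /h.
rewrite (integral_prod_law mk me mz rect)//.
- apply: eq_integral => x _; apply: hE => i; rewrite /h; case: eqP => // _ /=.
  rewrite ge0_integralZl//.
  by apply: measurableT_comp (mg i) _ => //; exact: measurable_pair1.
- move=> i; rewrite /h; case: eqP => // _; apply: emeasurable_funM => //.
  exact: (measurableT_comp mu').
- by move=> i x; rewrite /h; case: eqP => // _; exact: mule_ge0.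
Qed.

Lemma integral01 d (T : measurableType d) (m : giry T R) (x : T -> R) :
  measurable_fun setT x -> (forall t, 0 <= x t <= 1)%R ->
  0 <= \int[m]_t (x t)%:E <= 1.
Proof.
move=> mx x01; apply/andP; split.
  by apply: integral_ge0 => t _; rewrite lee_fin; case/andP: (x01 t).
apply: (@le_trans _ _ (\int[m]_t 1)).
  apply: ge0_le_integral => //.
  - by move=> t _; rewrite lee_fin; case/andP: (x01 t).
  - exact/measurable_EFinP.
  - by move=> t _; rewrite lee_fin; case/andP: (x01 t).
by rewrite integral_cst// mul1e; exact: sprobability_setT.
Qed.

Lemma integral01_fin_num d (T : measurableType d) (m : giry T R) (x : T -> R) :
  measurable_fun setT x -> (forall t, 0 <= x t <= 1)%R ->
  \int[m]_t (x t)%:E \is a fin_num.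
Proof.
move=> mx x01; have /andP[h0 h1] := integral01 m mx x01.
by rewrite ge0_fin_numE// (le_lt_trans h1)// ltry.
Qed.

Lemma fine_integral01 d (T : measurableType d) (m : giry T R) (x : T -> R) :
  measurable_fun setT x -> (forall t, 0 <= x t <= 1)%R ->
  (0 <= fine (\int[m]_t (x t)%:E) <= 1)%R.
Proof.
move=> mx x01; rewrite -!lee_fin fineK; first exact: integral01.
exact: integral01_fin_num.
Qed.

Lemma evalue_iid_le1 d (T : measurableType d) n (tau : probability T R)
    (Pr : probability (n.-tuple T) R) (x : T -> R) : iid_law tau Pr ->
  measurable_fun setT x -> (forall t, 0 <= x t <= 1)%R ->
  \int[Pr]_w evalue [set: 'I_n]%SET (fun i => x (tnth w i)) (fine (\int[tau]_t (x t)%:E)) <= 1.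
Proof.
move=> Pr_law mx x01; set p := fine _.
have p01 : (0 <= p <= 1)%R by exact: (@fine_integral01 _ _ tau).
have mf a b : measurable_fun setT (fun t => efactor a b (x t) p).
  by apply: measurable_efactor => //; exact: measurable_cst.
rewrite /evalue ge0_integral_sum//; last 2 first.
- move=> J; apply: emeasurable_funM => //; apply: measurable_prode => i.
  apply: (measurableT_comp (mf _ _)); exact: measurable_tnth.
- move=> J w _; apply: mule_ge0; first by rewrite lee_fin ltW// kt_gt0.
  by apply: prode_ge0 => i _; rewrite efactor_ge0.
rewrite (eq_bigr (fun J : {set 'I_n} => (kt R #|J| (#|[set: 'I_n]%SET| - #|J|))%:E *
   \prod_i \int[tau]_t efactor (i \in [set: 'I_n]%SET) (i \in J) (x t) p)); last first.
  move=> J _; rewrite -(integral_iid_prod Pr_law)//; last first.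
    by move=> i t; rewrite efactor_ge0.
  rewrite ge0_integralZl//.
  - apply: measurable_prode => i.
    apply: (measurableT_comp (mf _ _)); exact: measurable_tnth.
  - by move=> w _; apply: prode_ge0 => i _; rewrite efactor_ge0.
  - by rewrite lee_fin ltW// kt_gt0.
apply: sum_kt_bound => J i; apply/andP; split.
  by apply: integral_ge0 => t _; rewrite efactor_ge0.
exact: (@integral_efactor_le _ _ _ tau).
Qed.

(** Given (D, m), the observed set and the mean are fixed and the entries are independent. The
    mixture weights depend on m and are carried as the weight [u]. *)
Lemma evalue_env_le1 d (Z : measurableType d) mmax (mu : probability (giry Z R * nat)%type R)
    (tau : probability (task Z R mmax) R) (x : Z -> R) : (0 < mmax)%N -> env_law mu tau ->
  measurable_fun setT x -> (forall t, 0 <= x t <= 1)%R ->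
  \int[tau]_t evalue [set j : 'I_mmax | (j < t.1.2)%N]%SET (fun j => x (tnth t.2 j))
    (fine (\int[t.1.1]_z (x z)%:E)) <= 1.
Proof.
move=> mmax_gt0 tau_law mx x01.
pose A (e : giry Z R * nat) := [set j : 'I_mmax | (j < e.2)%N]%SET.
pose p (e : giry Z R * nat) := fine (\int[e.1]_z (x z)%:E).
have p01 e : (0 <= p e <= 1)%R by exact: fine_integral01.
have mp : measurable_fun setT p.
  apply: measurable_fine_fun.
  apply: (@measurableT_comp _ _ _ _ _ _ (fun D : giry Z R => \int[D]_z (x z)%:E)) => //.
  apply: (@measurable_giry_int _ _ _ (EFin \o x)); first exact/measurable_EFinP.
  by move=> z; rewrite lee_fin; case/andP: (x01 z).
pose u (J : {set 'I_mmax}) e := (kt R #|J| (#|A e| - #|J|))%:E.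
have mu' J : measurable_fun setT (u J).
  apply: (@measurable_nat_case _ _ _ _ snd (fun k (e : giry Z R * nat) =>
    (kt R #|J| (#|[set j : 'I_mmax | (j < k)%N]%SET| - #|J|))%:E)) => //.
have u0 J e : 0 <= u J e by rewrite lee_fin ltW// kt_gt0.
pose g (J : {set 'I_mmax}) (j : 'I_mmax) (y : (giry Z R * nat) * Z) :=
  efactor (j \in A y.1) (j \in J) (x y.2) (p y.1).
have mg J j : measurable_fun setT (g J j).
  apply: (@measurable_nat_case _ _ _ _ (fun y : (giry Z R * nat) * Z => y.1.2) (fun k y =>
    efactor (j \in [set j : 'I_mmax | (j < k)%N]%SET) (j \in J) (x y.2) (p y.1))).
    exact: measurableT_comp.
  by move=> k; apply: measurable_efactor => //; exact: measurableT_comp.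
have g0 J j y : 0 <= g J j y by rewrite efactor_ge0.
have mgt J : measurable_fun setT (fun t : task Z R mmax => \prod_j g J j (t.1, tnth t.2 j)).
  apply: measurable_prode => j; apply: (measurableT_comp (mg J j)).
  by apply: measurable_fun_pair => //; exact: measurable_fun_tnth.
rewrite [leLHS](_ : _ = \sum_(J : {set 'I_mmax})
    \int[tau]_t (u J t.1 * \prod_j g J j (t.1, tnth t.2 j))); last first.
  rewrite -ge0_integral_sum//.
  - move=> J; apply: emeasurable_funM => //; exact: (@measurableT_comp _ _ _ _ _ _ (u J)).
  - by move=> J t _; rewrite mule_ge0// prode_ge0.
have int_ge0 J (e : giry Z R * nat) j : 0 <= \int[e.1]_y g J j (e, y) by apply: integral_ge0.
have mint J : measurable_fun setT (fun e : giry Z R * nat => u J e * \prod_j \int[e.1]_y g J j (e, y)).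
  apply: emeasurable_funM => //; apply: measurable_prode => j.
  exact: (measurable_giry_kernel_int (k := fst)).
rewrite (eq_bigr (fun J => \int[mu]_e (u J e * \prod_j \int[e.1]_y g J j (e, y)))); last first.
  move=> J _; apply: (@integral_prod_law_weight _ _ _ _ _ _ _ tau mu fst fst
    (fun j t => tnth t.2 j) (Ordinal mmax_gt0) (u J) (g J)) => //.
  by move=> j; exact: measurable_fun_tnth.
rewrite -ge0_integral_sum//; last first.
  by move=> J e _; rewrite mule_ge0// prode_ge0.
apply: (@le_trans _ _ (\int[mu]_e 1)); last first.
  by rewrite integral_cst//= probability_setT mule1.
apply: ge0_le_integral => //.
- by move=> e _; apply: sume_ge0 => J _; rewrite mule_ge0// prode_ge0.
- exact: emeasurable_sum.
move=> e _; apply: sum_kt_bound => J j; rewrite int_ge0/=.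
exact: (@integral_efactor_le _ _ _ e.1 (j \in A e) (j \in J) x mx x01).
Qed.

End laws.

Section helpers.
Local Open Scope ereal_scope.
Context (R : realType).

Lemma measurable_kernel_integral01 d d' (E : measurableType d) (Y : measurableType d')
    (k : E -> giry Y R) (f : E -> Y -> R) :
  measurable_fun setT k -> measurable_fun setT (fun p : (E * Y)%type => f p.1 p.2) ->
  (forall e y, 0 <= f e y <= 1)%R ->
  measurable_fun setT (fun e => fine (\int[k e]_y (f e y)%:E)).
Proof.
move=> mk mf f01; apply: measurable_fine_fun.
apply: (measurable_giry_kernel_int mk (f := fun p => (f p.1 p.2)%:E)).
  exact/measurable_EFinP.
by move=> p; rewrite lee_fin; case/andP: (f01 p.1 p.2).
Qed.

Lemma measurable_fun_curry d1 d2 d3 (T1 : measurableType d1) (T2 : measurableType d2)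
    (T3 : measurableType d3) (f : T1 * T2 -> T3) x :
  measurable_fun setT f -> measurable_fun setT (fun y => f (x, y)).
Proof. by move=> mf; apply: measurableT_comp mf _ => //; exact: measurable_pair1. Qed.

Lemma measurable_fun_curryl d1 d2 d3 (T1 : measurableType d1) (T2 : measurableType d2)
    (T3 : measurableType d3) (f : T1 * T2 -> T3) y :
  measurable_fun setT f -> measurable_fun setT (fun x => f (x, y)).
Proof. by move=> mf; apply: measurableT_comp mf _ => //; exact: measurable_pair2. Qed.

Lemma markov_mixture d d' (W : measurableType d) (Y : measurableType d')
    (P : probability W R) (M : giry Y R) (X : W * Y -> \bar R) (a : R) :
  (0 < a)%R -> measurable_fun setT X -> (forall t, 0 <= X t) ->
  (forall y, \int[P]_w X (w, y) <= 1) ->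
  measurable [set w | \int[M]_y X (w, y) < a%:E] /\
  (1 - a^-1)%:E <= P [set w | \int[M]_y X (w, y) < a%:E].
Proof.
move=> a0 mX X0 X1; apply: markov_le1 => //.
- apply: (measurable_giry_kernel_int (k := fun=> M)) => //; exact: measurable_cst.
- by move=> w; exact: integral_ge0.
rewrite (@fubini_tonelli _ _ _ _ _ P M X mX X0).
apply: (@le_trans _ _ (\int[M]_y 1)); last first.
  by rewrite integral_cst//= mul1e; exact: sprobability_setT.
apply: ge0_le_integral => //.
- by move=> y _; exact: integral_ge0.
- exact: measurable_fun_fubini_tonelli_G.
Qed.

Lemma klform_bound (r s q p : R) : (0 < r)%R -> (0 < s)%R -> (0 <= q <= 1)%R -> (0 <= p <= 1)%R ->
  (`|klform r s q p| <= `|ln r| + `|ln s| + 1 + r + s)%R.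
Proof.
move=> r0 s0 /andP[q0 q1] /andP[p0 p1]; rewrite /klform.
have hr : (`|q * ln r| <= `|ln r|)%R by rewrite normrM ger0_norm// ler_piMl.
have hs : (`|(1 - q) * ln s| <= `|ln s|)%R.
  by rewrite normrM ger0_norm ?subr_ge0// ler_piMl// gerBl.
have : (0 <= p * r <= r)%R by rewrite mulr_ge0 ?(ltW r0)//= ler_piMl// ltW.
have : (0 <= (1 - p) * s <= s)%R.
  by rewrite mulr_ge0 ?(ltW s0) ?subr_ge0//= ler_piMl ?(ltW s0)// gerBl.
move: hr hs; rewrite !ler_norml.
by move: (q * _)%R (_ * ln s)%R (p * r)%R (_ * s)%R `|ln r|%R `|ln s|%R => a b c d e f; lra.
Qed.

Section integral_klform.
Context d (T : measurableType d) (P : probability T R).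

Lemma integral_sum_klform (I : finType) (w : I -> nat) (r s : I -> R) (q p : I -> T -> R) :
  (forall i, 0 < r i)%R -> (forall i, 0 < s i)%R ->
  (forall i, measurable_fun setT (q i)) -> (forall i, measurable_fun setT (p i)) ->
  (forall i t, 0 <= q i t <= 1)%R -> (forall i t, 0 <= p i t <= 1)%R ->
  [/\ measurable_fun setT (fun t => \sum_i (w i)%:R * klform (r i) (s i) (q i t) (p i t))%R,
    exists M, forall t, (`|\sum_i (w i)%:R * klform (r i) (s i) (q i t) (p i t)| <= M)%R &
    \int[P]_t (\sum_i (w i)%:R * klform (r i) (s i) (q i t) (p i t))%:E =
    (\sum_i (w i)%:R * klform (r i) (s i) (fine (\int[P]_t (q i t)%:E))
                        (fine (\int[P]_t (p i t)%:E)))%:E].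
Proof.
move=> r0 s0 mq mp q01 p01.
have mk i : measurable_fun setT (fun t => klform (r i) (s i) (q i t) (p i t)).
  rewrite /klform; apply: measurable_funB; last by apply: measurable_funM => //; exact: measurable_funB.
  apply: measurable_funB; last exact: measurable_funM.
  apply: measurable_funD => //; apply: measurable_funD; apply: measurable_funM => //.
  exact: measurable_funB.
have kM i t := klform_bound (r0 i) (s0 i) (q01 i t) (p01 i t).
have int01 (f : T -> R) : measurable_fun setT f -> (forall t, 0 <= f t <= 1)%R ->
    P.-integrable setT (EFin \o f).
  move=> mf f01; apply: (@bounded_integrable _ _ _ P f 1%R) => // t.
  by case/andP: (f01 t) => h0 h1; rewrite ger0_norm.
split.
- by apply: measurable_sum => i; exact: measurable_funM.
- exists (\sum_i (w i)%:R * (`|ln (r i)| + `|ln (s i)| + 1 + r i + s i))%R => t.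
  apply: le_trans (ler_norm_sum _ _ _) _; apply: ler_sum => i _.
  by rewrite normrM ger0_norm// ler_wpM2l.
under eq_integral do rewrite -sumEFin.
rewrite integral_sum//; last first.
  move=> i; apply: (@bounded_integrable _ _ _ P (fun t => (w i)%:R * klform (r i) (s i) (q i t) (p i t))%R).
    exact: measurable_funM.
  by move=> t; rewrite normrM ger0_norm//; apply: ler_wpM2l => //; exact: kM.
rewrite -sumEFin; apply: eq_bigr => i _.
have e t : ((w i)%:R * klform (r i) (s i) (q i t) (p i t) =
  ((w i)%:R * (ln (r i) - ln (s i))) * q i t + ((w i)%:R * (s i - r i)) * p i t +
  (w i)%:R * (ln (s i) + 1 - s i))%R by rewrite /klform; ring.
under eq_integral do rewrite e.
have mqq := mq i; have mpp := mp i.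
have iq := int01 _ mqq (q01 i); have ip := int01 _ mpp (p01 i).
under eq_integral do rewrite !EFinD !(EFinM (_ * (_ - _))).
rewrite integralD//; last 2 first.
- apply: integrableD => //; exact: integrableZl.
- exact: finite_measure_integrable_cst.
rewrite integralD//; [|exact: integrableZl|exact: integrableZl].
rewrite !integralZl// integral_cst//= probability_setT mule1.
rewrite -{1}[X in _ * X + _]fineK; last exact: (@integral01_fin_num _ _ _ P).
rewrite -{1}[X in _ + _ * X + _]fineK; last exact: (@integral01_fin_num _ _ _ P).
by rewrite -!EFinM -!EFinD; congr _%:E; rewrite /klform; ring.
Qed.

End integral_klform.

Context dZ (Z : measurableType dZ).

Lemma dataset_sum mmax (t : task Z R mmax) (V : nmodType) (g : Z -> V) :
  (\sum_(z <- dataset t) g z = \sum_(j < mmax | (j < t.1.2)%N) g (tnth t.2 j))%R.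
Proof.
rewrite /dataset; case: t => -[D m] S /=.
case: mmax S => [|k] S; first by rewrite tuple0 big_nil big_ord0.
pose x0 := tnth S ord0; rewrite (big_nth x0) size_take size_tuple.
transitivity (\sum_(0 <= j < k.+1 | (j < m)%N) g (nth x0 S j))%R; last first.
  rewrite big_mkord; apply: eq_bigr => j _; congr g; apply/esym; exact: tnth_nth.
rewrite -/(minn m k.+1) (big_nat_widen _ _ k.+1) ?geq_minr// big_nat_cond [RHS]big_nat_cond.
apply: eq_big => [j|j /andP[/andP[_ jk] jm]].
  by rewrite leq_min; case: (j < k.+1)%N; rewrite ?andbT ?andbF.
by rewrite nth_take//; move: jm => /=; rewrite leq_min => /andP[].
Qed.

Lemma size_dataset mmax (t : task Z R mmax) : (t.1.2 <= mmax)%N -> size (dataset t) = t.1.2.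
Proof. by move=> h; rewrite /dataset size_takel// size_tuple. Qed.

(** [alg] is measurable at each fixed length, while the length of a dataset is random: the lengths
    form a countable partition. *)
Lemma measurable_posterior dA dF (Alg : measurableType dA) (F : measurableType dF)
    mmax (alg : Alg -> seq Z -> probability F R) :
  (forall (k : nat) (B : set F), measurable B ->
     measurable_fun setT (fun p : (Alg * k.-tuple Z)%type => (alg p.1 p.2 B : \bar R))) ->
  measurable_fun setT (fun p : (Alg * task Z R mmax)%type => (alg p.1 (dataset p.2) : giry F R)).
Proof.
move=> alg_meas; apply: measurable_giry_codensity => // B mB.
apply: (@measurable_nat_case _ _ _ _ (fun p : (Alg * task Z R mmax)%type => p.2.1.2)
  (fun k p => alg p.1 (take k p.2.2) B : \bar R)).
  by apply: measurableT_comp => //; exact: measurableT_comp.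
move=> k.
(* The truncated dataset is viewed as a tuple of length [minn k mmax], for which [alg_meas] is
   available. *)
have mk : measurable_fun setT (fun p : (Alg * task Z R mmax)%type =>
    (p.1, [tuple of take k p.2.2])).
  apply: measurable_fun_pair => //; apply/measurable_fun_tnthP => i.
  rewrite (_ : _ \o _ = fun p : (Alg * task Z R mmax)%type =>
     tnth p.2.2 (widen_ord (geq_minr k mmax) i)); last first.
    apply/funext => p; pose x0 := tnth p.2.2 (widen_ord (geq_minr k mmax) i).
    rewrite [LHS](tnth_nth x0) [RHS](tnth_nth x0) /= nth_take//.
    by rewrite (leq_trans (ltn_ord i))// geq_minl.
  apply: measurable_fun_tnth; exact: measurableT_comp.
exact: (measurableT_comp (alg_meas _ _ mB) mk).
Qed.

End helpers.

(** * Mixtures of posteriors *)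

Section measurable_tuple_kernel.
Local Open Scope ereal_scope.
Context d d' (T : measurableType d) (F : measurableType d') (R : realType) (n : nat).

Definition tuple_rect (B : 'I_n -> set F) : set (n.-tuple F) := [set f | forall i, B i (tnth f i)].

Lemma measurable_tuple_rect B : (forall i, measurable (B i)) -> measurable (tuple_rect B).
Proof.
move=> mB; rewrite (_ : tuple_rect B = \bigcap_(i in [set: 'I_n]) ((@tnth n F ^~ i) @^-1` B i)).
  apply: fin_bigcap_measurable => [|i _]; first exact: finite_finset.
  by rewrite -[X in measurable X]setTI; exact: measurable_tnth.
by apply/seteqP; split => f /= h i; [move=> _|]; exact: h.
Qed.

Let rects : set (set (n.-tuple F)) := [set tuple_rect B | B in [set B | forall i, measurable (B i)]].

Let measurable_tupleE : @measurable _ (n.-tuple F) = <<s rects >>.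
Proof.
apply/seteqP; split => [A mA|]; last first.
  apply: smallest_sub; first exact: sigma_algebra_measurable.
  by move=> _ [B mB <-]; exact: measurable_tuple_rect.
have : measurable_fun setT (id : g_sigma_algebraType rects -> n.-tuple F).
  apply/measurable_fun_tnthP => i _ B mB; rewrite setTI; apply: sub_sigma_algebra.
  exists (fun j => if j == i then B else setT) => /=; first by move=> j; case: ifP.
  apply/seteqP; split => f /=; first by move=> /(_ i); rewrite eqxx.
  by move=> Bf j; case: eqP => // ->.
by move=> /(_ measurableT A mA); rewrite setTI.
Qed.

(** Rectangles form a pi-system generating the sigma-algebra of tuples, and the sets with measurable
    evaluation form a Dynkin system. *)
Lemma measurable_tuple_kernel (Q : T -> probability (n.-tuple F) R) :
  (forall B, (forall i, measurable (B i)) -> measurable_fun setT (fun a => Q a (tuple_rect B))) ->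
  measurable_fun setT (fun a => Q a : giry (n.-tuple F) R).
Proof.
move=> mQ; apply: measurable_giry_codensity => // S; rewrite [in X in X -> _]measurable_tupleE.
move: S; apply: (dynkin_induction measurable_tupleE) => //.
- move=> _ _ [B mB <-] [C mC <-]; exists (fun i => B i `&` C i) => /=.
    by move=> i; exact: measurableI.
  apply/seteqP; split => f /=; first by move=> h; split => i; case: (h i).
  by move=> [h1 h2] i; split.
- rewrite (_ : (fun a => _) = cst 1); first exact: measurable_cst.
  by apply/funext => a; exact: (probability_setT (Q a)).
- by move=> _ [B mB <-]; exact: mQ.
- move=> S mS mQS; rewrite (_ : (fun a => _) = (fun a => 1 - Q a S)); first exact: emeasurable_funB.
  by apply/funext => a; exact: (probability_setC (Q a)).
- move=> A mA tA mQA; rewrite (_ : (fun a => _) = (fun a => \sum_(0 <= k <oo) Q a (A k))); last first.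
    by apply/funext => a; rewrite [LHS](measure_bigcup (Q a))//; apply: eq_eseriesl => k; rewrite in_setT.
  apply: (@ge0_emeasurable_sum _ _ _ _ (fun k a => Q a (A k)) xpredT).
    by move=> k a _ _; exact: (measure_ge0 (Q a)).
  by move=> k _; exact: mQA.
Qed.

End measurable_tuple_kernel.

Section mixtures.
Local Open Scope ereal_scope.
Context (R : realType).

Lemma integral_prob_of d (T : measurableType d) (m : {measure set T -> \bar R})
    (H : m setT = 1) (f : T -> \bar R) : \int[prob_of H]_x f x = \int[m]_x f x.
Proof. by apply: eq_measure_integral. Qed.

Lemma integral_subprob_of d (T : measurableType d) (m : {measure set T -> \bar R})
    (H : m setT <= 1) (f : T -> \bar R) : \int[subprob_of H]_x f x = \int[m]_x f x.
Proof. by apply: eq_measure_integral. Qed.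

Lemma probability_pushforward d d' (T : measurableType d) (U : measurableType d') (f : T -> U)
    (P : probability T R) : measurable_fun setT f ->
  exists Q : probability U R, (forall A, Q A = P (f @^-1` A)) /\
    forall g : U -> \bar R, measurable_fun setT g -> (forall x, 0 <= g x) ->
      \int[Q]_x g x = \int[P]_x g (f x).
Proof.
move=> mf; have H : giry_map mf P setT = 1.
  by rewrite -[LHS]/(P (f @^-1` setT)) preimage_setT probability_setT.
exists (prob_of H); split => // g mg g0; rewrite integral_prob_of.
by have := giry_int_map mf P mg g0.
Qed.

Lemma probability_mixture d d' (T : measurableType d) (U : measurableType d')
    (rho : probability T R) (Q : T -> probability U R) :
  measurable_fun setT (fun a => Q a : giry U R) ->
  exists QQ : probability (T * U)%type R,
    forall f : T * U -> \bar R, measurable_fun setT f -> (forall x, 0 <= f x) ->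
      \int[QQ]_x f x = \int[rho]_a \int[Q a]_y f (a, y).
Proof.
move=> mQ; have H : giry_compprod mQ rho setT = 1.
  rewrite -[LHS]mul1e -integral_cst//= giry_compprodE//.
  under eq_integral do rewrite integral_cst//= probability_setT mule1.
  by rewrite integral_cst//= probability_setT mule1.
by exists (prob_of H) => f mf f0; rewrite integral_prob_of giry_compprodE.
Qed.

(** [M] is chosen before [rho], [Q] and [D]: this order makes the final event independent of the
    posteriors. *)
Lemma finitely_additive_joint_prior d1 d2 (T1 : measurableType d1) (T2 : measurableType d2)
    (P : probability T1 R) (K : T1 -> probability T2 R) :
  exists M : giry (T1 * T2)%type R,
    forall (rho : probability T1 R) (Q : T1 -> probability T2 R) (D : T1 -> \bar R),
    measurable_fun setT (fun a => Q a : giry T2 R) ->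
    measurable_fun setT D -> (forall a, 0 <= D a) ->
    (forall a (phi : T2 -> R) B c, measurable_fun setT phi -> (forall y, `|phi y| <= B)%R ->
      \int[K a]_y (expR (phi y))%:E <= (expR c)%:E -> \int[Q a]_y (phi y)%:E <= D a + c%:E) ->
    exists2 QQ : probability (T1 * T2)%type R,
      forall f : T1 * T2 -> \bar R, measurable_fun setT f -> (forall x, 0 <= f x) ->
        \int[QQ]_x f x = \int[rho]_a \int[Q a]_y f (a, y) &
      forall (phi : T1 * T2 -> R) B c, measurable_fun setT phi -> (forall x, `|phi x| <= B)%R ->
        \int[M]_x (expR (phi x))%:E <= (expR c)%:E ->
        \int[QQ]_x (phi x)%:E <= KL rho P + \int[rho]_a D a + c%:E.
Proof.
have [L [LD LZ Lle Lint]] := integral_extension P.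
have M1 := joint_prior_le1 K LD Lle Lint.
exists (subprob_of M1) => rho Q D mQ mD D0 HQ.
have [QQ QQE] := probability_mixture rho mQ.
exists QQ => // phi B c mphi phiB; rewrite integral_subprob_of => Hc.
apply: (KL_joint_bound LD LZ Lle Lint M1 _ QQE _ mD D0 HQ mphi phiB Hc).
- exact: (joint_prior_cover K LD Lle Lint).
- by move=> f mf f0; exact: (measurable_giry_kernel_int mQ mf f0).
Qed.

End mixtures.

(** * Bounds for the meta-risk *)

Section meta.
Local Open Scope ereal_scope.
Context (R : realType) dZ (Z : measurableType dZ) dF (F : measurableType dF).
Variable ell : F -> Z -> R.
Hypothesis ell01 : forall f z, (0 <= ell f z <= 1)%R.
Hypothesis ell_meas : measurable_fun setT (fun p : (F * Z)%type => ell p.1 p.2).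
Variable mmax : nat.

Definition emp_loss (t : task Z R mmax) (f : F) : R :=
  ((t.1.2)%:R^-1 * \sum_(z <- dataset t) ell f z)%R.

Definition pop_loss (t : task Z R mmax) (f : F) : R := fine (\int[t.1.1]_z (ell f z)%:E).

(** The observed indices are the first m entries of the padded tuple. *)
Definition task_evalue (t : task Z R mmax) (f : F) : \bar R :=
  evalue [set j : 'I_mmax | (j < t.1.2)%N]%SET (fun j => ell f (tnth t.2 j)) (pop_loss t f).

Let mellf f : measurable_fun setT (ell f).
Proof. exact: (measurable_fun_curry f ell_meas). Qed.

Let mellz z : measurable_fun setT (ell ^~ z).
Proof. exact: (measurable_fun_curryl z ell_meas). Qed.

Let mell d (T : measurableType d) (f : T -> F) (z : T -> Z) :
  measurable_fun setT f -> measurable_fun setT z -> measurable_fun setT (fun t => ell (f t) (z t)).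
Proof. by move=> mf mz; exact: (measurableT_comp ell_meas (measurable_fun_pair mf mz)). Qed.

Lemma pop_loss01 t f : (0 <= pop_loss t f <= 1)%R.
Proof. exact: fine_integral01. Qed.

Lemma emp_loss01 t f : (1 <= t.1.2 <= mmax)%N -> (0 <= emp_loss t f <= 1)%R.
Proof.
move=> /andP[m1 mm]; have m0 : (0 < (t.1.2)%:R :> R)%R by rewrite ltr0n.
rewrite /emp_loss mulr_ge0 ?invr_ge0//=; last by apply: sumr_ge0 => z _; case/andP: (ell01 f z).
rewrite ler_pdivrMl// mulr1 -(size_dataset mm) -sum1_size natr_sum.
by apply: ler_sum => z _; case/andP: (ell01 f z).
Qed.

Lemma measurable_emp_loss t : measurable_fun setT (emp_loss t).
Proof. by apply: measurable_funM => //; apply: measurable_sum => z; exact: mellz. Qed.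

Lemma measurable_pop_loss_pair :
  measurable_fun setT (fun p : (task Z R mmax * F)%type => pop_loss p.1 p.2).
Proof.
apply: (@measurable_kernel_integral01 _ _ _ _ _ (fun p : (task Z R mmax * F)%type => p.1.1.1)
  (fun p z => ell p.2 z)) => //.
- by apply: measurableT_comp => //; exact: measurableT_comp.
- by apply: mell => //; exact: measurableT_comp.
Qed.

Lemma measurable_pop_loss t : measurable_fun setT (pop_loss t).
Proof. exact: (measurable_fun_curry t measurable_pop_loss_pair). Qed.

Lemma measurable_task_evalue :
  measurable_fun setT (fun p : (task Z R mmax * F)%type => task_evalue p.1 p.2).
Proof.
apply: (@measurable_nat_case _ _ _ _ (fun p : (task Z R mmax * F)%type => p.1.1.2)
  (fun k p => evalue [set j : 'I_mmax | (j < k)%N]%SET (fun j => ell p.2 (tnth p.1.2 j))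
     (pop_loss p.1 p.2))).
  by apply: measurableT_comp => //; exact: measurableT_comp.
move=> k; apply: measurable_evalue.
- exact: measurable_pop_loss_pair.
- move=> j; apply: mell => //; apply: measurable_fun_tnth; exact: measurableT_comp.
- by move=> p; exact: pop_loss01.
Qed.

Lemma task_evalue_ge0 t f : 0 <= task_evalue t f.
Proof. by apply: evalue_ge0 => //; exact: pop_loss01. Qed.

(** A form is affine in its first argument, so m times its value at the empirical mean is the sum of
    its values at the samples. *)
Lemma expR_emp_loss_le (t : task Z R mmax) f r s : (1 <= t.1.2 <= mmax)%N -> (0 < r)%R -> (0 < s)%R ->
  (expR ((t.1.2)%:R * klform r s (emp_loss t f) (pop_loss t f)))%:E <=
  (2 * Num.sqrt (t.1.2)%:R)%:E * task_evalue t f.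
Proof.
move=> /andP[m1 mm] r0 s0; pose A := [set j : 'I_mmax | (j < t.1.2)%N]%SET.
have cA : #|A| = t.1.2.
  rewrite -sum1_card -(size_dataset mm) -sum1_size dataset_sum.
  by apply: eq_bigl => j; rewrite inE.
have := @evalue_lb R _ A (fun j => ell f (tnth t.2 j)) (pop_loss t f) r s.
rewrite cA => /(_ m1 (fun j => ell01 f _) (pop_loss01 t f) r0 s0) h; apply: le_trans h.
rewrite lee_fin ler_expR.
have m0 : ((t.1.2)%:R != 0 :> R)%R by rewrite pnatr_eq0 -lt0n.
have e (q : R) : klform r s q (pop_loss t f) =
   ((ln r - ln s) * q + (ln s + 1 - pop_loss t f * r - (1 - pop_loss t f) * s))%R.
  by rewrite /klform; ring.
under [leRHS]eq_bigr do rewrite e.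
rewrite big_split/= sumr_const cA -mulr_sumr.
rewrite e /emp_loss dataset_sum mulrDr [X in (_ + X <= _)%R]mulr_natl.
rewrite [(_ * (_ * (_ * _)))%R]mulrCA mulVKf//.
by under [X in (_ <= _ * X + _)%R]eq_bigl do rewrite inE.
Qed.

Lemma task_evalue_le1 (mu : probability (giry Z R * nat)%type R)
    (tau : probability (task Z R mmax) R) f : (0 < mmax)%N -> env_law mu tau ->
  \int[tau]_t task_evalue t f <= 1.
Proof. by move=> mm tau_law; exact: (evalue_env_le1 mm tau_law (mellf f)). Qed.

End meta.

(** * From empirical risks to the risks of the observed tasks *)

Section training.
Local Open Scope ereal_scope.
Context (R : realType).

(** Adding the bound B reduces the change of variables to nonnegative functions. *)
Lemma pushforward_bounded d d' (T : measurableType d) (U : measurableType d') (f : T -> U)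
    (P : probability T R) (Q : probability U R) (g : U -> R) B :
  measurable_fun setT f ->
  (forall g : U -> \bar R, measurable_fun setT g -> (forall x, 0 <= g x) ->
      \int[Q]_x g x = \int[P]_x g (f x)) ->
  measurable_fun setT g -> (forall x, `|g x| <= B)%R ->
  \int[Q]_x (g x)%:E = \int[P]_x (g (f x))%:E.
Proof.
move=> mf QP mg gB.
have mgf : measurable_fun setT (fun x => g (f x)) by exact: measurableT_comp.
have : \int[Q]_x (g x + B)%:E = \int[P]_x (g (f x) + B)%:E.
  apply: (QP (fun x => (g x + B)%:E)).
    by apply/measurable_EFinP; exact: measurable_funD.
  by move=> x; have := gB x; rewrite ler_norml lee_fin; lra.
rewrite (integral_shift _ _ mg gB) (integral_shift _ _ mgf (fun x => gB (f x))).
by move=> /(congr1 (fun z => z - B%:E)); rewrite !addeK.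
Qed.

Context dZ (Z : measurableType dZ) dF (F : measurableType dF)
  dA (Alg : measurableType dA).
Variable ell : F -> Z -> R.
Hypothesis ell01 : forall f z, (0 <= ell f z <= 1)%R.
Hypothesis ell_meas : measurable_fun setT (fun p : (F * Z)%type => ell p.1 p.2).
Variable alg : Alg -> seq Z -> probability F R.
Hypothesis alg_meas : forall (k : nat) (B : set F), measurable B ->
  measurable_fun setT (fun p : (Alg * k.-tuple Z)%type => (alg p.1 p.2 B : \bar R)).
Variable mmax : nat.

Definition post_risk (a : Alg) (t : task Z R mmax) : R :=
  fine (\int[alg a (dataset t)]_f (pop_loss ell t f)%:E).

Definition task_risk (rho : probability Alg R) (t : task Z R mmax) : R :=
  fine (\int[rho]_a (post_risk a t)%:E).

Let mellz z : measurable_fun setT (ell ^~ z).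
Proof. exact: (measurable_fun_curryl z ell_meas). Qed.

Let mpop := measurable_pop_loss ell01 ell_meas (mmax := mmax).

Let memp := measurable_emp_loss ell_meas (mmax := mmax).

Lemma hyperpost_marginal n (calQ : probability (giry F R) R) (post : 'I_n -> probability F R)
    (frakQ : probability (giry F R * n.-tuple F)%type R) (Q : probability (n.-tuple F) R) i
    (g : F -> \bar R) :
  hyperpost_law calQ post frakQ -> (forall A, Q A = frakQ (snd @^-1` A)) ->
  measurable_fun setT g -> (forall x, 0 <= g x) ->
  \int[Q]_f g (tnth f i) = \int[post i]_f g f.
Proof.
move=> law QE mg g0.
have [Q' [Q'E Q'int]] := probability_pushforward Q (@measurable_tnth _ F n i).
rewrite -Q'int//; apply: eq_measure_integral => A mA _.
rewrite -[LHS]/(Q' A) Q'E QE; have := law setT (fun j => if j == i then A else setT) measurableT.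
move=> /(_ (fun j => _)) h; rewrite [LHS](_ : _ =
    frakQ [set x | setT x.1 /\ forall j, (if j == i then A else setT) (tnth x.2 j)]).
  rewrite h; last by move=> j; case: ifP.
  rewrite probability_setT mul1e (bigD1 i)//= eqxx big1 ?mulr1; last first.
    by move=> j /negbTE ->; rewrite probability_setT.
  by rewrite fineK// fin_num_measure.
congr (frakQ _); apply/seteqP; split => x /=.
  by move=> Ax; split => // j; case: eqP => // ->.
by move=> [_ /(_ i)]; rewrite eqxx.
Qed.

Lemma integral_emp_loss a (t : task Z R mmax) : (1 <= t.1.2 <= mmax)%N ->
  \int[alg a (dataset t)]_f (emp_loss ell t f)%:E =
  ((size (dataset t))%:R^-1 * \sum_(z <- dataset t) loss_post ell z (alg a (dataset t)))%:E.
Proof.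
move=> /andP[m1 mm]; rewrite (size_dataset mm) /emp_loss.
under eq_integral do rewrite EFinM -sumEFin.
have mE z : measurable_fun setT (fun f => (ell f z)%:E) by exact/measurable_EFinP.
have E0 z f : 0 <= (ell f z)%:E by rewrite lee_fin; case/andP: (ell01 f z).
rewrite ge0_integralZl ?lee_fin ?invr_ge0//; last 2 first.
- exact: emeasurable_sum.
- by move=> f _; exact: sume_ge0.
rewrite ge0_integral_sum// EFinM -sumEFin; congr (_ * _); apply: eq_bigr => z _.
by rewrite /loss_post fineK// (@integral01_fin_num _ _ _ (alg a (dataset t))).
Qed.

(** The product of the task e-values has mean at most 1 for fixed predictors. [M] mixes them, b is
    the level in Markov's inequality, and the marginals of [frakQ] turn integrals under [QQ] into
    the two risks. *)
Lemma training_bound n (mu : probability (giry Z R * nat)%type R)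
    (tau : probability (task Z R mmax) R) (Pr : probability (n.-tuple (task Z R mmax)) R)
    (pi : probability Alg R) (frakP : Alg -> probability (giry F R * n.-tuple F)%type R) (b : R) :
  (0 < mmax)%N -> env_law mu tau -> iid_law tau Pr -> (0 < b)%R ->
  exists G : set (n.-tuple (task Z R mmax)), [/\ measurable G, (1 - b^-1)%:E <= Pr G &
    forall w, G w -> (forall i, (1 <= (tnth w i).1.2 <= mmax)%N) ->
    forall (rho : probability Alg R) (calQ : Alg -> probability (giry F R) R)
      (frakQ : Alg -> probability (giry F R * n.-tuple F)%type R),
    (forall A, hyperpost_law (calQ A) (fun i => alg A (dataset (tnth w i))) (frakQ A)) ->
    measurable_fun setT (fun A => KL (frakQ A) (frakP A)) ->
    \sum_(i < n) ((tnth w i).1.2)%:R%:E *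
      kl (emp_risk alg ell rho (dataset (tnth w i))) (task_risk rho (tnth w i)) <=
    KL rho pi + \int[rho]_A KL (frakQ A) (frakP A) + (ln b)%:E +
    (\sum_(i < n) ln (2 * Num.sqrt ((tnth w i).1.2)%:R))%:E].
Proof.
move=> mmax_gt0 tau_law Pr_law b0.
(* The losses see only (f_1, ..., f_n), so the component in M(F) is projected away. *)
have /choice[K KP] := fun A => probability_pushforward (frakP A) (@measurable_snd _ _ _ (n.-tuple F)).
have [M HM] := finitely_additive_joint_prior pi K.
pose X (p : n.-tuple (task Z R mmax) * (Alg * n.-tuple F)) :=
  \prod_i task_evalue ell (tnth p.1 i) (tnth p.2.2 i).
have mX : measurable_fun setT X.
  apply: measurable_prode => i.
  apply: (measurable_fun_comp2 (f := fun t : task Z R mmax => task_evalue ell t)).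
  - exact: measurable_task_evalue.
  - exact: measurable_fun_tnth.
  - by apply: measurable_fun_tnth; exact: measurableT_comp.
have X0 p : 0 <= X p by apply: prode_ge0 => i _; exact: task_evalue_ge0.
have X1 y : \int[Pr]_w X (w, y) <= 1.
  rewrite (integral_iid_prod (g := fun i t => task_evalue ell t (tnth y.2 i)) Pr_law)//; last 2 first.
  - move=> i; apply: (measurable_fun_comp2 (f := fun t : task Z R mmax => task_evalue ell t)) => //.
    exact: measurable_task_evalue.
  - by move=> i t; exact: task_evalue_ge0.
  apply: (@le_trans _ _ (\prod_(i < n) 1)); last by rewrite big1_eq.
  apply: lee_prode => i.
  rewrite integral_ge0/=; last by move=> t _; exact: task_evalue_ge0.
  exact: task_evalue_le1 tau_law.
have [mG PG] := markov_mixture M b0 mX X0 X1.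
exists [set w | \int[M]_y X (w, y) < b%:E]; split => // w /= Gw wm rho calQ frakQ frakQ_law mKL.
have /choice[Q QP] := fun A => probability_pushforward (frakQ A) (@measurable_snd _ _ _ (n.-tuple F)).
pose D A := KL (frakQ A) (frakP A).
have D0 A : 0 <= D A by exact: KL_ge0.
have mpost := measurable_posterior alg_meas (mmax := mmax).
have mQ : measurable_fun setT (fun A => Q A : giry (n.-tuple F) R).
  apply: measurable_tuple_kernel => B mB.
  rewrite (_ : (fun A => _) = fun A => (\prod_i fine (alg A (dataset (tnth w i)) (B i)))%:E).
    apply/measurable_EFinP; apply: measurable_prod => i _.
    apply: measurable_fine_fun.
    apply: (measurableT_comp (measurable_giry_ev (mB i))).
    exact: (measurable_fun_curryl (tnth w i) mpost).
  apply/funext => A; case: (QP A) => -> _.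
  have := frakQ_law A setT B measurableT mB; rewrite probability_setT mul1e => <-.
  by congr (frakQ A _); apply/seteqP; split => x //= [].
(* Data processing: a function of the tuple is a function on the full space, so the relative entropy
   of the joint laws controls that of the marginals. *)
have HQ A (phi : n.-tuple F -> R) B c : measurable_fun setT phi -> (forall y, `|phi y| <= B)%R ->
    \int[K A]_y (expR (phi y))%:E <= (expR c)%:E -> \int[Q A]_y (phi y)%:E <= D A + c%:E.
  move=> mphi phiB Hc.
  rewrite (pushforward_bounded measurable_snd (QP A).2 mphi phiB).
  apply: (donsker_varadhan (frakQ A) _ (fun x => phiB x.2)).
    exact: measurableT_comp.
  move: Hc; rewrite (KP A).2//.
  by apply/measurable_EFinP; exact: measurableT_comp.
have [QQ QQE HQQ] := HM rho Q D mQ mKL D0 HQ.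
pose q i (y : Alg * n.-tuple F) := emp_loss ell (tnth w i) (tnth y.2 i).
pose p i (y : Alg * n.-tuple F) := pop_loss ell (tnth w i) (tnth y.2 i).
have mtn (i : 'I_n) : measurable_fun setT (fun y : Alg * n.-tuple F => tnth y.2 i).
  exact: measurable_fun_tnth.
have mq i : measurable_fun setT (q i) by exact: (measurableT_comp (memp _)).
have mp i : measurable_fun setT (p i) by exact: (measurableT_comp (mpop _)).
have q01 i y : (0 <= q i y <= 1)%R by exact: emp_loss01.
have p01 i y : (0 <= p i y <= 1)%R by exact: pop_loss01.
have marg i (g : F -> R) : measurable_fun setT g -> (forall f, 0 <= g f)%R ->
    \int[QQ]_y (g (tnth y.2 i))%:E = \int[rho]_A \int[alg A (dataset (tnth w i))]_f (g f)%:E.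
  move=> mg g0; rewrite (QQE (fun y => (g (tnth y.2 i))%:E)); last 2 first.
  - by apply/measurable_EFinP; exact: measurableT_comp.
  - by move=> y; rewrite lee_fin.
  apply: eq_integral => A _.
  apply: (hyperpost_marginal i (g := EFin \o g) (frakQ_law A) (QP A).1) => //.
  exact/measurable_EFinP.
have qE i : fine (\int[QQ]_y (q i y)%:E) = emp_risk alg ell rho (dataset (tnth w i)).
  rewrite (marg i (emp_loss ell (tnth w i))); last 2 first.
  - exact: memp.
  - by move=> f; have /andP[] := emp_loss01 ell01 f (wm i).
  by rewrite /emp_risk; congr fine; apply: eq_integral => A _; exact: integral_emp_loss.
have pE i : fine (\int[QQ]_y (p i y)%:E) = task_risk rho (tnth w i).
  rewrite (marg i (pop_loss ell (tnth w i))); last 2 first.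
  - exact: mpop.
  - by move=> f; have /andP[] := pop_loss01 ell01 ell_meas (tnth w i) f.
  rewrite /task_risk; congr fine; apply: eq_integral => A _; rewrite /post_risk fineK//.
  apply: (@integral01_fin_num _ _ _ (alg A (dataset (tnth w i)))) => // f.
  exact: pop_loss01.
apply: sum_kl_le.
- by move=> i; case/andP: (wm i).
- by move=> i; rewrite -qE; exact: (@fine_integral01 _ _ _ QQ).
- by move=> i; rewrite -pE; exact: (@fine_integral01 _ _ _ QQ).
move=> r s r0 s0.
have [mphi [B phiB] phiE] := integral_sum_klform QQ (fun i => (tnth w i).1.2) r0 s0 mq mp q01 p01.
rewrite (eq_bigr (fun i => ((tnth w i).1.2)%:R * klform (r i) (s i)
  (fine (\int[QQ]_y (q i y)%:E)) (fine (\int[QQ]_y (p i y)%:E)))%R); last first.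
  by move=> i _; rewrite qE pE.
rewrite -phiE -[leRHS]addeA -EFinD; apply: (HQQ _ _ _ mphi phiB).
have sq0 i : (0 < 2 * Num.sqrt ((tnth w i).1.2)%:R :> R)%R.
  by rewrite mulr_gt0// sqrtr_gt0 ltr0n; case/andP: (wm i).
(* The product of the Krichevsky-Trofimov factors, whose logarithm is [c1]. *)
pose cst := (\prod_i (2 * Num.sqrt ((tnth w i).1.2)%:R) : R)%R.
have cst0 : (0 <= cst)%R by apply: prodr_ge0 => i _; exact: ltW.
apply: (@le_trans _ _ (cst%:E * \int[M]_y X (w, y))).
  have mXw : measurable_fun setT (fun y => X (w, y)) by exact: (measurable_fun_curry w mX).
  rewrite -ge0_integralZl//.
  apply: ge0_le_integral => //.
  - by apply/measurable_EFinP; exact: measurableT_comp.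
  - exact: emeasurable_funM.
  move=> y _; rewrite expR_sum -prodEFin /cst -prodEFin -big_split/=.
  apply: lee_prode => i; rewrite lee_fin expR_ge0/=.
  exact: expR_emp_loss_le.
rewrite expRD lnK ?posrE// mulrC EFinM lee_pmul//.
- exact: integral_ge0.
- rewrite lee_fin expR_sum /cst; apply: ler_prod => i _.
  by rewrite (ltW (sq0 i))/= lnK ?posrE.
- exact: ltW.
Qed.

End training.

Lemma mean01 (R : realType) n (x : 'I_n -> R) : (0 < n)%N -> (forall i, 0 <= x i <= 1) ->
  0 <= n%:R^-1 * \sum_i x i <= 1.
Proof.
move=> n0 x01; rewrite mulr_ge0 ?invr_ge0//=; last by apply: sumr_ge0 => i _; case/andP: (x01 i).
rewrite ler_pdivrMl ?ltr0n// mulr1 -[leRHS]mulr1 mulr_natl.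
rewrite -[n in leRHS]card_ord -sumr_const; apply: ler_sum => i _.
by case/andP: (x01 i).
Qed.

Lemma probability_setI_ge d (T : measurableType d) (R : realType) (P : probability T R)
    (A B : set T) (a b : R) : measurable A -> measurable B ->
  ((1 - a)%:E <= P A)%E -> ((1 - b)%:E <= P B)%E -> ((1 - (a + b))%:E <= P (A `&` B))%E.
Proof.
move=> mA mB hA hB.
have hC S c : measurable S -> ((1 - c)%:E <= P S)%E -> (P (~` S) <= c%:E)%E.
  move=> mS; rewrite probability_setC//.
  have : P S \is a fin_num by exact: fin_num_measure.
  by case: (P S) => // x _; rewrite -EFinB !lee_fin; lra.
have mAB : measurable (A `&` B) by exact: measurableI.
have : (P (~` A `|` ~` B) <= (a + b)%:E)%E.
  apply: (@le_trans _ _ (P (~` A) + P (~` B))%E).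
    by apply: measureU2; exact: measurableC.
  by rewrite EFinD leeD// hC.
rewrite -setCI probability_setC//.
have : P (A `&` B) \is a fin_num by exact: fin_num_measure.
by case: (P (A `&` B)) => // x _; rewrite -EFinB !lee_fin; lra.
Qed.

(** The dataset sizes obey their bounds only almost surely, so the exceptional samples are removed
    by a third event, of probability 1. *)
Lemma iid_support (R : realType) d (Z : measurableType d) mmax n
    (mu : probability (giry Z R * nat)%type R) (tau : probability (task Z R mmax) R)
    (Pr : probability (n.-tuple (task Z R mmax)) R) :
  mu [set e : (giry Z R * nat)%type | e.1 setT = 1%E /\ (1 <= e.2 <= mmax)%N] = 1%E ->
  env_law mu tau -> iid_law tau Pr ->
  measurable [set w : n.-tuple (task Z R mmax) | forall i, (1 <= (tnth w i).1.2 <= mmax)%N] /\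
  Pr [set w | forall i, (1 <= (tnth w i).1.2 <= mmax)%N] = 1%E.
Proof.
move=> mu_supp tau_law Pr_law.
pose B := [set e : (giry Z R * nat)%type | (1 <= e.2 <= mmax)%N].
pose S := [set e : (giry Z R * nat)%type | e.1 setT = 1%E /\ (1 <= e.2 <= mmax)%N].
have mB : measurable B.
  rewrite (_ : B = snd @^-1` [set m | (1 <= m <= mmax)%N])//.
  by rewrite -[X in measurable X]setTI; exact: measurable_snd.
have mS : measurable S.
  rewrite (_ : S = (fun e : (giry Z R * nat)%type => e.1 setT) @^-1` [set 1%E] `&` B)//.
  apply: measurableI => //; rewrite -[X in measurable X]setTI.
  have : measurable_fun setT (fun e : (giry Z R * nat)%type => e.1 setT).
    exact: (measurableT_comp (measurable_giry_ev measurableT)).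
  by apply => //; exact: emeasurable_set1.
have mT : measurable [set t : task Z R mmax | B t.1].
  by rewrite -[X in measurable X]setTI; exact: measurable_fst.
have tauT : tau [set t : task Z R mmax | B t.1] = 1%E.
  apply/eqP; rewrite eq_le probability_le1//=.
  have := tau_law B (fun=> setT) mB (fun=> measurableT).
  rewrite (_ : mkset _ = [set t : task Z R mmax | B t.1]); last first.
    by apply/seteqP; split => t //= [].
  move=> ->; rewrite -mu_supp -/S -[X in (X <= _)%E]mul1e -integral_cst//.
  (* On the support of [mu] the first component has mass 1, so this product over the padded entries
     is 1. *)
  pose h (e : (giry Z R * nat)%type) : \bar R := (\prod_(j < mmax) fine (e.1 setT))%:E.
  have mh : measurable_fun setT h.
    apply/measurable_EFinP; apply: measurable_prod => j _; apply: measurable_fine_fun.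
    exact: (measurableT_comp (measurable_giry_ev measurableT)).
  rewrite (@eq_integral _ _ _ mu S h (cst 1%E)); last first.
    by move=> e; rewrite inE => -[e1 _]; rewrite /h e1 big1.
  apply: ge0_subset_integral => //; last by move=> e [].
  - exact: measurable_funTS.
  - by move=> e _; rewrite lee_fin; apply: prodr_ge0 => j _; rewrite fine_ge0.
split.
  rewrite (_ : mkset _ = tuple_rect (fun=> [set t : task Z R mmax | B t.1]))//.
  exact: measurable_tuple_rect.
have := Pr_law (fun=> [set t : task Z R mmax | B t.1]) (fun=> mT).
by rewrite tauT /= big1.
Qed.

(** * From the risks of the observed tasks to the meta-risk *)

Section meta_generalization.
Local Open Scope ereal_scope.
Context (R : realType) dZ (Z : measurableType dZ) dF (F : measurableType dF)
  dA (Alg : measurableType dA).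
Variable ell : F -> Z -> R.
Hypothesis ell01 : forall f z, (0 <= ell f z <= 1)%R.
Hypothesis ell_meas : measurable_fun setT (fun p : (F * Z)%type => ell p.1 p.2).
Variable alg : Alg -> seq Z -> probability F R.
Hypothesis alg_meas : forall (k : nat) (B : set F), measurable B ->
  measurable_fun setT (fun p : (Alg * k.-tuple Z)%type => (alg p.1 p.2 B : \bar R)).
Variables (mmax : nat) (tau : probability (task Z R mmax) R).

Definition meta_loss (a : Alg) : R := fine (\int[tau]_t (post_risk ell alg a t)%:E).

Lemma post_risk01 a (t : task Z R mmax) : (0 <= post_risk ell alg a t <= 1)%R.
Proof.
apply: (@fine_integral01 _ _ _ (alg a (dataset t))); first exact: measurable_pop_loss.
by move=> f; exact: pop_loss01.
Qed.

Lemma measurable_post_risk :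
  measurable_fun setT (fun p : (Alg * task Z R mmax)%type => post_risk ell alg p.1 p.2).
Proof.
apply: (@measurable_kernel_integral01 _ _ _ _ _
  (fun p : (Alg * task Z R mmax)%type => (alg p.1 (dataset p.2) : giry F R))
  (fun p f => pop_loss ell p.2 f)).
- exact: measurable_posterior.
- apply: (measurable_fun_comp2 (f := fun t : task Z R mmax => pop_loss ell t)) => //.
    exact: measurable_pop_loss_pair.
  exact: measurableT_comp.
- by move=> p f; exact: pop_loss01.
Qed.

Lemma task_risk01 (rho : probability Alg R) (t : task Z R mmax) :
  (0 <= task_risk ell alg rho t <= 1)%R.
Proof.
apply: (@fine_integral01 _ _ _ rho (fun a => post_risk ell alg a t)).
  exact: (measurable_fun_curryl t measurable_post_risk).
by move=> a; exact: post_risk01.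
Qed.

Lemma measurable_post_riskr a : measurable_fun setT (post_risk ell alg (mmax := mmax) a).
Proof. exact: (measurable_fun_curry a measurable_post_risk). Qed.

Lemma meta_loss01 a : (0 <= meta_loss a <= 1)%R.
Proof.
apply: (@fine_integral01 _ _ _ tau); first exact: measurable_post_riskr.
by move=> t; exact: post_risk01.
Qed.

Lemma measurable_meta_loss : measurable_fun setT meta_loss.
Proof.
apply: (@measurable_kernel_integral01 _ _ _ _ _ (fun _ : Alg => (tau : giry _ R))
  (fun a t => post_risk ell alg a t)).
- exact: measurable_cst.
- exact: measurable_post_risk.
- by move=> a t; exact: post_risk01.
Qed.

Lemma integral_loss_post a (t : task Z R mmax) :
  \int[t.1.1]_z (loss_post ell z (alg a (dataset t)))%:E = (post_risk ell alg a t)%:E.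
Proof.
have mz z : measurable_fun setT (ell ^~ z) by exact: (measurable_fun_curryl z ell_meas).
have mf f : measurable_fun setT (ell f) by exact: (measurable_fun_curry f ell_meas).
rewrite /post_risk fineK; last first.
  apply: (@integral01_fin_num _ _ _ (alg a (dataset t))); first exact: measurable_pop_loss.
  by move=> f; exact: pop_loss01.
under eq_integral do rewrite /loss_post fineK ?(@integral01_fin_num _ _ _ (alg a (dataset t)))//.
under [RHS]eq_integral do rewrite /pop_loss fineK ?integral01_fin_num//.
have mE : measurable_fun setT (fun p : F * Z => (ell p.1 p.2)%:E) by exact/measurable_EFinP.
have E0 (p : F * Z) : 0 <= (ell p.1 p.2)%:E by rewrite lee_fin; case/andP: (ell01 p.1 p.2).
by have := @fubini_tonelli _ _ _ _ _ (alg a (dataset t)) t.1.1 _ mE E0.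
Qed.

Lemma meta_riskE (rho : probability Alg R) :
  meta_risk alg ell tau rho = (fine (\int[rho]_a (meta_loss a)%:E))%:E.
Proof.
rewrite fineK; last first.
  apply: (@integral01_fin_num _ _ _ rho); first exact: measurable_meta_loss.
  exact: meta_loss01.
rewrite /meta_risk; apply: eq_integral => a _.
rewrite /meta_loss fineK; last first.
  apply: (@integral01_fin_num _ _ _ tau); first exact: measurable_post_riskr.
  by move=> t; exact: post_risk01.
by apply: eq_integral => t _; exact: integral_loss_post.
Qed.

Lemma sum_klform_mean n (r s p : R) (q : 'I_n -> R) : (0 < n)%N ->
  (\sum_i klform r s (q i) p = n%:R * klform r s (n%:R^-1 * \sum_i q i) p)%R.
Proof.
move=> n0; have nn : (n%:R != 0 :> R)%R by rewrite pnatr_eq0 -lt0n.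
have e (u : R) : klform r s u p = ((ln r - ln s) * u + (ln s + 1 - p * r - (1 - p) * s))%R.
  by rewrite /klform; ring.
under eq_bigr do rewrite e.
rewrite e big_split/= sumr_const card_ord -mulr_sumr mulrDr [X in (_ = _ + X)%R]mulr_natl.
by congr (_ + _)%R; rewrite mulrCA mulVKf.
Qed.

(** For fixed a, the n risks [post_risk] are i.i.d. in [0, 1] with mean [meta_loss a], so the tasks
    play the part of samples and only [KL rho pi] is paid. *)
Lemma environment_bound n (Pr : probability (n.-tuple (task Z R mmax)) R)
    (pi : probability Alg R) (b : R) : (0 < n)%N -> iid_law tau Pr -> (0 < b)%R ->
  exists G : set (n.-tuple (task Z R mmax)), [/\ measurable G, (1 - b^-1)%:E <= Pr G &
    forall w, G w -> forall rho : probability Alg R,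
    n%:R%:E * kl (n%:R^-1 * \sum_i task_risk ell alg rho (tnth w i))%R
                 (fine (\int[rho]_a (meta_loss a)%:E)) <=
    KL rho pi + (ln (2 * Num.sqrt n%:R * b))%:E].
Proof.
move=> n0 Pr_law b0.
pose X (p : n.-tuple (task Z R mmax) * Alg) :=
  evalue [set: 'I_n]%SET (fun i => post_risk ell alg p.2 (tnth p.1 i)) (meta_loss p.2).
have mX : measurable_fun setT X.
  apply: measurable_evalue.
  - by apply: (measurableT_comp measurable_meta_loss).
  - move=> i; apply: (measurable_fun_comp2 (f := fun a (t : task Z R mmax) => post_risk ell alg a t)) => //.
      exact: measurable_post_risk.
    exact: measurable_fun_tnth.
  - by move=> p; exact: meta_loss01.
have X0 p : 0 <= X p.
  by apply: evalue_ge0; [move=> i; exact: post_risk01|exact: meta_loss01].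
have X1 a : \int[Pr]_w X (w, a) <= 1.
  have h := @evalue_iid_le1 R _ _ n tau Pr (post_risk ell alg a) Pr_law
    (measurable_post_riskr a) (post_risk01 a).
  exact: h.
have [mG PG] := markov_mixture pi b0 mX X0 X1.
exists [set w | \int[pi]_a X (w, a) < b%:E]; split => // w /= Gw rho.
pose q i a := post_risk ell alg a (tnth w i).
have mq i : measurable_fun setT (q i) by exact: (measurable_fun_curryl (tnth w i) measurable_post_risk).
have q01 i a : (0 <= q i a <= 1)%R by exact: post_risk01.
have risk01 i : (0 <= task_risk ell alg rho (tnth w i) <= 1)%R by exact: task_risk01.
have mean01 : (0 <= n%:R^-1 * \sum_i task_risk ell alg rho (tnth w i) <= 1)%R by exact: mean01.
have meta01 : (0 <= fine (\int[rho]_a (meta_loss a)%:E) <= 1)%R.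
  apply: (@fine_integral01 _ _ _ rho); [exact: measurable_meta_loss|exact: meta_loss01].
(* A single divergence of weight n is treated as a sum with one term. *)
have := @sum_kl_le R 'I_1 (fun=> n) (fun=> (n%:R^-1 * \sum_i task_risk ell alg rho (tnth w i))%R)
  (fun=> fine (\int[rho]_a (meta_loss a)%:E)) (KL rho pi + (ln (2 * Num.sqrt n%:R * b))%:E).
rewrite big_ord1; apply => // r s r0 s0; rewrite big_ord1 -sum_klform_mean//.
move: (r ord0) (s ord0) (r0 ord0) (s0 ord0) => {r0 s0} {}r {}s r0 s0.
have [mphi [B phiB] phiE] := integral_sum_klform rho (fun _ : 'I_n => 1%N) (fun=> r0) (fun=> s0)
  mq (fun=> measurable_meta_loss) q01 (fun=> meta_loss01).
rewrite (eq_bigr (fun i => 1%:R * klform r s (fine (\int[rho]_a (q i a)%:E))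
  (fine (\int[rho]_a (meta_loss a)%:E)))%R); last by move=> i _; rewrite mul1r.
rewrite -phiE; apply: (donsker_varadhan rho mphi phiB).
have sq0 : (0 < 2 * Num.sqrt n%:R :> R)%R by rewrite mulr_gt0// sqrtr_gt0 ltr0n.
have -> : expR (ln (2 * Num.sqrt n%:R * b)) = (2 * Num.sqrt n%:R * b)%R.
  by rewrite lnK// posrE mulr_gt0.
rewrite (EFinM (2 * Num.sqrt n%:R)%R b).
apply: (@le_trans _ _ ((2 * Num.sqrt n%:R)%:E * \int[pi]_a X (w, a))); last first.
  by rewrite lee_pmul2l// ltW.
have mXw : measurable_fun setT (fun a => X (w, a)) by exact: (measurable_fun_curry w mX).
rewrite -ge0_integralZl//.
apply: ge0_le_integral => //.
- by apply/measurable_EFinP; exact: measurableT_comp.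
- exact: emeasurable_funM.
move=> a _; have := @evalue_lb R _ [set: 'I_n]%SET (fun i => q i a) (meta_loss a) r s.
rewrite cardsT card_ord => /(_ n0 (fun i => q01 i a) (meta_loss01 a) r0 s0) h.
apply: le_trans h; rewrite lee_fin ler_expR.
by rewrite [leRHS](eq_bigl xpredT) => [|i]; [apply: ler_sum => i _; rewrite mul1r|rewrite inE].
Qed.

End meta_generalization.

(** * Inversion of the divergence bounds *)

Lemma le_klinv_multi (R : realType) n (ms : 'I_n -> nat) (qs ps : 'I_n -> R) (b : \bar R) :
  (0 < n)%N -> (forall i, 0 <= ps i <= 1) ->
  (\sum_(i < n) (ms i)%:R%:E * kl (qs i) (ps i) <= b)%E ->
  n%:R^-1 * \sum_i ps i <= klinv_multi ms qs b <= 1.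
Proof.
move=> n0 ps01 hb; pose S := [set x : R | exists ps : 'I_n -> R,
  (forall i, 0 <= ps i <= 1) /\ (\sum_(i < n) (ms i)%:R%:E * kl (qs i) (ps i) <= b)%E /\
  x = n%:R^-1 * \sum_(i < n) ps i].
have Sps : S (n%:R^-1 * \sum_i ps i) by exists ps.
have S1 x : S x -> x <= 1 by move=> [p [p01 [_ ->]]]; case/andP: (mean01 n0 p01).
rewrite /klinv_multi -/S; apply/andP; split.
  by apply: ub_le_sup => //; exists 1 => x; exact: S1.
by apply: ge_sup; [exists (n%:R^-1 * \sum_i ps i)|exact: S1].
Qed.

(** If q' <= p, raising q to q' only lowers the divergence, so p stays admissible. If p < q', then
    q' itself is admissible, as [kl q' q'] = 0 and b >= 0. *)
Lemma le_klinv (R : realType) N (q q' p : R) (b : \bar R) :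
  0 <= q -> q <= q' -> q' <= 1 -> 0 <= p <= 1 -> (0 <= b)%E ->
  (N%:R%:E * kl q p <= b)%E -> p <= klinv N q' b.
Proof.
move=> q0 qq' q'1 /andP[p0 p1] b0 hb.
have ubS : has_ubound [set p : R | 0 <= p <= 1 /\ (N%:R%:E * kl q' p <= b)%E].
  by exists 1 => x [/andP[]].
have [q'p|pq'] := leP q' p; last first.
  apply: (le_trans (ltW pq')); apply: ub_le_sup => //=.
  by rewrite kl_refl mule0 (le_trans q0 qq').
apply: ub_le_sup => //=; rewrite p0 p1; split => //; apply: le_trans hb.
by rewrite lee_wpmul2l ?lee_fin//; exact: kl_decr.
Qed.

Theorem theorem6 (R : realType)
  (dZ : measure_display) (Z : measurableType dZ)
  (dF : measure_display) (F : measurableType dF)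
  (dA : measure_display) (Alg : measurableType dA)
  (ell : F -> Z -> R)
  (ell01 : forall f z, 0 <= ell f z <= 1)
  (ell_meas : measurable_fun setT (fun p : (F * Z)%type => ell p.1 p.2))
  (alg : Alg -> seq Z -> probability F R)
  (alg_meas : forall (k : nat) (B : set F), measurable B ->
     measurable_fun setT (fun p : (Alg * k.-tuple Z)%type => (alg p.1 p.2 B : \bar R)))
  (mmax : nat) (mmax_gt0 : (0 < mmax)%N)
  (mu : probability (giry Z R * nat)%type R)
  (mu_supp : mu [set e : (giry Z R * nat)%type |
                   e.1 setT = 1%E /\ (1 <= e.2 <= mmax)%N] = 1%E)
  (tau : probability (task Z R mmax) R) (tau_law : env_law mu tau)
  (n : nat) (n_gt0 : (0 < n)%N)
  (Pr : probability (n.-tuple (task Z R mmax)) R) (Pr_law : iid_law tau Pr)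
  (pi : probability Alg R)
  (calP : Alg -> probability (giry F R) R)
  (calP_supp : forall A, on_prob_measures (calP A))
  (frakP : Alg -> probability (giry F R * n.-tuple F)%type R)
  (frakP_law : forall A, hyperprior_law (calP A) (frakP A))
  (delta : R) (delta_gt0 : 0 < delta) :
  exists G : set (n.-tuple (task Z R mmax)),
    [/\ measurable G, ((1 - delta)%:E <= Pr G)%E &
    forall w, G w ->
    forall (rho : probability Alg R)
           (calQ : Alg -> probability (giry F R) R)
           (frakQ : Alg -> probability (giry F R * n.-tuple F)%type R),
      (forall A, on_prob_measures (calQ A)) ->
      (forall A, hyperpost_law (calQ A)
                   (fun i => alg A (dataset (tnth w i))) (frakQ A)) ->
      measurable_fun setT (fun A => KL (frakQ A) (frakP A)) ->
      let C := (KL rho pi + (\int[rho]_A KL (frakQ A) (frakP A))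
                + (ln (2 / delta))%:E)%E in
      let c1 := \sum_(i < n) ln (2 * Num.sqrt ((tnth w i).1.2)%:R) in
      (meta_risk alg ell tau rho <=
       (klinv n
          (klinv_multi (fun i => (tnth w i).1.2)
             (fun i => emp_risk alg ell rho (dataset (tnth w i)))
             (C + c1%:E)%E)
          (KL rho pi + (ln (4 * Num.sqrt n%:R / delta))%:E)%E)%:E)%E].
Proof.
(* For delta >= 1 the empty event suffices; otherwise 4 sqrt n / delta >= 1, so the outer budget is
   nonnegative as [le_klinv] requires. *)
have [delta1|delta1] := leP 1 delta.
  by exists set0; split => //; rewrite measure0 lee_fin subr_le0.
(* Each of the two Markov events may fail with probability delta / 2. *)
have b0 : 0 < 2 / delta by rewrite divr_gt0.
have bV : (2 / delta)^-1 = delta / 2 by rewrite invf_div.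
have [G1 [mG1 PG1 HG1]] :=
  training_bound ell01 ell_meas alg_meas pi frakP mmax_gt0 tau_law Pr_law b0.
have [G2 [mG2 PG2 HG2]] :=
  environment_bound ell01 ell_meas alg_meas pi n_gt0 Pr_law b0.
have [mG3 PG3] := iid_support mu_supp tau_law Pr_law.
set G3 := [set w | _] in mG3 PG3.
exists (G1 `&` G2 `&` G3); split.
- by apply: measurableI => //; exact: measurableI.
- have {}PG3 : ((1 - 0)%:E <= Pr G3)%E by rewrite PG3 subr0.
  have := probability_setI_ge (measurableI _ _ mG1 mG2) mG3
    (probability_setI_ge mG1 mG2 PG1 PG2) PG3.
  by rewrite addr0 bV -splitr.
move=> w [[G1w G2w] G3w] rho calQ frakQ _ frakQ_law mKL /=.
rewrite (meta_riskE ell01 ell_meas alg_meas) lee_fin.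
have risk01 i : 0 <= task_risk ell alg rho (tnth w i) <= 1. by exact: task_risk01.
have /andP[mean_le le1] := le_klinv_multi n_gt0 risk01
  (HG1 w G1w G3w rho calQ frakQ frakQ_law mKL).
have /andP[mean0 _] := mean01 n_gt0 risk01.
have sqn1 : 1 <= Num.sqrt n%:R :> R by rewrite -[leLHS]sqrtr1 ler_sqrt// ler1n.
have E : 2 * Num.sqrt n%:R * (2 / delta) = 4 * Num.sqrt n%:R / delta by field; rewrite gt_eqF.
apply: (le_klinv mean0 mean_le le1).
- apply: (@fine_integral01 _ _ _ rho (meta_loss ell alg tau)).
    exact: measurable_meta_loss.
  by move=> a; exact: meta_loss01.
- rewrite adde_ge0 ?KL_ge0// lee_fin ln_ge0// ler_pdivlMr// mul1r.
  by lra.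
- by rewrite -E; exact: HG2.
Qed.
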